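(* Let $\mathbb{K}$ be an algebraically closed field of characteristic $0$, let $d_1,\dots,d_6\in\mathbb{K}$ be generic parameters as in the context, and let $I$, $S=V(I)\subset\mathcal{L}_S\subset\mathbb{P}^{44}$ be the associated ideal, surface and $3$-dimensional linear subspace defined in the context. Let $\phi:\mathbb{P}^3\to\mathcal{L}_S\subset\mathbb{P}^{44}$ be a linear map onto $\mathcal{L}_S$, with associated ring map $\phi^*:\mathbb{K}[x_{ij},y_{ijklmn}]\to\mathbb{K}[x,y,z,w]$, and consider $S\cong\phi^{-1}(S)\subset\mathbb{P}^3$. Then the images under $\phi^*$ of the $120$ $W(E_6)$-conjugates (counted up to sign) of $$x_{12}x_{23}x_{31}-x_{13}x_{32}x_{21}$$ are the $120$ essentially distinct Cayley-Salmon equations of $\phi^{-1}(S)$. That is, setting each such image to $0$ gives a Cayley-Salmon equation of $\phi^{-1}(S)$, and every Cayley-Salmon equation of $\phi^{-1}(S)$ is essentially the same as exactly one of these $120$.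
   Context: **Cayley-Salmon equations.** A Cayley-Salmon equation for a smooth cubic surface $X\subset\mathbb{P}^3$ is an equation $l_1l_2l_3-m_1m_2m_3=0$, with $l_i,m_j$ homogeneous linear forms in four variables, whose zero set is $X$. Two such equations are considered essentially the same if they differ by rescaling the linear forms by nonzero constants, permuting the $l_i$ among themselves, permuting the $m_j$ among themselves, and exchanging the two triples. Equivalently, they are essentially the same if they determine the same unordered pair of unordered triples of planes $\{\{V(l_1),V(l_2),V(l_3)\},\{V(m_1),V(m_2),V(m_3)\}\}$. A smooth cubic surface has exactly $120$ essentially distinct Cayley-Salmon equations. **Parameters.** $d_1,\dots,d_6\in\mathbb{K}$ are such that the six points $p_i=[1:d_i:d_i^3]\in\mathbb{P}^2$ are distinct, no three are collinear and no conic contains all six. Equivalently, $d_i\ne d_j$ for $i\neq j$, $d_i+d_j+d_k\neq 0$ for distinct $i,j,k$, and $d_1+\dots+d_6\ne0$. **The 27 labels and the 45 variables.** The $27$ lines on the blow-up of $\mathbb{P}^2$ at $p_1,\dots,p_6$ are: $E_i$ (exceptional curve over $p_i$); $F_{ij}=F_{ji}$ (proper transform of the line through $p_i,p_j$); $G_j$ (proper transform of the conic through the five points other than $p_j$). The $45$ tritangent triples are $\{E_i,G_j,F_{ij}\}$ ($i\neq j$; $30$ of them) and $\{F_{ij},F_{kl},F_{mn}\}$ with $\{i,j\}\sqcup\{k,l\}\sqcup\{m,n\}=\{1,\dots,6\}$ ($15$ of them). The homogeneous coordinates on $\mathbb{P}^{44}$ are variables $x_{ij}$ ($i\ne j$),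 labelled by $\{E_i,G_j,F_{ij}\}$, and $y_{ijklmn}$, labelled by $\{F_{ij},F_{kl},F_{mn}\}$ (depending only on the partition). **The action of $W(E_6)$.** The Weyl group $W(E_6)$ is generated by the following reflections, which act linearly on $(d_1,\dots,d_6)$ and by permutations on the $27$ labels, hence by permutations on the $45$ tritangent triples and on the variables. - $s_{ij}$ (root $d_i-d_j$) exchanges the indices $i$ and $j$ everywhere. - $s_{ijk}$ (root $\sigma=d_i+d_j+d_k$) sends $d_a\mapsto d_a-\tfrac23\sigma$ for $a\in\{i,j,k\}$ and $d_a\mapsto d_a+\tfrac13\sigma$ for $a\notin\{i,j,k\}$. With $\{l,m,n\}=\{1,\dots,6\}\setminus\{i,j,k\}$, it exchanges $E_i\leftrightarrow F_{jk}$, $E_j\leftrightarrow F_{ik}$, $E_k\leftrightarrow F_{ij}$, $G_l\leftrightarrow F_{mn}$, $G_m\leftrightarrow F_{ln}$, $G_n\leftrightarrow F_{lm}$, and fixes all other labels. To form the conjugates of a polynomial whose coefficients are polynomials in $d_1,\dots,d_6$, act simultaneously on the coefficients (viewed as polynomials in the $d_i$) and on the variables. Conjugates are taken up to sign. **The ideal $I$, the surface $S$ and the linear space $\mathcal{L}_S$.** $I\subset\mathbb{K}[x_{ij},y_{ijklmn}]$ is the ideal generated by the $270$ $W(E_6)$-conjugates of $$(d_3-d_4)(d_1+d_3+d_4)x_{21}-(d_2-d_4)(d_1+d_2+d_4)x_{31}+(d_2-d_3)(d_1+d_2+d_3)x_{41}$$ together with the $120$ $W(E_6)$-conjugates of $x_{12}x_{23}x_{31}-x_{13}x_{32}x_{21}$.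 Set $S=V(I)\subset\mathbb{P}^{44}$. By a theorem of Cueto and Deopurkar, $S$ is isomorphic to the blow-up of $\mathbb{P}^2$ at $p_1,\dots,p_6$ (a smooth cubic surface). $\mathcal{L}_S$ is the linear span of $S$ in $\mathbb{P}^{44}$; it is the zero locus of the $270$ linear forms above and is isomorphic to $\mathbb{P}^3$. A linear map $\phi:\mathbb{P}^3\to\mathcal{L}_S$ onto $\mathcal{L}_S$ is an isomorphism onto its image, given by $45$ linear forms in $x,y,z,w$; $\phi^*$ substitutes these linear forms for the variables $x_{ij},y_{ijklmn}$. *)

(* Defs.v *)
From HB Require Import structures.
From mathcomp Require Import all_boot all_order all_algebra all_fingroup.
From mathcomp.multinomials Require Export mpoly.

Set Implicit Arguments.
Unset Strict Implicit.
Unset Printing Implicit Defensive.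

Import GRing.Theory.
Local Open Scope ring_scope.

(* The indices 1, ..., 6 of the six points. *)
Definition i1 : 'I_6 := Ordinal (isT : (0 < 6)%N).
Definition i2 : 'I_6 := Ordinal (isT : (1 < 6)%N).
Definition i3 : 'I_6 := Ordinal (isT : (2 < 6)%N).
Definition i4 : 'I_6 := Ordinal (isT : (3 < 6)%N).
Definition i5 : 'I_6 := Ordinal (isT : (4 < 6)%N).
Definition i6 : 'I_6 := Ordinal (isT : (5 < 6)%N).

(* The six points [1 : d_i : d_i^3] of the projective plane.  A point of a
   projective space is represented by a nonzero row vector, and two vectors
   represent the same point iff they span the same line. *)
Definition plane_point (K : fieldType) (d : 'I_6 -> K) (i : 'I_6) : 'rV[K]_3 :=
  \row_(k < 3) (d i ^+ nth 0%N [:: 0%N; 1%N; 3%N] k).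

Definition on_plane_curve (K : fieldType) (e : nat) (d : 'I_6 -> K)
    (A : {set 'I_6}) : Prop :=
  exists q : {mpoly K[3]},
    [/\ q != 0, q \is e.-homog
      & forall i, i \in A -> q.@[fun k => plane_point d i 0 k] = 0].

Definition generic_parameters (K : fieldType) (d : 'I_6 -> K) : Prop :=
  [/\ forall i j, i != j -> ~~ (plane_point d i == plane_point d j)%MS,
      forall A : {set 'I_6}, #|A| = 3%N -> ~ on_plane_curve 1 d A
    & ~ on_plane_curve 2 d [set: 'I_6]].

(* The 27 labels.  The label F_ij is carried by the two-element set {i, j}. *)
Definition pair := {B : {set 'I_6} | #|B| == 2%N}.
Definition label := ('I_6 + 'I_6 + pair)%type.

Fact pair12_proof : #|[set i1; i2]| == 2%N.
Proof. by rewrite cards2. Qed.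
Definition pair12 : pair :=
  exist (fun B : {set 'I_6} => #|B| == 2%N) [set i1; i2] pair12_proof.

Definition labE (i : 'I_6) : label := inl (inl i).
Definition labG (j : 'I_6) : label := inl (inr j).
(* Only meaningful for i != j; the default value of insubd is irrelevant. *)
Definition labF (i j : 'I_6) : label := inr (insubd pair12 [set i; j]).

Definition is_tritangent (T : {set label}) : bool :=
  [exists i : 'I_6, exists j : 'I_6,
     (i != j) && (T == [set labE i; labG j; labF i j])]
  || [exists p : 'S_6,
        T == [set labF (p i1) (p i2); labF (p i3) (p i4); labF (p i5) (p i6)]].

Definition tritangent := {T : {set label} | is_tritangent T}.

Fact tritangent12_proof : is_tritangent [set labE i1; labG i2; labF i1 i2].
Proof.
apply/orP; left; apply/existsP; exists i1; apply/existsP; exists i2.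
by rewrite eqxx.
Qed.
Definition tritangent12 : tritangent :=
  exist is_tritangent _ tritangent12_proof.

(* The number (45) of tritangent triples: the variables of the coordinate ring
   of P^44 are the 'X_k for k : 'I_ntri, indexed through enum_rank. *)
Definition ntri : nat := #|{: tritangent}|.

Definition tri_index (T : tritangent) : 'I_ntri := enum_rank T.

Definition xindex (i j : 'I_6) : 'I_ntri :=
  tri_index (insubd tritangent12 [set labE i; labG j; labF i j]).

(* The reflections s_ij and s_ijk.  For s_ijk the six indices i, j, k, l, m, n
   of the root d_i + d_j + d_k and of its complement are p 1, ..., p 6 for a
   permutation p. *)
Definition swap_label (i j : 'I_6) (x : label) : label :=
  match x with
  | inl (inl a) => labE (tperm i j a)
  | inl (inr a) => labG (tperm i j a)
  | inr B => inr (insubd pair12 (tperm i j @: val B))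
  end.

Definition triple_label (p : 'S_6) : {perm label} :=
  (tperm (labE (p i1)) (labF (p i2) (p i3))
   * tperm (labE (p i2)) (labF (p i1) (p i3))
   * tperm (labE (p i3)) (labF (p i1) (p i2))
   * tperm (labG (p i4)) (labF (p i5) (p i6))
   * tperm (labG (p i5)) (labF (p i4) (p i6))
   * tperm (labG (p i6)) (labF (p i4) (p i5)))%g.

Section Polynomials.
Variable K : fieldType.

Definition swap_param (i j a : 'I_6) : {mpoly K[6]} := 'X_(tperm i j a).

Definition triple_root (p : 'S_6) : {mpoly K[6]} :=
  'X_(p i1) + 'X_(p i2) + 'X_(p i3).

Definition triple_param (p : 'S_6) (a : 'I_6) : {mpoly K[6]} :=
  if a \in [set p i1; p i2; p i3]
  then 'X_a - (2%:R / 3%:R : K) *: triple_root p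
  else 'X_a + (1 / 3%:R : K) *: triple_root p.

(* Polynomials in the 45 variables with coefficients polynomial in d_1..d_6. *)
Definition dpoly := {mpoly {mpoly K[6]}[ntri]}.

(* All label maps used below send tritangent triples to tritangent triples, so
   the default value of insubd is never taken. *)
Definition act_tritangent (s : label -> label) (T : tritangent) : tritangent :=
  insubd T (s @: val T).

Definition act_index (s : label -> label) (k : 'I_ntri) : 'I_ntri :=
  tri_index (act_tritangent s (enum_val k)).

(* Simultaneous substitution d_a |-> r a and x_T |-> x_(s T). *)
Definition act_dpoly (r : 'I_6 -> {mpoly K[6]}) (s : label -> label)
    (P : dpoly) : dpoly :=
  map_mpoly (fun c : {mpoly K[6]} => c \mPo [tuple r a | a < 6]) P
    \mPo [tuple 'X_(act_index s k) | k < ntri].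

(* The W(E_6)-orbit of P.  The generating reflections are involutions, so no
   closure under inverses is needed. *)
Inductive conjugate (P : dpoly) : dpoly -> Prop :=
| conjugate_refl : conjugate P P
| conjugate_swap (Q : dpoly) (i j : 'I_6) : i != j -> conjugate P Q ->
    conjugate P (act_dpoly (swap_param i j) (swap_label i j) Q)
| conjugate_triple (Q : dpoly) (p : 'S_6) : conjugate P Q ->
    conjugate P (act_dpoly (triple_param p) (triple_label p) Q).

Definition specialize (d : 'I_6 -> K) (P : dpoly) : {mpoly K[ntri]} :=
  map_mpoly (fun c : {mpoly K[6]} => c.@[d]) P.

Definition conjugate_at (d : 'I_6 -> K) (P : dpoly) (q : {mpoly K[ntri]}) :
    Prop :=
  exists2 Q, conjugate P Q & q = specialize d Q.

Definition dvar (a : 'I_6) : {mpoly K[6]} := 'X_a.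
Definition xvar (i j : 'I_6) : dpoly := 'X_(xindex i j).

Definition base_linear : dpoly :=
  ((dvar i3 - dvar i4) * (dvar i1 + dvar i3 + dvar i4)) *: xvar i2 i1
  - ((dvar i2 - dvar i4) * (dvar i1 + dvar i2 + dvar i4)) *: xvar i3 i1
  + ((dvar i2 - dvar i3) * (dvar i1 + dvar i2 + dvar i3)) *: xvar i4 i1.

Definition base_cubic : dpoly :=
  xvar i1 i2 * xvar i2 i3 * xvar i3 i1 - xvar i1 i3 * xvar i3 i2 * xvar i2 i1.

Definition generatorI (d : 'I_6 -> K) (q : {mpoly K[ntri]}) : Prop :=
  conjugate_at d base_linear q \/ conjugate_at d base_cubic q.

Definition idealI (d : 'I_6 -> K) (f : {mpoly K[ntri]}) : Prop :=
  exists n (a g : 'I_n -> {mpoly K[ntri]}),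
    (forall i, generatorI d (g i)) /\ f = \sum_(i < n) a i * g i.

(* Subsets of P^(n-1) are predicates on 'rV_n, read on nonzero vectors. *)
Definition surfaceS (d : 'I_6 -> K) (v : 'rV[K]_ntri) : Prop :=
  v != 0 /\ forall f, idealI d f -> f.@[fun k => v 0 k] = 0.

Definition linear_span n (S : 'rV[K]_n -> Prop) (v : 'rV[K]_n) : Prop :=
  forall W : 'M[K]_n, (forall s, S s -> (s <= W)%MS) -> (v <= W)%MS.

Definition spaceLS (d : 'I_6 -> K) : 'rV[K]_ntri -> Prop :=
  linear_span (surfaceS d).

(* phi : P^m -> P^n is v |-> v *m M; it is defined everywhere on P^m exactly
   when M is row_free, and it is then injective. *)
Definition linear_map_onto m n (M : 'M[K]_(m, n)) (L : 'rV[K]_n -> Prop) :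
    Prop :=
  row_free M /\ forall w, L w <-> exists v : 'rV[K]_m, w = v *m M.

Definition pullback m n (M : 'M[K]_(m, n)) (f : {mpoly K[n]}) : {mpoly K[m]} :=
  f \mPo [tuple \sum_(i < m) M i k *: 'X_i | k < n].

Definition preimage m n (M : 'M[K]_(m, n)) (S : 'rV[K]_n -> Prop)
    (v : 'rV[K]_m) : Prop := S (v *m M).

Definition CayleySalmon (X : 'rV[K]_4 -> Prop) (l m : 'I_3 -> {mpoly K[4]}) :
    Prop :=
  [/\ forall i, l i \is 1.-homog,
      forall i, m i \is 1.-homog
    & forall v : 'rV[K]_4, v != 0 ->
        X v <-> (\prod_(i < 3) l i - \prod_(i < 3) m i).@[fun k => v 0 k] = 0].

Definition same_triple (l l' : 'I_3 -> {mpoly K[4]}) : Prop :=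
  exists (s : 'S_3) (c : 'I_3 -> K),
    forall i, c i != 0 /\ l' i = c i *: l (s i).

Definition essentially_same (l m l' m' : 'I_3 -> {mpoly K[4]}) : Prop :=
  (same_triple l l' /\ same_triple m m')
  \/ (same_triple l m' /\ same_triple m l').

(* A Cayley-Salmon equation remembers its two triples of linear forms, not only
   its expanded polynomial.  The equation phi^* q = 0 is therefore read through
   the two monomials of the binomial q. *)
Definition image_equation (M : 'M[K]_(4, ntri)) (q : {mpoly K[ntri]})
    (l m : 'I_3 -> {mpoly K[4]}) : Prop :=
  exists t u : 'I_3 -> 'I_ntri,
    [/\ q = \prod_(i < 3) 'X_(t i) - \prod_(i < 3) 'X_(u i),
        forall i, l i = pullback M 'X_(t i)
      & forall i, m i = pullback M 'X_(u i)].

End Polynomials.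

Arguments base_linear {K}.
Arguments base_cubic {K}.

(* c lists, once each up to sign, the elements satisfying P. *)
Definition enumerates_up_to_sign (V : zmodType) n (c : 'I_n -> V)
    (P : V -> Prop) : Prop :=
  [/\ forall i, P (c i),
      forall q, P q -> exists i, q = c i \/ q = - c i
    & forall i j, c i = c j \/ c i = - c j -> i = j].

(* Main.v *)
Require Import Defs.
From HB Require Import structures.
From mathcomp Require Import all_boot all_order all_algebra all_fingroup.
From mathcomp.multinomials Require Import mpoly.
From mathcomp Require Import ring zify.

Set Implicit Arguments.
Unset Strict Implicit.
Unset Printing Implicit Defensive.

Import GRing.Theory.
Local Open Scope ring_scope.

(** The forms phi^* x_T are 45 linear forms on a four-dimensional space which
    satisfy the 270 linear relations, because these hold on the span of S, and
    have no common zero but 0. Such a system, for parameters at which none of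
    the 36 positive roots of E_6 vanishes, is called a configuration below. A
    reflection turns a configuration into another one ([config_refl]), so a
    statement about every line, plane or triple only has to be proved for one
    representative of its orbit under W(E_6). The group is used through words
    in six simple reflections acting on numerical codes ([conjugate_word],
    [conjugate_at_cubicP]), so that questions of incidence are decided by
    computation.

    The images are equations of one surface. Five simple reflections change
    the base cubic at most by a sign. The remaining one exchanges two indices
    and replaces the cubic by a nonzero multiple of it on the span: the
    difference is divisible by a linear relation among six of the coordinates,
    itself a consequence of the 270 relations ([six_term_relation],
    [cubic_identity]). Hence all 120 conjugates vanish at the same points of
    the span ([cubic_word]), and these are the points of S ([preimage_cubic]).

    Every Cayley-Salmon equation is an image. The five forms belonging to the
    tritangent triples through a label span a pencil, so each label gives a
    line, and each tritangent plane meets the surface in its three lines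
    ([plane_section]). A plane through one of the 27 lines cuts out that line
    and a residual conic, whose discriminant is, along the pencil, a form of
    degree five with the five tritangent planes as roots; so a plane that
    contains a second line of the surface is tritangent ([residual_line]). It
    follows that the surface has no other lines ([known_line]) and contains no
    plane ([no_plane]). If l1 l2 l3 - m1 m2 m3 vanishes exactly on the surface,
    then each line V(l_i, m_j) lies on it, and therefore each l_i and each m_j
    defines a tritangent plane ([L_tritangent]). A line of the surface in the
    plane l_i = 0 lies in some plane m_j = 0, and conversely, so the two
    triples of planes cover the same lines; an exhaustive search shows that
    only the 120 conjugate pairs have this property ([trihedral_of_cover]).

    Uniqueness holds because distinct tritangent triples give distinct planes
    ([plane_inj]) and the 120 unordered pairs of triples are distinct
    ([pair_at_inj]); the latter also separates the 120 binomials up to sign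
    ([cubic_at_enumerates]). *)

(** * Codes for the 27 labels and the 45 tritangent triples *)

(** Indices are counted from 0. The label E_i has code i, G_j has code 6 + j,
    and F_ij has code 12 plus the position of (i, j) in the list. *)
Definition pair_codes : seq (nat * nat) :=
  [seq ab <- [seq (a, b) | a <- iota 0 6, b <- iota 0 6] | (ab.1 < ab.2)%N].

Definition codeF (a b : nat) : nat :=
  (12 + index (minn a b, maxn a b) pair_codes)%N.

Definition label_of (c : nat) : label :=
  if (c < 6)%N then labE (inord c)
  else if (c < 12)%N then labG (inord (c - 6))
  else let ab := nth (0, 1)%N pair_codes (c - 12) in
       labF (inord ab.1) (inord ab.2).

Definition disjoint_codes (c c' : nat) : bool :=
  let p := nth (0, 1)%N pair_codes (c - 12) in
  let p' := nth (0, 1)%N pair_codes (c' - 12) in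
  uniq [:: p.1; p.2; p'.1; p'.2].

Definition codes_xij : seq (seq nat) :=
  [seq [:: ab.1; 6 + ab.2; codeF ab.1 ab.2]%N
     | ab <- [seq (a, b) | a <- iota 0 6, b <- iota 0 6] & ab.1 != ab.2].

Definition codes_y : seq (seq nat) :=
  [seq [:: abc.1.1; abc.1.2; abc.2]
     | abc <- [seq (ab, c) | ab <- [seq (a, b) | a <- iota 12 15, b <- iota 12 15],
                             c <- iota 12 15]
     & [&& (abc.1.1 < abc.1.2 < abc.2)%N, disjoint_codes abc.1.1 abc.1.2,
           disjoint_codes abc.1.1 abc.2 & disjoint_codes abc.1.2 abc.2]].

Definition tri_codes : seq (seq nat) := Eval vm_compute in codes_xij ++ codes_y.

Definition lines (t : nat) : seq nat := nth [::] tri_codes t.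
Definition find_tri (l : seq nat) : nat := index (sort leq l) tri_codes.

Lemma size_tri_codes : size tri_codes = 45%N.
Proof. by vm_compute. Qed.

Lemma find_tri_lt l : sort leq l \in tri_codes -> (find_tri l < 45)%N.
Proof. by rewrite -index_mem size_tri_codes. Qed.

Lemma lines_find l : sort leq l \in tri_codes ->
  lines (find_tri l) = sort leq l.
Proof. by move=> h; rewrite /lines /find_tri nth_index. Qed.

Lemma all_ltP (n : nat) (P : pred nat) :
  reflect (forall k, (k < n)%N -> P k) (all P (iota 0 n)).
Proof.
apply: (iffP allP) => h k; first by move=> kn; apply: h; rewrite mem_iota.
by rewrite mem_iota /= add0n; apply: h.
Qed.

Lemma lines_lt t c : (t < 45)%N -> c \in lines t -> (c < 27)%N.
Proof.
have /all_ltP h : all (fun t => all (fun c => c < 27)%N (lines t)) (iota 0 45).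
  by vm_compute.
by move=> /h /allP; apply.
Qed.

Lemma pair_codesP k : (k < 15)%N ->
  let ab := nth (0, 1)%N pair_codes k in
  [/\ (ab.1 < 6)%N, (ab.2 < 6)%N & (ab.1 < ab.2)%N].
Proof.
have /all_ltP h : all (fun k => let ab := nth (0, 1)%N pair_codes k in
  [&& ab.1 < 6, ab.2 < 6 & ab.1 < ab.2])%N (iota 0 15) by vm_compute.
by move=> /h /and3P.
Qed.

Lemma labF_sym a b : labF a b = labF b a.
Proof. by rewrite /labF setUC. Qed.

Lemma val_labF a b : a != b ->
  val (insubd pair12 [set a; b]) = [set a; b].
Proof. by move=> ab; rewrite val_insubd cards2 ab. Qed.

Lemma labF_inj a b a' b' : a != b -> a' != b' ->
  labF a b = labF a' b' -> [set a; b] = [set a'; b'].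
Proof. by move=> ab ab' [/(congr1 val)]; rewrite !val_labF. Qed.

Lemma codeF_lt a b : (a < 6)%N -> (b < 6)%N -> a != b -> (codeF a b < 27)%N.
Proof.
have /allP h : all (fun ab => (ab.1 != ab.2) ==> (codeF ab.1 ab.2 < 27))%N
   [seq (a, b) | a <- iota 0 6, b <- iota 0 6] by vm_compute.
move=> a6 b6 ab; have /h /implyP : (a, b) \in [seq (a, b) | a <- iota 0 6, b <- iota 0 6].
  by apply: allpairs_f; rewrite mem_iota.
exact.
Qed.

Lemma label_codeF a b : (a < 6)%N -> (b < 6)%N -> a != b ->
  label_of (codeF a b) = labF (inord a) (inord b).
Proof.
have /allP h : all (fun ab => (ab.1 != ab.2) ==>
   [&& (12 <= codeF ab.1 ab.2),
    nth (0,1) pair_codes (codeF ab.1 ab.2 - 12) == (minn ab.1 ab.2, maxn ab.1 ab.2) &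
   (minn ab.1 ab.2, maxn ab.1 ab.2) \in [:: ab; (ab.2, ab.1)]])%N
   [seq (a, b) | a <- iota 0 6, b <- iota 0 6] by vm_compute.
move=> a6 b6 ab; have /h /implyP : (a, b) \in [seq (a, b) | a <- iota 0 6, b <- iota 0 6].
  by apply: allpairs_f; rewrite mem_iota.
move=> /(_ ab) /and3P [c12 /eqP e m].
rewrite /label_of ltnNge (leq_trans _ c12) // ltnNge c12 /= e.
move: m; rewrite !inE => /orP [] /eqP -> //=.
by rewrite labF_sym.
Qed.

Lemma inord_inj6 a b : (a < 6)%N -> (b < 6)%N ->
  (@inord 5 a == inord b) = (a == b).
Proof.
by move=> a6 b6; apply/eqP/eqP => [/(congr1 val)|->//]; rewrite /= !inordK.
Qed.

Lemma label_of_inj c c' : (c < 27)%N -> (c' < 27)%N ->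
  label_of c = label_of c' -> c = c'.
Proof.
move=> c27 c'27; rewrite /label_of.
case c6: (c < 6)%N; case c'6: (c' < 6)%N; case c12: (c < 12)%N;
  case c'12: (c' < 12)%N => //=; try by case=> /(congr1 val); rewrite /= !inordK; lia.
have [k [k15 ->]] : exists k, (k < 15)%N /\ c = (12 + k)%N.
  by exists (c - 12)%N; lia.
have [k' [k'15 ->]] : exists k, (k < 15)%N /\ c' = (12 + k)%N.
  by exists (c' - 12)%N; lia.
rewrite !addKn.
have [] := pair_codesP k15; have [] := pair_codesP k'15.
have : uniq pair_codes by vm_compute.
have sz : size pair_codes = 15%N by vm_compute.
move=> /(nth_uniq (0,1)%N) U.
case ek: (nth _ pair_codes k) => [a b]; case ek': (nth _ pair_codes k') => [a' b'] /=.
move=> a'6 b'6 ab' a6 b6 ab E.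
congr (12 + _)%N; apply/eqP; rewrite -(U k k') ?sz // ek ek'.
have {E} E : [set @inord 5 a; inord b] = [set inord a'; inord b'].
  by apply: labF_inj => //; rewrite inord_inj6 // neq_ltn ?ab ?ab'.
have : inord a \in [set @inord 5 a'; inord b'] by rewrite -E set21.
have : inord b \in [set @inord 5 a'; inord b'] by rewrite -E set22.
rewrite !inE !inord_inj6 // => /orP [] /eqP eb /orP [] /eqP ea; subst.
- by rewrite ltnn in ab.
- by move: (ltn_trans ab ab'); rewrite ltnn.
- by [].
- by rewrite ltnn in ab.
Qed.

Lemma label_codeG (a : 'I_6) : label_of (6 + a) = labG a.
Proof.
rewrite /label_of ltnNge leq_addr /= (ltn_add2l 6 a 6) ltn_ord.
by rewrite addKn inord_val.
Qed.

Definition tset (t : nat) : {set label} := [set x in map label_of (lines t)].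

Definition tri_of (t : nat) : 'I_ntri := tri_index (insubd tritangent12 (tset t)).

Lemma mem_tset t c : (t < 45)%N -> (c < 27)%N ->
  (label_of c \in tset t) = (c \in lines t).
Proof.
move=> t45 c27; rewrite inE; apply/mapP/idP => [[c' c't] e|ct]; last by exists c.
by rewrite (label_of_inj c27 _ e) // (lines_lt t45).
Qed.

Lemma lines_sorted t : (t < 45)%N -> sorted ltn (lines t).
Proof.
have /all_ltP h : all (fun t => sorted ltn (lines t)) (iota 0 45) by vm_compute.
exact: h.
Qed.

Lemma lines_inj t u : (t < 45)%N -> (u < 45)%N -> lines t =i lines u -> t = u.
Proof.
move=> t45 u45 e.
have : lines t = lines u.
  by apply: (irr_sorted_eq ltn_trans ltnn _ _ e); apply: lines_sorted.
move/eqP; rewrite /lines nth_uniq ?size_tri_codes //.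
by move/eqP.
Qed.

Lemma tset_inj t u : (t < 45)%N -> (u < 45)%N -> tset t = tset u -> t = u.
Proof.
move=> t45 u45 e; apply: lines_inj => // c.
have [c27|c27] := ltnP c 27; first by rewrite -!mem_tset // e.
by apply/idP/idP => h; [have := lines_lt t45 h | have := lines_lt u45 h];
  rewrite ltnNge c27.
Qed.

Lemma tset3 t a b c : lines t = [:: a; b; c] ->
  tset t = [set label_of a; label_of b; label_of c].
Proof. by rewrite /tset => ->; apply/setP => x; rewrite !inE orbA. Qed.

(** A partition into three pairs is given by a list of the six indices in
    which the members of a pair are adjacent. *)
Definition ycode (l : seq nat) : seq nat :=
  [:: codeF (nth 0 l 0) (nth 0 l 1); codeF (nth 0 l 2) (nth 0 l 3);
      codeF (nth 0 l 4) (nth 0 l 5)]%N.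

Definition xcode (a b : nat) : nat := find_tri [:: a; 6 + b; codeF a b]%N.

Lemma xcodeP a b : (a < 6)%N -> (b < 6)%N -> a != b ->
  (xcode a b < 45)%N /\ lines (xcode a b) = [:: a; 6 + b; codeF a b]%N.
Proof.
have /allP h : all (fun ab => (ab.1 != ab.2) ==>
   let l := [:: ab.1; 6 + ab.2; codeF ab.1 ab.2]%N in
   (sort leq l == l) && (l \in tri_codes))
   [seq (a, b) | a <- iota 0 6, b <- iota 0 6] by vm_compute.
move=> a6 b6 ab; have /h /implyP : (a, b) \in [seq (a, b) | a <- iota 0 6, b <- iota 0 6].
  by apply: allpairs_f; rewrite mem_iota.
move=> /(_ ab) /= /andP [/eqP e m]; split.
  by apply: find_tri_lt; rewrite e.
by rewrite lines_find e.
Qed.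

Lemma tset_xcode a b : a != b :> 'I_6 ->
  tset (xcode a b) = [set labE a; labG b; labF a b].
Proof.
move=> ab; have [_ e] := xcodeP (ltn_ord a) (ltn_ord b) ab.
rewrite (tset3 e) label_codeF // !inord_val; congr [set _; _; _].
  by rewrite /label_of ltn_ord inord_val.
exact: label_codeG.
Qed.

Lemma ycodeP l : perm_eq l (iota 0 6) ->
  (find_tri (ycode l) < 45)%N /\ lines (find_tri (ycode l)) = sort leq (ycode l).
Proof.
rewrite -mem_permutations.
have /allP h : all (fun l => sort leq (ycode l) \in tri_codes)
  (permutations (iota 0 6)) by vm_compute.
by move=> /h m; split; [exact: find_tri_lt | exact: lines_find].
Qed.

Definition perm_vals (p : 'S_6) : seq nat := [seq val (p i) | i <- enum 'I_6].

Lemma perm_vals_iota p : perm_eq (perm_vals p) (iota 0 6).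
Proof.
rewrite -val_enum_ord /perm_vals (map_comp val p) perm_map // uniq_perm ?enum_uniq //.
  by rewrite map_inj_uniq ?enum_uniq //; apply: perm_inj.
move=> x; rewrite mem_enum; apply/mapP; exists (p^-1 x)%g => //.
  by rewrite mem_enum.
by rewrite permKV.
Qed.

Lemma tset_ycode (p : 'S_6) :
  tset (find_tri (ycode (perm_vals p))) =
  [set labF (p i1) (p i2); labF (p i3) (p i4); labF (p i5) (p i6)].
Proof.
have [_ e] := ycodeP (perm_vals_iota p).
have nthp (k : 'I_6) : nth 0%N (perm_vals p) k = p k.
  by rewrite (nth_map k) ?size_enum_ord // nth_ord_enum.
have cF (a b : 'I_6) : a != b ->
    label_of (codeF (p a) (p b)) = labF (p a) (p b).
  by move=> ab; rewrite label_codeF // ?inord_val // (inj_eq val_inj) (inj_eq perm_inj).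
apply/setP => x; rewrite inE e.
have /perm_map/perm_mem-> := permEl (perm_sort leq (ycode (perm_vals p))).
rewrite /ycode (nthp i1) (nthp i2) (nthp i3) (nthp i4) (nthp i5) (nthp i6) /=.
by rewrite !cF // !inE orbA.
Qed.

Lemma tritangent_code (T : {set label}) : is_tritangent T ->
  exists2 t, (t < 45)%N & T = tset t.
Proof.
case/orP.
  case/existsP=> a /existsP [b] /andP [ab /eqP ->].
  by exists (xcode a b); [have [] := xcodeP (ltn_ord a) (ltn_ord b) ab | rewrite tset_xcode].
case/existsP => p /eqP ->; rewrite -tset_ycode; eexists; last by reflexivity.
by have [] := ycodeP (perm_vals_iota p).
Qed.

Lemma perm_of_seq (l : seq nat) : perm_eq l (iota 0 6) ->
  exists p : 'S_6, l = perm_vals p.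
Proof.
move=> pl; have sl : size l = 6%N by rewrite (perm_size pl) size_iota.
have lt6 (i : 'I_6) : (nth 0 l i < 6)%N.
  have : nth 0%N l i \in l by rewrite mem_nth ?sl.
  by rewrite (perm_mem pl) mem_iota.
pose f i := Ordinal (lt6 i).
have fI : injective f.
  move=> i j /(congr1 val) /= /eqP; rewrite nth_uniq ?sl //.
    by move/eqP/val_inj.
  by rewrite (perm_uniq pl) iota_uniq.
exists (perm fI); apply: (@eq_from_nth _ 0%N).
  by rewrite sl size_map size_enum_ord.
rewrite sl => k k6; rewrite /perm_vals; rewrite (nth_map ord0) ?size_enum_ord //.
by rewrite permE /= nth_enum_ord.
Qed.

Lemma tset_tritangent t : (t < 45)%N -> is_tritangent (tset t).
Proof.
move=> t45.
have /all_ltP h : all (fun t => has (fun ab => (ab.1 != ab.2) && (t == xcode ab.1 ab.2))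
    [seq (a, b) | a <- iota 0 6, b <- iota 0 6]
  || has (fun l => t == find_tri (ycode l)) (permutations (iota 0 6))) (iota 0 45).
  by vm_compute.
case/orP: (h t t45) => /hasP.
  case=> ab /allpairsP [[a b] [a6 b6 ->]] /andP [ab' /eqP ->].
  move: a6 b6; rewrite !mem_iota !add0n => a6 b6.
  rewrite (tset_xcode (a := Ordinal a6) (b := Ordinal b6)) //.
  apply/orP; left; apply/existsP; exists (Ordinal a6); apply/existsP; exists (Ordinal b6).
  by rewrite eqxx andbT.
case=> l; rewrite mem_permutations => /perm_of_seq [p ->] /eqP ->.
rewrite tset_ycode; apply/orP; right; apply/existsP; exists p; exact: eqxx.
Qed.

Lemma val_tri_of t : (t < 45)%N ->
  val (enum_val (tri_of t)) = tset t.
Proof.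
by move=> t45; rewrite /tri_of /tri_index enum_rankK val_insubd tset_tritangent.
Qed.

Lemma tri_of_inj t u : (t < 45)%N -> (u < 45)%N -> tri_of t = tri_of u -> t = u.
Proof.
by move=> t45 u45 e; apply: tset_inj => //; rewrite -!val_tri_of // e.
Qed.

Lemma tri_of_surj (k : 'I_ntri) : exists2 t, (t < 45)%N & tri_of t = k.
Proof.
case E: (enum_val k) => [T hT].
have [t t45 eT] := tritangent_code hT; exists t => //.
apply: enum_val_inj; apply: val_inj; by rewrite val_tri_of // E.
Qed.

Lemma xindex_code (a b : 'I_6) : a != b -> xindex a b = tri_of (xcode a b).
Proof. by move=> ab; rewrite /tri_of tset_xcode. Qed.

(** Reduces the action on the variables, which is defined through sets of
    labels, to two tables of numbers. *)
Lemma act_index_code (s : label -> label) (tab ttab : nat -> nat) :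
  (forall c, (c < 27)%N -> s (label_of c) = label_of (tab c)) ->
  (forall t, (t < 45)%N -> (ttab t < 45)%N &&
     perm_eq (map tab (lines t)) (lines (ttab t))) ->
  forall t, (t < 45)%N -> act_index s (tri_of t) = tri_of (ttab t).
Proof.
move=> hs ht t t45; have /andP [u45 pe] := ht t t45.
rewrite /act_index /act_tritangent val_tri_of //; congr (tri_index _).
suff -> : [set s x | x in tset t] = tset (ttab t).
  apply: val_inj; rewrite !val_insubd tset_tritangent //.
apply/setP => x; rewrite inE -(perm_mem (perm_map label_of pe)).
apply/imsetP/mapP.
  case=> y; rewrite inE => /mapP [c ct ->] ->; exists (tab c).
    exact: map_f.
  by rewrite hs // (lines_lt t45).
case=> c' /mapP [c ct ->] ->; exists (label_of c).
  by rewrite inE; apply: map_f.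
by rewrite hs // (lines_lt t45).
Qed.

(** * The simple reflections on codes *)

Definition swap_nat (g a : nat) : nat :=
  if a == g then g.+1 else if a == g.+1 then g else a.

Definition swap_code (x y z : nat) : nat :=
  if z == x then y else if z == y then x else z.

Definition label_table (g c : nat) : nat :=
  if (g < 5)%N then
    if (c < 6)%N then swap_nat g c
    else if (c < 12)%N then (6 + swap_nat g (c - 6))%N
    else let ab := nth (0, 1)%N pair_codes (c - 12) in
         codeF (swap_nat g ab.1) (swap_nat g ab.2)
  else
   swap_code 11 (codeF 3 4) (swap_code 10 (codeF 3 5) (swap_code 9 (codeF 4 5)
     (swap_code 2 (codeF 0 1) (swap_code 1 (codeF 0 2) (swap_code 0 (codeF 1 2) c))))).

Definition tri_tables : seq (seq nat) := Eval vm_compute in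
  [seq [seq find_tri (map (label_table g) (lines t)) | t <- iota 0 45]
     | g <- iota 0 6].

(** The values [g < 5] stand for the exchange of two consecutive indices, all
    others for the reflection in d_1 + d_2 + d_3, so that every list of numbers
    is a word. *)
Definition tri_refl (g t : nat) : nat := nth 0%N (nth [::] tri_tables (minn g 5)) t.

Lemma tri_reflP g t : (t < 45)%N ->
  (tri_refl g t < 45)%N &&
     perm_eq (map (label_table g) (lines t)) (lines (tri_refl g t)).
Proof.
wlog g6 : g / (g < 6)%N.
  move=> h; have [//|g6] := ltnP g 6; first exact: h.
  have -> : tri_refl g = tri_refl 5 by rewrite /tri_refl (minn_idPr (ltnW g6)).
  have -> : label_table g = label_table 5 by rewrite /label_table ltnNge (ltnW g6).
  exact: h.
move: g g6 t; have /all_ltP h : all (fun g => all (fun t => (tri_refl g t < 45)%N &&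
   perm_eq (map (label_table g) (lines t)) (lines (tri_refl g t))) (iota 0 45)) (iota 0 6).
  by vm_compute.
by move=> g /h /all_ltP.
Qed.

Lemma tri_refl_lt g t : (t < 45)%N -> (tri_refl g t < 45)%N.
Proof. by move=> /(tri_reflP g) /andP []. Qed.

Definition tri_word (ws : seq nat) (t : nat) : nat := foldr tri_refl t ws.

Lemma tri_word_lt ws t : (t < 45)%N -> (tri_word ws t < 45)%N.
Proof. by move=> t45; elim: ws => //= g ws IH; apply: tri_refl_lt. Qed.

Lemma tri_word_cat ws ws' t : tri_word (ws ++ ws') t = tri_word ws (tri_word ws' t).
Proof. exact: foldr_cat. Qed.

Section ParameterReflections.
Variable K : fieldType.

Definition param_refl (g : nat) (d : nat -> K) (a : nat) : K :=
  if (g < 5)%N then d (swap_nat g a)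
  else if (a < 3)%N then d a - 2%:R / 3%:R * (d 0%N + d 1%N + d 2)
  else d a + 1 / 3%:R * (d 0%N + d 1%N + d 2).

Definition param_word (ws : seq nat) (d : nat -> K) : nat -> K :=
  foldl (fun d g => param_refl g d) d ws.

Lemma param_word_cat ws ws' d :
  param_word (ws ++ ws') d = param_word ws' (param_word ws d).
Proof. exact: foldl_cat. Qed.

Lemma param_word_ext ws d d' : (forall a, (a < 6)%N -> d a = d' a) ->
  forall a, (a < 6)%N -> param_word ws d a = param_word ws d' a.
Proof.
elim: ws d d' => [|g ws IH] d d' e //=; apply: IH => a a6.
rewrite /param_refl; case: ifP => g5; last by rewrite !e.
apply: e; rewrite /swap_nat; case: ifP => _; first by [].
by case: ifP => // _; apply: ltn_trans g5 _.
Qed.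

Definition params (d : 'I_6 -> K) (a : nat) : K := d (inord a).

(** Substitutions act on points contravariantly: the word is applied to the
    parameters from its first letter on and to the triples from its last. *)
Definition realizes (ws : seq nat) (r : ('I_6 -> K) -> 'I_6 -> K)
    (s : label -> label) : Prop :=
  (forall d a, (a < 6)%N -> params (r d) a = param_word ws (params d) a)
  /\ (forall t, (t < 45)%N -> act_index s (tri_of t) = tri_of (tri_word ws t)).

Definition realizable r s := exists ws, realizes ws r s.

Definition relab (p : 'S_6) (x : label) : label :=
  match x with
  | inl (inl a) => labE (p a)
  | inl (inr a) => labG (p a)
  | inr B => inr (insubd pair12 (p @: val B))
  end.

Lemma relab_labF (p : 'S_6) a b : a != b -> relab p (labF a b) = labF (p a) (p b).
Proof. by move=> ab; rewrite /labF /= val_labF // imsetU1 imset_set1. Qed.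

Lemma labFP (B : pair) : exists a b, a != b /\ inr B = labF a b.
Proof.
case: B => B cB; have /cards2P [a [b [ab eB]]] := cB.
exists a, b; split=> //; rewrite /labF; congr inr.
by apply: val_inj; rewrite val_labF.
Qed.

Lemma relabM (p q : 'S_6) x : relab (p * q)%g x = relab q (relab p x).
Proof.
case: x => [[a|a]|B]; [by rewrite /= permM | by rewrite /= permM |].
have [a [b [ab ->]]] := labFP B.
by rewrite !(relab_labF _ ab) !permM relab_labF // (inj_eq perm_inj).
Qed.

Lemma relab1 x : relab 1%g x = x.
Proof.
case: x => [[a|a]|B]; [by rewrite /= perm1 | by rewrite /= perm1 |].
have [a [b [ab ->]]] := labFP B.
by rewrite (relab_labF 1 ab) !perm1.
Qed.

Lemma relabK p : cancel (relab p) (relab p^-1).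
Proof. by move=> x; rewrite -relabM mulgV relab1. Qed.

Lemma relabVK p : cancel (relab p^-1) (relab p).
Proof. by move=> x; rewrite -relabM mulVg relab1. Qed.

Definition preserves_tritangents (s : label -> label) : Prop :=
  forall T, is_tritangent T -> is_tritangent (s @: T).

Lemma act_index_comp (s s' : label -> label) :
  preserves_tritangents s -> preserves_tritangents s' ->
  forall k, act_index (s' \o s) k = act_index s' (act_index s k).
Proof.
move=> hs hs' k; rewrite /act_index /act_tritangent /tri_index; congr enum_rank.
have hk : is_tritangent (val (enum_val k)) := valP (enum_val k).
apply: val_inj; rewrite enum_rankK !val_insubd imset_comp.
by rewrite hs // !hs' // hs.
Qed.

Lemma eq_act_index (s s' : label -> label) : s =1 s' -> act_index s =1 act_index s'.
Proof.
move=> e k; rewrite /act_index /act_tritangent; congr (tri_index (insubd _ _)).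
exact: eq_imset.
Qed.

Lemma relab_preserves p : preserves_tritangents (relab p).
Proof.
move=> T /orP [].
  case/existsP=> a /existsP [b] /andP [ab /eqP ->].
  apply/orP; left; apply/existsP; exists (p a); apply/existsP; exists (p b).
  by rewrite (inj_eq perm_inj) ab !imsetU !imset_set1 relab_labF //= eqxx.
case/existsP => q /eqP ->; apply/orP; right; apply/existsP; exists (q * p)%g.
by rewrite !imsetU !imset_set1 !relab_labF ?permM // (inj_eq perm_inj).
Qed.

Lemma swap_nat_lt g a : (g < 5)%N -> (a < 6)%N -> (swap_nat g a < 6)%N.
Proof. by rewrite /swap_nat; case: (a =P g); case: (a =P g.+1) => *; lia. Qed.

Lemma swap_nat_inj g a b : (swap_nat g a == swap_nat g b) = (a == b).
Proof. by rewrite /swap_nat; case: (a =P g); case: (a =P g.+1); case: (b =P g);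
  case: (b =P g.+1) => *; lia. Qed.

Definition tadj (g : nat) : 'S_6 := tperm (inord g) (inord g.+1).

Lemma tadjE g a : (g < 5)%N -> (a < 6)%N ->
  tadj g (inord a) = inord (swap_nat g a).
Proof.
move=> g5 a6; rewrite permE /= /swap_nat !inord_inj6 //; last by apply: ltnW.
by case: ifP => //; case: ifP.
Qed.

Lemma label_of_refl g c : (g < 5)%N -> (c < 27)%N ->
  relab (tadj g) (label_of c) = label_of (label_table g c).
Proof.
move=> g5 c27; rewrite /label_table g5 {1}/label_of.
case: ifP => c6.
  rewrite /= tadjE //.
  by rewrite /label_of swap_nat_lt.
case: ifP => c12.
  have c6' : (c - 6 < 6)%N by lia.
  rewrite /= tadjE // -label_codeG inordK // swap_nat_lt //.
have [k6 l6 kl] := pair_codesP (k := c - 12) ltac:(lia).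
move: k6 l6 kl; case: (nth _ _ _) => [a b] /= a6 b6 ab.
rewrite -[LHS]/(relab (tadj g) (labF _ _)).
rewrite relab_labF ?inord_inj6 ?neq_ltn ?ab // !tadjE //.
by rewrite label_codeF ?swap_nat_lt // swap_nat_inj neq_ltn ab.
Qed.

Lemma swap_codeP x y z : (x < 27)%N -> (y < 27)%N -> (z < 27)%N ->
  tperm (label_of x) (label_of y) (label_of z) = label_of (swap_code x y z).
Proof.
move=> hx hy hz.
have e u v : (u < 27)%N -> (v < 27)%N -> (label_of u == label_of v) = (u == v).
  by move=> hu hv; apply/eqP/eqP => [/label_of_inj-> //|->].
by rewrite permE /= /swap_code !e //; case: ifP => //; case: ifP.
Qed.

Lemma swap_code_lt x y z : (x < 27)%N -> (y < 27)%N -> (z < 27)%N ->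
  (swap_code x y z < 27)%N.
Proof. by rewrite /swap_code; case: ifP => //; case: ifP. Qed.

Lemma label_of_tau c : (c < 27)%N ->
  triple_label 1%g (label_of c) = label_of (label_table 5 c).
Proof.
move=> c27; rewrite /triple_label !permM !perm1.
have E (a : 'I_6) : labE a = label_of a by rewrite /label_of ltn_ord inord_val.
have F (a b : 'I_6) : a != b -> labF a b = label_of (codeF a b).
  by move=> ab; rewrite label_codeF // !inord_val.
rewrite !E -!label_codeG !F // /label_table.
have f a b : (a < 6)%N -> (b < 6)%N -> a != b -> (codeF a b < 27)%N by exact: codeF_lt.
by rewrite !swap_codeP ?swap_code_lt ?f.
Qed.

Lemma realizes_cat ws ws' r s r' s' :
  preserves_tritangents s -> preserves_tritangents s' ->
  realizes ws r s -> realizes ws' r' s' ->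
  realizes (ws ++ ws') (fun d => r' (r d)) (s \o s').
Proof.
move=> ps ps' [hr hs] [hr' hs']; split=> [d a a6|t t45].
  rewrite param_word_cat hr' //; apply: param_word_ext => // b b6.
  exact: hr.
by rewrite act_index_comp // hs' // hs ?tri_word_lt // tri_word_cat.
Qed.

Lemma eq_realizes ws r s r' s' : (forall d, r d =1 r' d) -> s =1 s' ->
  realizes ws r s -> realizes ws r' s'.
Proof.
move=> er es [hr hs]; split=> [d a a6|t t45].
  by rewrite -hr // /params er.
by rewrite -(eq_act_index es) hs.
Qed.

Definition perm_param (p : 'S_6) (d : 'I_6 -> K) (a : 'I_6) : K := d (p a).

Lemma realizes_tadj g : (g < 5)%N ->
  realizes [:: g] (perm_param (tadj g)) (relab (tadj g)).
Proof.
move=> g5; split=> [d a a6|t t45].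
  by rewrite /params /perm_param tadjE //= /param_refl g5.
rewrite (act_index_code (tab := label_table g) (ttab := tri_refl g)) //.
  by move=> c; apply: label_of_refl.
by move=> u; apply: tri_reflP.
Qed.

(** Adjacent transpositions generate the symmetric group. *)
Lemma realizable_perm (p : 'S_6) : realizable (perm_param p) (relab p).
Proof.
have mul (p1 p2 : 'S_6) : realizable (perm_param p1) (relab p1) ->
    realizable (perm_param p2) (relab p2) ->
    realizable (perm_param (p1 * p2)) (relab (p1 * p2)).
  move=> [w1 h1] [w2 h2]; exists (w2 ++ w1).
  have := realizes_cat (@relab_preserves p2) (@relab_preserves p1) h2 h1.
  apply: eq_realizes => [d a|x]; first by rewrite /perm_param permM.
  by rewrite /= relabM.
have adj i j : (i < j < 6)%N ->
    realizable (perm_param (tperm (inord i) (inord j)))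
               (relab (tperm (inord i) (inord j))).
  elim: j => [|j IH]; first by rewrite ltn0.
  rewrite ltnS leq_eqVlt => /andP [/orP [/eqP -> j5|ij j5]].
    by exists [:: j]; apply: realizes_tadj.
  have hj : realizable (perm_param (tadj j)) (relab (tadj j)).
    by exists [:: j]; apply: realizes_tadj.
  have := mul _ _ hj (mul _ _ (IH _) hj); rewrite ij (ltnW j5) => /(_ isT).
  have -> // : (tadj j * (tperm (inord i) (inord j) * tadj j))%g =
            tperm (inord i) (inord j.+1).
  rewrite -[X in (X * _)%g]invgK [X in (X^-1 * _)%g]tpermV -conjgE tpermJ.
  rewrite /tadj tpermL tpermD // inord_inj6 //; lia.
have [ts -> _] := prod_tpermP p; elim: ts => [|[a b] ts IH].
  rewrite big_nil; exists [::]; split=> [d a a6|t t45] /=.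
    by rewrite /params /perm_param perm1.
  rewrite (act_index_code (tab := id) (ttab := id)) // => [c|u u45].
    by rewrite relab1.
  by rewrite u45 map_id perm_refl.
rewrite big_cons; apply: mul => //=.
have [ab|ba|ab] := ltngtP a b.
- by have := adj a b; rewrite ab ltn_ord !inord_val; apply.
- by rewrite tpermC; have := adj b a; rewrite ba ltn_ord !inord_val; apply.
rewrite (val_inj ab) tperm1; exists [:: 0%N; 0%N].
have h0 := @realizes_tadj 0 isT.
have := realizes_cat (@relab_preserves (tadj 0)) (@relab_preserves (tadj 0)) h0 h0.
apply: eq_realizes => [d c|x] /=; first by rewrite /perm_param tpermK perm1.
by rewrite -relabM tperm2 relab1.
Qed.

Definition triple_eval (p : 'S_6) (d : 'I_6 -> K) (a : 'I_6) : K :=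
  (triple_param K p a).@[d].

Lemma triple_evalE p d a : triple_eval p d a =
  if a \in [set p i1; p i2; p i3]
  then d a - 2%:R / 3%:R * (d (p i1) + d (p i2) + d (p i3))
  else d a + 1 / 3%:R * (d (p i1) + d (p i2) + d (p i3)).
Proof.
rewrite /triple_eval /triple_param /triple_root; case: ifP => _.
  by rewrite mevalB mevalZ !mevalD !mevalXU.
by rewrite mevalD mevalZ !mevalD !mevalXU.
Qed.

Lemma tau_preserves : preserves_tritangents (triple_label 1%g).
Proof.
move=> T /tritangent_code [t t45 ->].
have /andP [u45 pe] := tri_reflP 5 t45.
suff -> : triple_label 1%g @: tset t = tset (tri_refl 5 t) by apply: tset_tritangent.
apply/setP => x; rewrite [RHS]inE -(perm_mem (perm_map label_of pe)).
apply/imsetP/mapP.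
  case=> y; rewrite inE => /mapP [c ct ->] ->; exists (label_table 5 c).
    exact: map_f.
  by rewrite label_of_tau // (lines_lt t45).
case=> c' /mapP [c ct ->] ->; exists (label_of c).
  by rewrite inE; apply: map_f.
by rewrite label_of_tau // (lines_lt t45).
Qed.

Lemma realizes_tau g : (5 <= g)%N ->
  realizes [:: g] (triple_eval 1%g) (triple_label 1%g).
Proof.
move=> g5; have g5F : (g < 5)%N = false by rewrite ltnNge g5.
split=> [d a a6|t t45].
  rewrite -[RHS]/(param_refl g (params d) a) /param_refl g5F.
  rewrite /params triple_evalE !perm1 !inE.
  have e (k : 'I_6) : (inord a == k) = (a == k).
    by rewrite -{1}(inord_val k) inord_inj6.
  have i (k : nat) (hk : (k < 6)%N) : inord k = Ordinal hk :> 'I_6.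
    by apply: val_inj; rewrite /= inordK.
  rewrite !e /params !(i 0%N isT) !(i 1%N isT) !(i 2 isT).
  by case: a a6 {e} => [|[|[|a]]].
rewrite (act_index_code (tab := label_table 5) (ttab := tri_refl g)) //=.
- by move=> c; apply: label_of_tau.
- move=> u u45; have := tri_reflP g u45.
  by rewrite /label_table g5F.
Qed.

(** Every reflection s_ijk is conjugate to s_123 by a permutation of the
    indices, which reduces it to a word. *)
Lemma triple_label_conj (p : 'S_6) x :
  triple_label p (relab p x) = relab p (triple_label 1%g x).
Proof.
have rinj : injective (relab p) := can_inj (relabK p).
have tp y z w : tperm (relab p y) (relab p z) (relab p w) = relab p (tperm y z w).
  by rewrite !permE /= !(inj_eq rinj); case: ifP => //; case: ifP.
have E a : labE (p a) = relab p (labE a) by [].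
have G a : labG (p a) = relab p (labG a) by [].
have F a b : a != b -> labF (p a) (p b) = relab p (labF a b).
  by move=> ab; rewrite relab_labF.
by rewrite /triple_label !permM !E !G !F // !perm1 !tp.
Qed.

Lemma realizable_triple (p : 'S_6) : realizable (triple_eval p) (triple_label p).
Proof.
have [w1 h1] := realizable_perm p; have [w2 h2] := realizable_perm p^-1.
exists (w1 ++ [:: 5] ++ w2).
have pr := @relab_preserves.
have h := realizes_cat (pr _) _ h1 (realizes_cat tau_preserves (pr _) (realizes_tau (leqnn 5)) h2).
have {h} := h _; move=> h; apply: (eq_realizes _ _ (h _)).
- move=> d a; rewrite /perm_param !triple_evalE !perm1 permKV.
  by rewrite !inE -!(inj_eq (@perm_inj _ p) (p^-1 a)%g) permKV.
- by move=> x /=; rewrite -triple_label_conj relabVK.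
- move=> T hT; rewrite imset_comp; apply: tau_preserves; exact: pr.
Qed.
End ParameterReflections.

(** * Conjugates as words in the simple reflections *)

Section Conjugates.
Variable K : fieldType.
Implicit Types (d : 'I_6 -> K) (w : 'I_ntri -> K) (P Q : dpoly K).

Definition eval_at d w Q : K := (specialize d Q).@[w].

Lemma specializeX d k : specialize d ('X_k : dpoly K) = 'X_k.
Proof. exact: (map_mpolyX (meval d)). Qed.

Lemma eval_act r s d w Q : eval_at d w (act_dpoly r s Q) =
  eval_at (fun a => (r a).@[d]) (w \o act_index s) Q.
Proof.
pose f : {rmorphism {mpoly K[6]} -> {mpoly K[6]}} :=
  @comp_mpoly 6 K 6 [tuple r a | a < 6].
pose T := [tuple ('X_(act_index s k) : dpoly K) | k < ntri].
pose phi : {additive dpoly K -> K} :=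
  meval w \o (map_mpoly (meval d) \o (comp_mpoly T \o map_mpoly f)).
pose psi : {additive dpoly K -> K} :=
  meval (w \o act_index s) \o map_mpoly (meval (fun a => (r a).@[d])).
rewrite -[LHS]/(phi Q) -[RHS]/(psi Q) (mpolyE Q) (raddf_sum phi) (raddf_sum psi).
apply: eq_bigr => m _; rewrite /phi /psi /=.
rewrite (map_mpolyZ f) comp_mpolyZ !(map_mpolyZ (meval _)) !mevalZ; congr (_ * _).
  rewrite -[f _]/(comp_mpoly [tuple r a | a < 6] _) /= comp_mpoly_meval.
  by apply: meval_eq => a; rewrite tnth_mktuple.
rewrite (map_mpolyX f) (map_mpolyX (meval _)) comp_mpolyX.
rewrite (rmorph_prod (map_mpoly (meval d))) rmorph_prod /= mevalX.
apply: eq_bigr => k _; rewrite tnth_mktuple.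
rewrite (rmorphXn (map_mpoly (meval d))) rmorphXn /=; congr (_ ^+ _).
by rewrite (map_mpolyX (meval d)) mevalXU.
Qed.

(** Trades the orbit of a polynomial for an action on points. *)
Lemma conjugate_word P Q : Defs.conjugate P Q -> exists ws, forall d w,
  exists d' w', [/\ eval_at d w Q = eval_at d' w' P,
    forall a, (a < 6)%N -> params d' a = param_word ws (params d) a
  & forall t, (t < 45)%N -> w' (tri_of t) = w (tri_of (tri_word ws t))].
Proof.
have step Q' r (re : forall d a, (r a).@[d] = (r a).@[d]) s ws' :
  forall ws, realizes ws (fun d a => (r a).@[d]) s ->
  (forall d w,
  exists d' w', [/\ eval_at d w Q' = eval_at d' w' P,
    forall a, (a < 6)%N -> params d' a = param_word ws' (params d) a
  & forall t, (t < 45)%N -> w' (tri_of t) = w (tri_of (tri_word ws' t))]) ->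
  exists ws, forall d w,
  exists d' w', [/\ eval_at d w (act_dpoly r s Q') = eval_at d' w' P,
    forall a, (a < 6)%N -> params d' a = param_word ws (params d) a
  & forall t, (t < 45)%N -> w' (tri_of t) = w (tri_of (tri_word ws t))].
  move=> ws [hr hs] IH; exists (ws ++ ws') => d w.
  have [d' [w' [e1 e2 e3]]] := IH (fun a => (r a).@[d]) (w \o act_index s).
  exists d', w'; split=> [|a a6|t t45]; first by rewrite eval_act e1.
    rewrite e2 // param_word_cat; apply: param_word_ext => // b b6; exact: hr.
  by rewrite e3 //= hs ?tri_word_lt // tri_word_cat.
elim=> [|Q' i j ij _ [ws' IH]|Q' p _ [ws' IH]].
- by exists [::] => d w; exists d, w.
- have [ws h] := realizable_perm K (tperm i j).
  apply: (step Q' _ _ _ ws' ws) => //.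
  by apply: eq_realizes h => // d a; rewrite /swap_param mevalXU.
- have [ws h] := realizable_triple K p.
  by apply: (step Q' _ _ _ ws' ws).
Qed.

Lemma conjugate_refl_step P Q g : Defs.conjugate P Q -> exists r s,
  Defs.conjugate P (act_dpoly r s Q) /\ realizes [:: g] (fun d a => (r a).@[d]) s.
Proof.
move=> hQ; have [g5|g5] := ltnP g 5.
  exists (swap_param K (inord g) (inord g.+1)), (swap_label (inord g) (inord g.+1)).
  split.
    apply: conjugate_swap => //; rewrite inord_inj6 //; last by apply: ltnW.
    by rewrite neq_ltn ltnSn.
  by apply: eq_realizes (realizes_tadj K g5) => // d a; rewrite /swap_param mevalXU.
exists (triple_param K 1%g), (triple_label 1%g).
by split; [exact: conjugate_triple | exact: (realizes_tau K g5)].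
Qed.

Lemma word_conjugate P ws : exists2 Q, Defs.conjugate P Q & forall d w,
  exists d' w', [/\ eval_at d w Q = eval_at d' w' P,
    forall a, (a < 6)%N -> params d' a = param_word ws (params d) a
  & forall t, (t < 45)%N -> w' (tri_of t) = w (tri_of (tri_word ws t))].
Proof.
elim: ws => [|g ws [Q hQ IH]].
  by exists P; [exact: conjugate_refl | move=> d w; exists d, w].
have [r [s [hc [hr hs]]]] := conjugate_refl_step g hQ.
exists (act_dpoly r s Q) => // d w.
have [d' [w' [e1 e2 e3]]] := IH (fun a => (r a).@[d]) (w \o act_index s).
exists d', w'; split=> [|a a6|t t45]; first by rewrite eval_act e1.
  rewrite e2 //=; apply: param_word_ext => // b b6; exact: hr.
by rewrite e3 //= hs ?tri_word_lt.
Qed.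

Definition binomial (R : ringType) (t u : seq nat) : {mpoly R[ntri]} :=
  \prod_(k <- t) 'X_(tri_of k) - \prod_(k <- u) 'X_(tri_of k).

Lemma act_binomial r s (f : nat -> nat) t u :
  {in t ++ u, forall k, act_index s (tri_of k) = tri_of (f k)} ->
  @act_dpoly K r s (binomial {mpoly K[6]} t u) = binomial {mpoly K[6]} (map f t) (map f u).
Proof.
move=> h.
pose g : {rmorphism {mpoly K[6]} -> {mpoly K[6]}} :=
  @comp_mpoly 6 K 6 [tuple r a | a < 6].
pose T := [tuple ('X_(act_index s k) : dpoly K) | k < ntri].
pose phi : {rmorphism dpoly K -> dpoly K} := comp_mpoly T \o map_mpoly g.
have phiX k : phi 'X_k = 'X_(act_index s k).
  by rewrite /phi /= (map_mpolyX g) comp_mpolyXU -tnth_nth tnth_mktuple.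
rewrite -[LHS]/(phi _) /binomial (rmorphB phi) !(rmorph_prod phi) !big_map.
congr (_ - _); rewrite big_seq [RHS]big_seq; apply: eq_bigr => k kt;
  by rewrite phiX h // mem_cat kt ?orbT.
Qed.

Lemma big_prod3 (R : comRingType) (F : nat -> R) a b c :
  \prod_(k <- [:: a; b; c]) F k = F a * F b * F c.
Proof. by rewrite !big_cons big_nil mulr1 mulrA. Qed.

Lemma base_cubic_binomial : base_cubic = binomial {mpoly K[6]}
  [:: xcode 0 1; xcode 1 2; xcode 2 0] [:: xcode 0 2; xcode 2 1; xcode 1 0].
Proof.
rewrite /binomial.
rewrite [X in X - _]big_prod3 [X in _ - X]big_prod3 /base_cubic /xvar.
rewrite (@xindex_code i1 i2 isT) (@xindex_code i2 i3 isT) (@xindex_code i3 i1 isT).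
rewrite (@xindex_code i1 i3 isT) (@xindex_code i3 i2 isT) (@xindex_code i2 i1 isT).
reflexivity.
Qed.

Definition cubic_pos : seq nat := [:: xcode 0 1; xcode 1 2; xcode 2 0].
Definition cubic_neg : seq nat := [:: xcode 0 2; xcode 2 1; xcode 1 0].

Lemma cubic_codes_lt k : k \in cubic_pos ++ cubic_neg -> (k < 45)%N.
Proof. by move: k; apply/allP; vm_compute. Qed.

Lemma act_binomial_word r s ws ws' t u : {in t ++ u, forall k, (k < 45)%N} ->
  realizes ws (fun d a => (r a).@[d]) s ->
  @act_dpoly K r s (binomial {mpoly K[6]} (map (tri_word ws') t) (map (tri_word ws') u)) =
  binomial {mpoly K[6]} (map (tri_word (ws ++ ws')) t) (map (tri_word (ws ++ ws')) u).
Proof.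
move=> h45 [_ hs].
have e l : map (tri_word (ws ++ ws')) l = map (tri_word ws) (map (tri_word ws') l).
  by rewrite -map_comp; apply: eq_map => k /=; rewrite tri_word_cat.
rewrite (e t) (e u) (act_binomial _ (f := tri_word ws)); first by reflexivity.
move=> k; rewrite -map_cat => /mapP [k' hk' ->].
by rewrite hs // tri_word_lt // h45.
Qed.

Lemma conjugate_cubic_word Q : Defs.conjugate base_cubic Q -> exists ws,
  Q = binomial {mpoly K[6]} (map (tri_word ws) cubic_pos) (map (tri_word ws) cubic_neg).
Proof.
elim=> [|Q' i j ij _ [ws' ->]|Q' p _ [ws' ->]].
- exists [::]; exact: base_cubic_binomial.
- have [ws h] := realizable_perm K (tperm i j).
  exists (ws ++ ws'); apply: act_binomial_word; first exact: cubic_codes_lt.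
  by apply: eq_realizes h => // d a; rewrite /swap_param mevalXU.
- have [ws h] := realizable_triple K p.
  by exists (ws ++ ws'); apply: act_binomial_word; first exact: cubic_codes_lt.
Qed.

Lemma word_conjugate_cubic ws : Defs.conjugate base_cubic
  (binomial {mpoly K[6]} (map (tri_word ws) cubic_pos) (map (tri_word ws) cubic_neg)).
Proof.
elim: ws => [|g ws IH].
  have := conjugate_refl (@base_cubic K); rewrite {2}base_cubic_binomial; exact.
have [r [s [hc hr]]] := conjugate_refl_step g IH.
by rewrite -(act_binomial_word _ cubic_codes_lt hr).
Qed.

Lemma specialize_binomial d t u :
  specialize d (binomial {mpoly K[6]} t u : dpoly K) = binomial K t u.
Proof.
pose phi : {rmorphism dpoly K -> {mpoly K[ntri]}} := map_mpoly (meval d).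
rewrite -[LHS]/(phi _) /binomial (rmorphB phi) !(rmorph_prod phi).
by congr (_ - _); apply: eq_bigr => k _; apply: specializeX.
Qed.

Lemma eval_binomial w t u : (binomial K t u).@[w] =
  \prod_(k <- t) w (tri_of k) - \prod_(k <- u) w (tri_of k).
Proof.
rewrite /binomial mevalB !rmorph_prod /=.
by congr (_ - _); apply: eq_bigr => k _; rewrite mevalXU.
Qed.

Lemma conjugate_at_cubicP d q : conjugate_at d base_cubic q <-> exists ws,
  q = binomial K (map (tri_word ws) cubic_pos) (map (tri_word ws) cubic_neg).
Proof.
split=> [[Q /conjugate_cubic_word [ws ->] ->]|[ws ->]].
  by exists ws; rewrite specialize_binomial.
eexists; first exact: (word_conjugate_cubic ws).
by rewrite specialize_binomial.
Qed.

Definition base_form (d : nat -> K) (w : nat -> K) : K :=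
  (d 2 - d 3) * (d 0%N + d 2 + d 3) * w (xcode 1 0)
  - (d 1%N - d 3) * (d 0%N + d 1%N + d 3) * w (xcode 2 0)
  + (d 1%N - d 2) * (d 0%N + d 1%N + d 2) * w (xcode 3 0).

Lemma eval_linear3 d w (a b c : {mpoly K[6]}) i j k :
  eval_at d w (a *: 'X_i - b *: 'X_j + c *: 'X_k) =
  a.@[d] * w i - b.@[d] * w j + c.@[d] * w k.
Proof.
pose phi : {rmorphism dpoly K -> {mpoly K[ntri]}} := map_mpoly (meval d).
have phiZ (e : {mpoly K[6]}) l : phi (e *: 'X_l) = e.@[d] *: 'X_l.
  by rewrite /phi /= (map_mpolyZ (meval d)) (map_mpolyX (meval d)).
rewrite -[LHS]/((phi _).@[w]) (rmorphD phi) (rmorphB phi) !phiZ.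
by rewrite mevalD mevalB !mevalZ !mevalXU.
Qed.

Lemma eval_base_linear d w :
  eval_at d w base_linear = base_form (params d) (fun t => w (tri_of t)).
Proof.
rewrite [LHS]eval_linear3.
rewrite (@xindex_code i2 i1 isT) (@xindex_code i3 i1 isT) (@xindex_code i4 i1 isT).
rewrite !(mevalM, mevalD, mevalN, mevalXU) /base_form /params.
have i (k : nat) (hk : (k < 6)%N) : inord k = Ordinal hk :> 'I_6.
  by apply: val_inj; rewrite /= inordK.
rewrite !(i 0%N isT) !(i 1%N isT) !(i 2 isT) !(i 3 isT).
reflexivity.
Qed.
End Conjugates.

(** * The 120 pairs of triples of tritangents *)

Section OrbitClosure.
Variables (T : eqType) (gens : seq (T -> T)).

Fixpoint closure (n : nat) (seen frontier : seq T) : seq T :=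
  if n is n'.+1 then
    let new := undup [seq y <- flatten [seq [seq g x | g <- gens] | x <- frontier]
                        | y \notin seen] in
    closure n' (seen ++ new) new
  else seen.

Lemma closure_ind (P : T -> Prop) n x :
  P x -> (forall y, P y -> {in map (fun g => g y) gens, forall z, P z}) ->
  {in closure n [:: x] [:: x], forall y, P y}.
Proof.
move=> Px hP.
suff H seen frontier : {in seen, forall y, P y} -> {in frontier, forall y, P y} ->
    {in closure n seen frontier, forall y, P y}.
  by apply: H => y; rewrite inE => /eqP ->.
elim: n seen frontier => [|n IH] seen frontier hs hf //=.
have hn : {in undup [seq y <- flatten [seq [seq g x | g <- gens] | x <- frontier]
                        | y \notin seen], forall y, P y}.
  move=> y; rewrite mem_undup mem_filter => /andP [_ /flattenP [l /mapP [z zf ->]]].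
  exact: hP (hf z zf) y.
apply: IH => // y; rewrite mem_cat => /orP []; [exact: hs | exact: hn].
Qed.
End OrbitClosure.

Definition triples := (seq nat * seq nat)%type.

Definition same_pair (x y : triples) : bool :=
  perm_eq x.1 y.1 && perm_eq x.2 y.2 || perm_eq x.1 y.2 && perm_eq x.2 y.1.

Definition refl_pair (g : nat) (x : triples) : triples :=
  (map (tri_refl g) x.1, map (tri_refl g) x.2).

Definition normal_pair (x : triples) : triples :=
  let a := sort leq x.1 in let b := sort leq x.2 in
  if (head 0 a < head 0 b)%N then (a, b) else (b, a).

(** The Steiner trihedral pairs, obtained as the orbit of the base cubic by
    breadth-first search; 20 rounds exhaust it. *)
Definition trihedral_pairs : seq triples := Eval vm_compute in
  closure [seq (fun x => normal_pair (refl_pair g x)) | g <- iota 0 6] 20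
    [:: normal_pair (cubic_pos, cubic_neg)] [:: normal_pair (cubic_pos, cubic_neg)].

Lemma size_trihedral_pairs : size trihedral_pairs = 120%N.
Proof. by vm_compute. Qed.

Lemma trihedral_pairs_closed :
  all (fun x => all (fun g => has (same_pair (refl_pair g x)) trihedral_pairs) (iota 0 6))
    trihedral_pairs.
Proof. by vm_compute. Qed.

Definition covered (T : nat) (U : seq nat) : bool :=
  all (fun c => has (fun u => c \in lines u) U) (lines T).

Definition uncovered (T : nat) (U : seq nat) : seq nat :=
  [seq c <- lines T | ~~ has (fun u => c \in lines u) U].

(** Each line of a plane of one triple must lie in a plane of the other. Two
    planes share at most one line, so once two of the three covering planes are
    chosen at most one line of a covered plane may be left over: this prunes
    the search over the six planes. The conditionals stop the evaluation of a
    branch that is pruned. *)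
Definition steiner_check : bool :=
  let r := iota 0 45 in
  let coveredall l m := all (fun t => covered t m) l in
  all (fun t1 => all (fun u1 => if u1 == t1 then true else
  all (fun u2 => if u2 == t1 then true else if (u2 < u1)%N then true else
    if (1 < size (uncovered t1 [:: u1; u2]))%N then true else
  all (fun u3 => if u3 == t1 then true else if (u3 < u2)%N then true else
    if ~~ covered t1 [:: u1; u2; u3] then true else
  all (fun t2 => if (t2 < t1)%N then true else if t2 \in [:: u1; u2; u3] then true else
    if (1 < size (uncovered u1 [:: t1; t2]))%N then true else
    if (1 < size (uncovered u2 [:: t1; t2]))%N then true else
    if (1 < size (uncovered u3 [:: t1; t2]))%N then true else
  all (fun t3 => if (t3 < t2)%N then true else if t3 \in [:: u1; u2; u3] then true else
    if ~~ coveredall [:: u1; u2; u3] [:: t1; t2; t3] then true else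
    if ~~ coveredall [:: t2; t3] [:: u1; u2; u3] then true else
    has (same_pair ([:: t1; t2; t3], [:: u1; u2; u3])) trihedral_pairs)
  r) r) r) r) r) r.

Lemma steiner_checkT : steiner_check.
Proof. by vm_compute. Qed.

Definition pair_at (i : nat) : triples := nth ([::], [::]) trihedral_pairs i.

Lemma pair_at_inj i j : (i < 120)%N -> (j < 120)%N ->
  same_pair (pair_at i) (pair_at j) -> i = j.
Proof.
have /all_ltP h : all (fun i => all (fun j =>
    same_pair (pair_at i) (pair_at j) ==> (i == j)) (iota 0 120)) (iota 0 120).
  by vm_compute.
by move=> /h /all_ltP {}h /h /implyP {}h /h /eqP.
Qed.

Lemma same_pair_refl_pair g x y : same_pair x y -> same_pair (refl_pair g x) (refl_pair g y).
Proof.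
by case/orP=> /andP [h1 h2]; apply/orP; [left | right]; rewrite /= !perm_map.
Qed.

Lemma same_pair_trans : transitive same_pair.
Proof.
move=> y x z /orP [] /andP [h1 h2] /orP [] /andP [h3 h4]; apply/orP.
- by left; rewrite (perm_trans h1 h3) (perm_trans h2 h4).
- by right; rewrite (perm_trans h1 h3) (perm_trans h2 h4).
- by right; rewrite (perm_trans h1 h4) (perm_trans h2 h3).
- by left; rewrite (perm_trans h1 h4) (perm_trans h2 h3).
Qed.

Lemma same_pair_sym x y : same_pair x y = same_pair y x.
Proof.
by rewrite /same_pair ![perm_eq y.1 _]perm_sym ![perm_eq y.2 _]perm_sym
  [perm_eq x.2 y.1 && _]andbC.
Qed.

Definition word_pair (ws : seq nat) (x : triples) : triples :=
  (map (tri_word ws) x.1, map (tri_word ws) x.2).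

Lemma word_pair_cons g ws x : word_pair (g :: ws) x = refl_pair g (word_pair ws x).
Proof. by rewrite /word_pair /refl_pair /= -!map_comp. Qed.

Definition cubic_pair : triples := (cubic_pos, cubic_neg).

Lemma word_pair_trihedral ws : exists2 i, (i < 120)%N &
  same_pair (word_pair ws cubic_pair) (pair_at i).
Proof.
suff /hasP [x xP sx] : has (same_pair (word_pair ws cubic_pair)) trihedral_pairs.
  exists (index x trihedral_pairs); first by rewrite -size_trihedral_pairs index_mem.
  by rewrite /pair_at nth_index.
elim: ws => [|g ws /hasP [x xP sx]]; first by vm_compute.
have /allP /(_ x xP) /allP hx := trihedral_pairs_closed.
have /hx /hasP [y yP sy] : minn g 5 \in iota 0 6.
  by rewrite mem_iota /= add0n ltnS geq_minr.
apply/hasP; exists y => //; apply: (same_pair_trans _ sy).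
have -> : refl_pair (minn g 5) x = refl_pair g x.
  by rewrite /refl_pair /tri_refl -minnA minnn.
by rewrite word_pair_cons; apply: same_pair_refl_pair.
Qed.

Definition perm_eq_pair (x y : triples) : bool :=
  perm_eq x.1 y.1 && perm_eq x.2 y.2.

Definition reached (x y : triples) : Prop :=
  exists ws, perm_eq_pair (word_pair ws x) y.

Lemma reached_perm x y z : perm_eq_pair y z -> reached x y -> reached x z.
Proof.
move=> /andP [h1 h2] [ws /andP [h3 h4]]; exists ws.
by rewrite /perm_eq_pair (perm_trans h3 h1) (perm_trans h4 h2).
Qed.

Lemma reached_refl_pair x y g : reached x y -> reached x (refl_pair g y).
Proof.
move=> [ws /andP [h1 h2]]; exists (g :: ws).
by rewrite word_pair_cons /perm_eq_pair !perm_map.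
Qed.

Definition swap_pair (x : triples) : triples := (x.2, x.1).

Lemma reached_normal x y : reached x y /\ reached x (swap_pair y) ->
  reached x (normal_pair y) /\ reached x (swap_pair (normal_pair y)).
Proof.
have s l : perm_eq l (sort leq l) by rewrite perm_sym perm_sort.
by move=> [h1 h2]; rewrite /normal_pair; case: ifP => _; split;
  [apply: reached_perm h1 | apply: reached_perm h2
  |apply: reached_perm h2 | apply: reached_perm h1]; rewrite /perm_eq_pair !s.
Qed.

(** Both signs of each of the 120 binomials are conjugates of the base cubic:
    exchanging the first two indices changes the sign of the latter. *)
Lemma trihedral_word i : (i < 120)%N ->
  exists ws, perm_eq_pair (word_pair ws cubic_pair) (pair_at i).
Proof.
move=> i120; rewrite -/(reached _ _).
suff /(_ (pair_at i)) h : {in trihedral_pairs, forall x,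
    reached cubic_pair x /\ reached cubic_pair (swap_pair x)}.
  by apply: (proj1 (h _)); apply: mem_nth; rewrite size_trihedral_pairs.
have -> : trihedral_pairs =
    closure [seq (fun x => normal_pair (refl_pair g x)) | g <- iota 0 6] 20
    [:: normal_pair cubic_pair] [:: normal_pair cubic_pair].
  by vm_cast_no_check (erefl trihedral_pairs).
apply: closure_ind.
  by apply: reached_normal; split; [exists [::]; vm_compute | exists [:: 0%N]; vm_compute].
move=> x [Px Px'] z; rewrite -map_comp => /mapP [g _ ->].
apply: reached_normal; split; first exact: reached_refl_pair.
exact: (reached_refl_pair g Px').
Qed.

Lemma pair_atP i : (i < 120)%N ->
  [/\ size (pair_at i).1 = 3%N, size (pair_at i).2 = 3%N, uniq (pair_at i).1,
      uniq (pair_at i).2 & forall k, k \in (pair_at i).1 ++ (pair_at i).2 -> (k < 45)%N].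
Proof.
have /all_ltP h : all (fun i => [&& size (pair_at i).1 == 3%N, size (pair_at i).2 == 3%N,
   uniq (pair_at i).1, uniq (pair_at i).2 &
   all (fun k => k < 45)%N ((pair_at i).1 ++ (pair_at i).2)]) (iota 0 120).
  by vm_compute.
by move=> /h /and5P [/eqP h1 /eqP h2 h3 h4 /allP h5].
Qed.

Lemma pair_at_disjoint i k : (i < 120)%N -> k \in (pair_at i).1 -> k \notin (pair_at i).2.
Proof.
have /all_ltP h : all (fun i => all (fun k => k \notin (pair_at i).2) (pair_at i).1)
   (iota 0 120) by vm_compute.
by move=> /h /allP; apply.
Qed.

Lemma two_common_lines t u c c' : (t < 45)%N -> (u < 45)%N -> c != c' ->
  c \in lines t -> c' \in lines t -> c \in lines u -> c' \in lines u -> t = u.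
Proof.
have /all_ltP h : all (fun t => all (fun u => (t == u) ||
   (size [seq c <- lines t | c \in lines u] <= 1)%N) (iota 0 45)) (iota 0 45).
  by vm_compute.
move=> /h /all_ltP {}h /h /orP [/eqP //|].
case e: [seq _ <- _ | _] => [|a [|b l]] // _ cc' ct c't cu c'u.
  by have := mem_filter (fun x => x \in lines u) c (lines t); rewrite e ct cu.
have := mem_filter (fun x => x \in lines u) c (lines t).
have := mem_filter (fun x => x \in lines u) c' (lines t).
rewrite e ct cu c't c'u !inE => /eqP ec' /eqP ec.
by rewrite ec ec' eqxx in cc'.
Qed.

Lemma uncovered_le1 t u m : (t < 45)%N -> (u < 45)%N -> t != u ->
  covered t (rcons m u) -> (size (uncovered t m) <= 1)%N.
Proof.
move=> t45 u45 tu /allP cov; rewrite leqNgt; apply/negP => h.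
have u_unc : uniq (uncovered t m).
  by apply: filter_uniq; apply: (sorted_uniq ltn_trans ltnn); apply: lines_sorted.
case e: (uncovered t m) => [|a [|b l]] in h u_unc *; rewrite ?e // in h.
have mem_u c : c \in uncovered t m -> c \in lines t /\ c \in lines u.
  rewrite mem_filter => /andP [hn ct]; split=> //.
  by have := cov c ct; rewrite has_rcons (negbTE hn) orbF.
have [at_ au] := mem_u a ltac:(by rewrite e inE eqxx).
have [bt bu] := mem_u b ltac:(by rewrite e !inE eqxx orbT).
have ab : a != b by move: u_unc => /= /andP []; rewrite inE negb_or => /andP [].
by move: tu; rewrite (two_common_lines t45 u45 ab at_ bt au bu) eqxx.
Qed.

Lemma covered_perm t m m' : m =i m' -> covered t m = covered t m'.
Proof. by move=> e; apply: eq_all => c; apply: eq_has_r. Qed.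

(** Sorting both triples loses nothing, and the branch of the search that they
    describe is never pruned. *)
Lemma trihedral_of_cover (T U : seq nat) : size T = 3%N -> size U = 3%N ->
  {in T, forall t, (t < 45)%N} -> {in U, forall u, (u < 45)%N} ->
  {in T & U, forall t u, t != u} ->
  {in T, forall t, covered t U} -> {in U, forall u, covered u T} ->
  exists2 i, (i < 120)%N & same_pair (T, U) (pair_at i).
Proof.
wlog [sT sU] : T U / sorted leq T /\ sorted leq U.
  move=> h zT zU T45 U45 TU cT cU.
  have eT := mem_sort leq T; have eU := mem_sort leq U.
  have [||||||||i i120 hi] := h (sort leq T) (sort leq U); rewrite ?size_sort //.
  - by split; apply: (sort_sorted leq_total).
  - by move=> t; rewrite eT; apply: T45.
  - by move=> t; rewrite eU; apply: U45.
  - by move=> t u; rewrite eT eU; apply: TU.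
  - by move=> t; rewrite eT (covered_perm _ eU); apply: cT.
  - by move=> t; rewrite eU (covered_perm _ eT); apply: cU.
  exists i => //; apply: same_pair_trans hi.
  by rewrite /same_pair !(perm_sym _ (sort _ _)) !perm_sort !perm_refl.
case: T sT => [|t1 [|t2 [|t3 [|]]]] //; case: U sU => [|u1 [|u2 [|u3 [|]]]] //.
move=> /= /and3P [u12 u23 _] /and3P [t12 t23 _] _ _ T45 U45 TU cT cU.
have [t1T t2T t3T] : [/\ t1 \in [:: t1; t2; t3], t2 \in [:: t1; t2; t3] & t3 \in [:: t1; t2; t3]].
  by rewrite !inE !eqxx !orbT.
have [u1U u2U u3U] : [/\ u1 \in [:: u1; u2; u3], u2 \in [:: u1; u2; u3] & u3 \in [:: u1; u2; u3]].
  by rewrite !inE !eqxx !orbT.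
have nU t : t \in [:: t1; t2; t3] -> (t \in [:: u1; u2; u3]) = false.
  by move=> tT; apply/negP => /(TU _ _ tT); rewrite eqxx.
have nT u : u \in [:: u1; u2; u3] -> (u == t1) = false.
  by move=> uU; apply/negP => /eqP e; move: (TU _ _ t1T uU); rewrite e eqxx.
have unT : (1 < size (uncovered t1 [:: u1; u2]))%N = false.
  apply/negbTE; rewrite -leqNgt (uncovered_le1 (T45 _ t1T) (U45 _ u3U) (TU _ _ t1T u3U)) //.
  exact: (cT _ t1T).
have unU u : u \in [:: u1; u2; u3] -> (1 < size (uncovered u [:: t1; t2]))%N = false.
  move=> uU; have ut3 : u != t3 by rewrite eq_sym TU.
  apply/negbTE; rewrite -leqNgt (uncovered_le1 (U45 _ uU) (T45 _ t3T) ut3) //.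
  exact: (cU _ uU).
have := steiner_checkT; rewrite /steiner_check.
move=> /all_ltP /(_ _ (T45 _ t1T)) /all_ltP /(_ _ (U45 _ u1U)).
rewrite (nT _ u1U) => /all_ltP /(_ _ (U45 _ u2U)).
have le a c : (a <= c)%N -> (c < a)%N = false by rewrite ltnNge => ->.
have cT' : covered t1 [:: u1; u2; u3] = true := cT _ t1T.
have cU3 : all (fun t => covered t [:: t1; t2; t3]) [:: u1; u2; u3] = true.
  exact/allP.
have cT2 : all (fun t => covered t [:: u1; u2; u3]) [:: t2; t3] = true.
  by apply/allP => t tT; apply: cT; rewrite inE tT orbT.
rewrite (nT _ u2U) (le _ _ u12) unT => /all_ltP /(_ _ (U45 _ u3U)).
rewrite (nT _ u3U) (le _ _ u23) cT' => /all_ltP /(_ _ (T45 _ t2T)).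
rewrite (nU _ t2T) (le _ _ t12) (unU _ u1U) (unU _ u2U) (unU _ u3U).
move=> /all_ltP /(_ _ (T45 _ t3T)).
rewrite (nU _ t3T) (le _ _ t23) cU3 cT2 => /hasP [x xP hx].
exists (index x trihedral_pairs); first by rewrite -size_trihedral_pairs index_mem.
by rewrite /pair_at nth_index.
Qed.

(** * Systems of 45 linear forms satisfying the 270 relations *)

Definition through (c : nat) : seq nat := [seq t <- iota 0 45 | c \in lines t].

Lemma mem_through c t : (t \in through c) = (t < 45)%N && (c \in lines t).
Proof. by rewrite mem_filter mem_iota andbC. Qed.

(** The triples of tritangents with a common line, which form a single orbit
    with 270 members, one for each linear relation. *)
Definition pencil_triples : seq (seq nat) := Eval vm_compute in
  closure [seq (fun l => sort leq (map (tri_refl g) l)) | g <- iota 0 6] 30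
    [:: sort leq [:: xcode 1 0; xcode 2 0; xcode 3 0]]
    [:: sort leq [:: xcode 1 0; xcode 2 0; xcode 3 0]].

Lemma mem_pencil_triples c t t' t'' : (c < 27)%N ->
  t \in through c -> t' \in through c -> t'' \in through c ->
  uniq [:: t; t'; t''] -> sort leq [:: t; t'; t''] \in pencil_triples.
Proof.
have /all_ltP h : all (fun c => all (fun t => all (fun t' => all (fun t'' =>
    if uniq [:: t; t'; t''] then sort leq [:: t; t'; t''] \in pencil_triples else true)
    (through c)) (through c)) (through c)) (iota 0 27) by vm_compute.
by move=> /h /allP {}h /h /allP {}h /h /allP {}h /h; case: ifP => // ->.
Qed.

Lemma tri_reflK g t : (t < 45)%N -> tri_refl g (tri_refl g t) = t.
Proof.
have /all_ltP h : all (fun g => all (fun t => tri_refl g (tri_refl g t) == t) (iota 0 45))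
  (iota 0 6) by vm_compute.
move=> t45; have -> : tri_refl g = tri_refl (minn g 5).
  by rewrite /tri_refl -minnA minnn.
have /h /all_ltP /(_ t t45) /eqP // : (minn g 5 < 6)%N by rewrite ltnS geq_minr.
Qed.

(** Locked, so that two codes are compared by name and not by computation. *)
Definition xc : nat -> nat -> nat := locked xcode.
Definition yc : seq nat -> nat := locked (fun l => find_tri (ycode l)).

Lemma xcE : xc = xcode. Proof. by rewrite /xc -lock. Qed.
Lemma ycE l : yc l = find_tri (ycode l). Proof. by rewrite /yc -lock. Qed.

Section CubicAlgebra.
Variable K : fieldType.
Implicit Types a b c x : K.

Lemma solve_first a b c x : a * x - b + c = 0 -> a != 0 -> x = (b - c) / a.
Proof.
move=> e a0; apply: (mulfI a0); rewrite mulrCA divff // mulr1.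
by apply/eqP; rewrite -subr_eq0 -e; apply/eqP; ring.
Qed.

Lemma solve_last a b c x : b - c + a * x = 0 -> a != 0 -> x = (c - b) / a.
Proof.
move=> e a0; apply: (mulfI a0); rewrite mulrCA divff // mulr1.
by apply/eqP; rewrite -subr_eq0 -e; apply/eqP; ring.
Qed.

Variables d0 d1 d2 d3 d4 d5 : K.

(** A relation among six coordinates with indices at most 3, found by eliminating
    the four y and the coordinates with index 4 from ten of the 270 relations. *)
Lemma six_term_relation x01 x02 x03 x04 x10 x20 x30 x40 x12 x31 ya yb yc ye :
  (d0-d2) != 0 ->
  (d0-d3) != 0 ->
  (d0-d4) != 0 ->
  (d3-d4) != 0 ->
  (d4-d3) != 0 ->
  (d0-d5) != 0 ->
  (d2-d4) != 0 ->
  (d1+d2+d5) != 0 ->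
  (d0+d3+d4) != 0 ->
  (d0+d1+d2+d3+d4+d5) != 0 ->
  (d1+d2+d5)*(d4-d3)*x01 - (d2+d3+d5)*(d4-d1)*x03 + (d3-d1)*(d2+d4+d5)*x04 = 0 ->
  (d1+d2+d5)*(d4-d3)*x02 - (d1+d3+d5)*(d4-d2)*x03 + (d3-d2)*(d1+d4+d5)*x04 = 0 ->
  (d3-d4)*(d0+d3+d4)*x10 - (d1-d4)*(d0+d1+d4)*x30 + (d1-d3)*(d0+d1+d3)*x40 = 0 ->
  (d3-d4)*(d0+d3+d4)*x20 - (d2-d4)*(d0+d2+d4)*x30 + (d2-d3)*(d0+d2+d3)*x40 = 0 ->
  (d3+d4+d5)*(d1+d2+d3)*x03 - (d0+d4+d5)*(d0+d1+d2)*x30 + (d0-d3)*(d0+d1+d2+d3+d4+d5)*ya = 0 ->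
  (d3+d4+d5)*(d1+d2+d4)*x04 - (d0+d3+d5)*(d0+d1+d2)*x40 + (d0-d4)*(d0+d1+d2+d3+d4+d5)*yb = 0 ->
  (d2+d4+d5)*(d1+d2+d3)*x02 - (d0+d4+d5)*(d0+d1+d3)*x20 + (d0-d2)*(d0+d1+d2+d3+d4+d5)*yc = 0 ->
  (d2+d4+d5)*(d1+d3+d4)*x04 - (d0+d2+d5)*(d0+d1+d3)*x40 + (d0-d4)*(d0+d1+d2+d3+d4+d5)*ye = 0 ->
  (d3-d4)*(d0-d5)*x12 - (d1+d3+d5)*(d0+d1+d4)*ya + (d1+d4+d5)*(d0+d1+d3)*yb = 0 ->
  (d2-d4)*(d0-d5)*x31 - (d2+d3+d5)*(d0+d3+d4)*yc + (d3+d4+d5)*(d0+d2+d3)*ye = 0 ->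
  -(d0-d3)*(d2+d4+d5)*(d0+d2+d3)*x12
  - (d1-d3)*(d0+d4+d5)*(d0+d1+d3)*x20
  +(d2-d3)*(d0+d4+d5)*(d0+d2+d3)*x10
  +(d1-d2)*(d3+d4+d5)*(d1+d2+d3)*x03
  +(d0-d2)*(d1+d4+d5)*(d0+d1+d2)*x31
  +(d2-d3)*(d1+d4+d5)*(d1+d2+d3)*x01=0.
Proof.
move=> n0 n1 n2 n3 n4 n5 n6 n7 n8 n9.
move=> h0 h1 h2 h3 h4 h5 h6 h7 h8 h9.
have {}h0 := solve_first h0 ltac:(by rewrite !mulf_neq0).
have {}h1 := solve_first h1 ltac:(by rewrite !mulf_neq0).
have {}h2 := solve_first h2 ltac:(by rewrite !mulf_neq0).
have {}h3 := solve_first h3 ltac:(by rewrite !mulf_neq0).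
have {}h4 := solve_last h4 ltac:(by rewrite !mulf_neq0).
have {}h5 := solve_last h5 ltac:(by rewrite !mulf_neq0).
have {}h6 := solve_last h6 ltac:(by rewrite !mulf_neq0).
have {}h7 := solve_last h7 ltac:(by rewrite !mulf_neq0).
have {}h8 := solve_first h8 ltac:(by rewrite !mulf_neq0).
have {}h9 := solve_first h9 ltac:(by rewrite !mulf_neq0).
rewrite h9 h8 h7 h6 h5 h4 h3 h2 h1 h0; field.
by rewrite ?n0 ?n1 ?n2 ?n3 ?n4 ?n5 ?n6 ?n7 ?n8 ?n9.
Qed.

(** The exchange of the third and fourth index multiplies the base cubic by the
    quotient of the two coefficients in the conclusion. *)
Lemma cubic_identity x01 x02 x03 x10 x20 x30 x12 x21 x13 x31 :
  (d0-d3) != 0 ->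
  (d2+d4+d5) != 0 ->
  (d0+d2+d3) != 0 ->
  (d2-d0) != 0 ->
  (d3+d4+d5) != 0 ->
  (d1-d2) != 0 ->
  (d0+d1+d2) != 0 ->
  (d3-d1) != 0 ->
  (d0-d3) != 0 ->
  (d0+d1+d3) != 0 ->
  (d3+d4+d5)*(d2-d0)*x13 - (d0+d4+d5)*(d2-d3)*x10 + (d0-d3)*(d2+d4+d5)*x12 = 0 ->
  (d1-d2)*(d0+d1+d2)*x30 - (d3-d2)*(d0+d2+d3)*x10 + (d3-d1)*(d0+d1+d3)*x20 = 0 ->
  (d2+d4+d5)*(d3-d1)*x02 - (d1+d4+d5)*(d3-d2)*x01 + (d1-d2)*(d3+d4+d5)*x03 = 0 ->
  (d0-d3)*(d0+d1+d3)*x21 - (d2-d3)*(d1+d2+d3)*x01 + (d2-d0)*(d0+d1+d2)*x31 = 0 ->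
  -(d0-d3)*(d2+d4+d5)*(d0+d2+d3)*x12
  - (d1-d3)*(d0+d4+d5)*(d0+d1+d3)*x20
  +(d2-d3)*(d0+d4+d5)*(d0+d2+d3)*x10
  +(d1-d2)*(d3+d4+d5)*(d1+d2+d3)*x03
  +(d0-d2)*(d1+d4+d5)*(d0+d1+d2)*x31
  +(d2-d3)*(d1+d4+d5)*(d1+d2+d3)*x01 = 0 ->
  (d0-d2)*(d1-d2)*(d0+d1+d2)*(d3+d4+d5)*(x01*x13*x30-x03*x31*x10)
  = (d1-d3)*(d0-d3)*(d0+d1+d3)*(d2+d4+d5)*(x01*x12*x20-x02*x21*x10).
Proof.
move=> n0 n1 n2 n3 n4 n5 n6 n7 n8 n9 h0 h1 h2 h3 h4.
have {}h0 := solve_first h0 ltac:(by rewrite !mulf_neq0).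
have {}h1 := solve_first h1 ltac:(by rewrite !mulf_neq0).
have {}h2 := solve_first h2 ltac:(by rewrite !mulf_neq0).
have {}h3 := solve_first h3 ltac:(by rewrite !mulf_neq0).
rewrite h0 h1 h2 h3; apply/eqP; rewrite -subr_eq0; apply/eqP.
(* The difference of the two sides is a multiple of the six-term relation. *)
transitivity ((-(d0-d3)*(d2+d4+d5)*(d0+d2+d3)*x12
   - (d1-d3)*(d0+d4+d5)*(d0+d1+d3)*x20
   +(d2-d3)*(d0+d4+d5)*(d0+d2+d3)*x10
   +(d1-d2)*(d3+d4+d5)*(d1+d2+d3)*x03
   +(d0-d2)*(d1+d4+d5)*(d0+d1+d2)*x31
   +(d2-d3)*(d1+d4+d5)*(d1+d2+d3)*x01)
  * (x01*x10*(d2-d3))); last by rewrite h4 mul0r.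
field.
by rewrite ?n0 ?n1 ?n2 ?n3 ?n4 ?n5 ?n6 ?n7 ?n8 ?n9.
Qed.
End CubicAlgebra.

Section Configurations.
Variable K : fieldType.
Hypothesis K3 : 3%:R != 0 :> K.
Implicit Types (d : nat -> K) (w : nat -> 'cV[K]_4) (v : 'rV[K]_4).

Definition form (c : 'cV[K]_4) v : K := (v *m c) 0 0.

Lemma formD c v v' : form c (v + v') = form c v + form c v'.
Proof. by rewrite /form mulmxDl mxE. Qed.
Lemma formZ c a v : form c (a *: v) = a * form c v.
Proof. by rewrite /form -scalemxAl mxE. Qed.
Lemma form0 c : form c 0 = 0.
Proof. by rewrite /form mul0mx mxE. Qed.

(** None of the 36 positive roots of E_6 vanishes. *)
Definition roots_ok d : Prop :=
  [/\ forall a b, (a < 6)%N -> (b < 6)%N -> a != b -> d a - d b != 0,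
      forall a b c, (a < 6)%N -> (b < 6)%N -> (c < 6)%N -> uniq [:: a; b; c] ->
        d a + d b + d c != 0
    & d 0%N + d 1%N + d 2 + d 3 + d 4 + d 5 != 0].

(** 45 linear forms on a four-dimensional space which satisfy the 270 relations
    and have no common zero but 0: what is retained of the span of S. Stating the
    relations for all words makes the notion stable under the reflections. *)
Record config d w : Prop := Config {
  config_roots : roots_ok d;
  config_lin : forall ws v,
    base_form (param_word ws d) (fun t => form (w (tri_word ws t)) v) = 0;
  config_span : forall v, (forall t, (t < 45)%N -> form (w t) v = 0) -> v = 0 }.

(** The reflection permutes the 36 roots up to sign: a root with k of its indices
    among the first three is treated according to k. *)
Lemma roots_tau d : roots_ok d -> roots_ok (param_refl 5 d).
Proof.
move=> [hd h3 hS].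
have e3 : 1 / 3%:R = 1 - 2%:R / 3%:R :> K by field.
set sg := d 0%N + d 1%N + d 2.
have dE a : param_refl 5 d a = d a - 2%:R / 3%:R * sg + (if (a < 3)%N then 0 else sg).
  by rewrite /param_refl /=; case: ifP => _; rewrite ?addr0 // -/sg e3; ring.
split.
- move=> a b a6 b6 ab; rewrite !dE.
  have [a3|a3] := ltnP a 3; have [b3|b3] := ltnP b 3.
  + by have := hd a b a6 b6 ab; congr (_ != 0); ring.
  + have [p [q [pq6 pqU ->]]] : exists p q, [/\ (p < 6)%N && (q < 6)%N,
        uniq [:: b; p; q] & sg = d a + d p + d q].
      case: a a6 a3 ab => [|[|[|//]]] _ _ _.
      * exists 1%N, 2; split=> //; rewrite /= !inE; lia.
      * exists 0%N, 2; split=> //; first (by rewrite /= !inE; lia); rewrite /sg; ring.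
      * exists 0%N, 1%N; split=> //; first (by rewrite /= !inE; lia); rewrite /sg; ring.
    move: pq6 => /andP [p6 q6]; have := h3 b p q b6 p6 q6 pqU.
    by rewrite -oppr_eq0; congr (_ != 0); ring.
  + have [p [q [pq6 pqU ->]]] : exists p q, [/\ (p < 6)%N && (q < 6)%N,
        uniq [:: a; p; q] & sg = d b + d p + d q].
      case: b b6 b3 ab => [|[|[|//]]] _ _ _.
      * exists 1%N, 2; split=> //; rewrite /= !inE; lia.
      * exists 0%N, 2; split=> //; first (by rewrite /= !inE; lia); rewrite /sg; ring.
      * exists 0%N, 1%N; split=> //; first (by rewrite /= !inE; lia); rewrite /sg; ring.
    move: pq6 => /andP [p6 q6]; have := h3 a p q a6 p6 q6 pqU.
    by congr (_ != 0); ring.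
  + by have := hd a b a6 b6 ab; congr (_ != 0); ring.
- have key a b c : (a <= b)%N -> (b <= c)%N -> (a < 6)%N -> (b < 6)%N -> (c < 6)%N ->
      uniq [:: a; b; c] -> param_refl 5 d a + param_refl 5 d b + param_refl 5 d c != 0.
    move=> ab bc a6 b6 c6 U; rewrite !dE.
    have [c3|c3] := ltnP c 3.
      have [-> -> ->] : [/\ a = 0, b = 1 & c = 2]%N.
        by move: U; rewrite /= !inE; split; lia.
      have := h3 0%N 1%N 2 isT isT isT isT; rewrite -oppr_eq0; congr (_ != 0).
      by rewrite /= /sg; field.
    have [b3|b3] := ltnP b 3.
      have [r [r6 rU ->]] : exists r, [/\ (r < 6)%N, r != c & sg = d a + d b + d r].
        have : (a, b) \in [:: (0, 1); (0, 2); (1, 2)]%N.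
          by move: U; rewrite /= !inE !xpair_eqE; lia.
        rewrite !inE => /or3P [] /eqP [-> ->].
        * by exists 2; split=> //; lia.
        * by exists 1%N; split=> //; [lia | rewrite /sg; ring].
        * by exists 0%N; split=> //; [lia | rewrite /sg; ring].
      rewrite (leq_ltn_trans ab b3); have := hd c r c6 r6; rewrite eq_sym rU => /(_ isT).
      by congr (_ != 0); field.
    have [a3|a3] := ltnP a 3.
      by have := h3 a b c a6 b6 c6 U; congr (_ != 0); field.
    have [-> -> ->] : [/\ a = 3, b = 4 & c = 5]%N.
      by move: U; rewrite /= !inE; split; lia.
    by move: hS; congr (_ != 0); rewrite /= /sg; field.
  move=> a b c a6 b6 c6 U.
  have : sorted leq (sort leq [:: a; b; c]) := sort_sorted leq_total _.
  have U' : uniq (sort leq [:: a; b; c]) by rewrite sort_uniq.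
  have hl x : x \in sort leq [:: a; b; c] -> (x < 6)%N.
    by rewrite mem_sort !inE => /or3P [] /eqP ->.
  have pl : perm_eq (sort leq [:: a; b; c]) [:: a; b; c] by rewrite perm_sort.
  have eS : \sum_(x <- sort leq [:: a; b; c]) param_refl 5 d x =
            param_refl 5 d a + param_refl 5 d b + param_refl 5 d c.
    by rewrite (perm_big _ pl) /= !big_cons big_nil addr0 addrA.
  have := size_sort leq [:: a; b; c]; rewrite -eS.
  case: (sort _ _) U' hl => [|x [|y [|z []]]] //= U' hl _ /and3P [xy yz _].
  rewrite !big_cons big_nil addr0 addrA; apply: key => //; apply: hl; by rewrite !inE eqxx ?orbT.
- rewrite !dE /=; have := h3 3 4 5 isT isT isT isT; congr (_ != 0).
  by rewrite /sg; field.
Qed.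

Lemma roots_refl g d : roots_ok d -> roots_ok (param_refl g d).
Proof.
have [g5|g5] := ltnP g 5; last first.
  by rewrite (_ : param_refl g d = param_refl 5 d) /param_refl 1?ltnNge ?g5 //; apply: roots_tau.
move=> [hd h3 hS]; rewrite /param_refl g5; split.
- move=> a b a6 b6 ab; apply: hd; rewrite ?swap_nat_lt // ?swap_nat_inj //.
- move=> a b c a6 b6 c6 U; apply: h3; rewrite ?swap_nat_lt //.
  by rewrite -[[:: _; _; _]]/(map (swap_nat g) [:: a; b; c]) map_inj_uniq // => x y /eqP;
    rewrite swap_nat_inj => /eqP.
- move: hS; congr (_ != 0); case: g g5 => [|[|[|[|[|//]]]]] _; rewrite /swap_nat /=; ring.
Qed.

Lemma config_refl g d w : config d w -> config (param_refl g d) (w \o tri_refl g).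
Proof.
move=> [hr hl hs]; split; first exact: roots_refl.
  by move=> ws v; have := hl (g :: ws) v.
move=> v hv; apply: hs => t t45; rewrite -(tri_reflK g t45).
exact: (hv _ (tri_refl_lt g t45)).
Qed.

Lemma config_word ws d w : config d w -> config (param_word ws d) (w \o tri_word ws).
Proof.
elim: ws d w => [|g ws IH] d w hc //=.
exact: (IH _ _ (config_refl g hc)).
Qed.

(** Lets a relation be transported from one choice of indices to all. *)
Lemma perm_word (l : seq nat) : perm_eq l (iota 0 6) -> exists ws,
  [/\ forall d a, (a < 6)%N -> param_word ws d a = d (nth 0%N l a),
      forall a b, (a < 6)%N -> (b < 6)%N -> a != b ->
        tri_word ws (xc a b) = xc (nth 0%N l a) (nth 0%N l b)
    & forall m, perm_eq m (iota 0 6) ->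
        tri_word ws (yc m) = yc (map (nth 0%N l) m)].
Proof.
move=> /perm_of_seq [p ->]; have [ws [hp ht]] := realizable_perm K p.
have nthp (i : 'I_6) : nth 0%N (perm_vals p) i = p i.
  by rewrite (nth_map ord0) ?size_enum_ord // nth_ord_enum.
have act t u : (t < 45)%N -> (u < 45)%N -> relab p @: tset t = tset u -> tri_word ws t = u.
  move=> t45 u45 e; apply: tri_of_inj; rewrite ?tri_word_lt // -ht //.
  rewrite /act_index /act_tritangent val_tri_of // e; congr (tri_index _).
  by apply: val_inj; rewrite !val_insubd tset_tritangent.
exists ws; split.
- move=> d a a6; pose d' (i : 'I_6) := d i.
  have e b : (b < 6)%N -> params d' b = d b by move=> b6; rewrite /params /d' inordK.
  rewrite -(param_word_ext _ e) // -hp //.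
  by rewrite /params /perm_param /d' -nthp inordK.
- move=> a b a6 b6 ab; rewrite xcE (nthp (Ordinal a6)) (nthp (Ordinal b6)).
  have ab' : Ordinal a6 != Ordinal b6 by [].
  have pab : p (Ordinal a6) != p (Ordinal b6) by rewrite (inj_eq perm_inj).
  apply: act; first by have [] := xcodeP a6 b6 ab.
    by have [] := xcodeP (ltn_ord (p (Ordinal a6))) (ltn_ord (p (Ordinal b6))) pab.
  rewrite (tset_xcode ab') tset_xcode // !imsetU !imset_set1 relab_labF //.
- move=> m /perm_of_seq [q ->]; rewrite !ycE.
  have -> : map (nth 0%N (perm_vals p)) (perm_vals q) = perm_vals (q * p)%g.
    by rewrite /perm_vals -map_comp; apply: eq_map => i /=; rewrite nthp permM.
  apply: act.
  - by have [] := ycodeP (perm_vals_iota q).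
  - by have [] := ycodeP (perm_vals_iota (q * p)%g).
  have ne a b : a != b -> q a != q b by rewrite (inj_eq perm_inj).
  apply: (etrans (congr1 (fun T : {set label} => relab p @: T) (tset_ycode q))).
  apply: (etrans _ (esym (tset_ycode (q * p)%g))).
  rewrite !imsetU !imset_set1 !permM.
  rewrite (relab_labF p (ne i1 i2 isT)) (relab_labF p (ne i3 i4 isT)).
  rewrite (relab_labF p (ne i5 i6 isT)).
  reflexivity.
Qed.

Section Relations.
Variables (d : nat -> K) (w : nat -> 'cV[K]_4) (v : 'rV[K]_4).
Hypothesis hc : config d w.
Let X a b := form (w (xc a b)) v.

Lemma pencilG a b c e f g : perm_eq [:: a; b; c; e; f; g] (iota 0 6) ->
  (d c - d e) * (d a + d c + d e) * X b a - (d b - d e) * (d a + d b + d e) * X c a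
  + (d b - d c) * (d a + d b + d c) * X e a = 0.
Proof.
move=> /perm_word [ws [hd hx _]]; have := config_lin hc ws v; rewrite /base_form -xcE.
rewrite (hd d 0%N isT) (hd d 1%N isT) (hd d 2 isT) (hd d 3 isT).
rewrite (hx 1%N 0%N isT isT isT) (hx 2 0%N isT isT isT) (hx 3 0%N isT isT isT).
exact.
Qed.
End Relations.

(** The pencils of the lines E and F come from the pencil of a line G by the
    reflection in d_1 + d_2 + d_3 and permutations. *)
Lemma pencilF_std d w v : config d w ->
  let X a b := form (w (xc a b)) v in
  (d 5 + d 1%N + d 2) * (d 5 + d 0%N + d 3) * X 4 5
  - (d 4 + d 1%N + d 2) * (d 4 + d 0%N + d 3) * X 5 4
  + (d 4 - d 5) * (d 0%N + d 1%N + d 2 + d 3 + d 4 + d 5)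
    * form (w (yc [:: 4; 5; 0; 3; 1; 2]%N)) v = 0.
Proof.
move=> hc /=.
have := pencilG v (config_refl 5 hc) (a := 3) (b := 4) (c := 5) (e := 0) (f := 1) (g := 2) isT.
rewrite /comp (_ : tri_refl 5 (xc 4 3) = xc 4 5); last by rewrite xcE; vm_compute.
rewrite (_ : tri_refl 5 (xc 5 3) = xc 5 4); last by rewrite xcE; vm_compute.
rewrite (_ : tri_refl 5 (xc 0 3) = yc [:: 4; 5; 0; 3; 1; 2]%N); last first.
  by rewrite xcE ycE; vm_compute.
move: (form _ v) (form _ v) (form _ v) => x x' y h.
by rewrite -[RHS]h /param_refl /=; field.
Qed.

Lemma pencilFF_std d w v : config d w ->
  let X a b := form (w (xc a b)) v in
  (d 0%N - d 1%N) * (d 3 - d 2) * X 4 5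
  - (d 0%N + d 2 + d 4) * (d 1%N + d 3 + d 4) * form (w (yc [:: 4; 5; 0; 3; 1; 2]%N)) v
  + (d 1%N + d 2 + d 4) * (d 0%N + d 3 + d 4) * form (w (yc [:: 4; 5; 1; 3; 0; 2]%N)) v
  = 0.
Proof.
move=> hc /=.
have := pencilG v (config_refl 5 hc) (a := 3) (b := 4) (c := 0) (e := 1) (f := 2) (g := 5) isT.
rewrite /comp (_ : tri_refl 5 (xc 4 3) = xc 4 5); last by rewrite xcE; vm_compute.
rewrite (_ : tri_refl 5 (xc 0 3) = yc [:: 4; 5; 0; 3; 1; 2]%N); last first.
  by rewrite xcE ycE; vm_compute.
rewrite (_ : tri_refl 5 (xc 1 3) = yc [:: 4; 5; 1; 3; 0; 2]%N); last first.
  by rewrite xcE ycE; vm_compute.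
move: (form _ v) (form _ v) (form _ v) => x x' y h.
by rewrite -[RHS]h /param_refl /=; field.
Qed.

Lemma pencilF p q r s t u d w v : perm_eq [:: r; t; u; s; p; q] (iota 0 6) ->
  config d w ->
  let X a b := form (w (xc a b)) v in
  (d q + d t + d u) * (d q + d r + d s) * X p q
  - (d p + d t + d u) * (d p + d r + d s) * X q p
  + (d p - d q) * (d r + d t + d u + d s + d p + d q)
    * form (w (yc [:: p; q; r; s; t; u]%N)) v = 0.
Proof.
move=> /perm_word [ws [hd hx hy]] hc /=.
have := pencilF_std v (config_word ws hc).
rewrite /comp (hx 4 5 isT isT isT) (hx 5 4 isT isT isT) (hy [:: 4; 5; 0; 3; 1; 2]%N isT).
rewrite (hd d 0%N isT) (hd d 1%N isT) (hd d 2 isT) (hd d 3 isT) (hd d 4 isT) (hd d 5 isT).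
exact.
Qed.

Lemma pencilFF p q r s t u d w v : perm_eq [:: r; t; u; s; p; q] (iota 0 6) ->
  config d w ->
  (d r - d t) * (d s - d u) * form (w (xc p q)) v
  - (d r + d u + d p) * (d t + d s + d p) * form (w (yc [:: p; q; r; s; t; u]%N)) v
  + (d t + d u + d p) * (d r + d s + d p) * form (w (yc [:: p; q; t; s; r; u]%N)) v = 0.
Proof.
move=> /perm_word [ws [hd hx hy]] hc /=.
have := pencilFF_std v (config_word ws hc).
rewrite /comp (hx 4 5 isT isT isT) (hy [:: 4; 5; 0; 3; 1; 2]%N isT).
rewrite (hy [:: 4; 5; 1; 3; 0; 2]%N isT).
rewrite (hd d 0%N isT) (hd d 1%N isT) (hd d 2 isT) (hd d 3 isT) (hd d 4 isT).
exact.
Qed.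

Lemma pencilE_std d w v : config d w ->
  let X a b := form (w (xc a b)) v in
  (d 1%N + d 4 + d 5) * (d 3 - d 2) * X 0%N 1%N
  - (d 2 + d 4 + d 5) * (d 3 - d 1%N) * X 0%N 2
  + (d 2 - d 1%N) * (d 3 + d 4 + d 5) * X 0%N 3 = 0.
Proof.
move=> hc /=.
have := pencilF v (p := 2) (q := 1) (r := 0) (s := 3) (t := 4) (u := 5) isT (config_refl 5 hc).
rewrite /comp (_ : tri_refl 5 (xc 2 1) = xc 0 1); last by rewrite xcE; vm_compute.
rewrite (_ : tri_refl 5 (xc 1 2) = xc 0 2); last by rewrite xcE; vm_compute.
rewrite (_ : tri_refl 5 (yc [:: 2; 1; 0; 3; 4; 5]%N) = xc 0 3); last first.
  by rewrite xcE ycE; vm_compute.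
move: (form _ v) (form _ v) (form _ v) => x x' y h.
by rewrite -[RHS]h /param_refl /=; field.
Qed.

Lemma pencilE a b c e f g d w v : perm_eq [:: a; b; c; e; f; g] (iota 0 6) ->
  config d w ->
  let X a b := form (w (xc a b)) v in
  (d b + d f + d g) * (d e - d c) * X a b - (d c + d f + d g) * (d e - d b) * X a c
  + (d c - d b) * (d e + d f + d g) * X a e = 0.
Proof.
move=> /perm_word [ws [hd hx hy]] hc /=.
have := pencilE_std v (config_word ws hc).
rewrite /comp (hx 0%N 1%N isT isT isT) (hx 0%N 2 isT isT isT) (hx 0%N 3 isT isT isT).
rewrite (hd d 1%N isT) (hd d 2 isT) (hd d 3 isT) (hd d 4 isT) (hd d 5 isT).
exact.
Qed.

Definition cubic w v : K :=
  form (w (xc 0 1)) v * form (w (xc 1 2)) v * form (w (xc 2 0)) v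
  - form (w (xc 0 2)) v * form (w (xc 2 1)) v * form (w (xc 1 0)) v.

(** Of the simple reflections only the exchange of the third and fourth index
    does more to the base cubic than change its sign; the new cubic is
    nevertheless proportional to the old one on the configuration. *)
Lemma cubic_swap23 d w : config d w -> exists2 k, k != 0 &
  forall v, cubic (w \o tri_refl 2) v = k * cubic w v.
Proof.
move=> hc; have [hd h3 hS] := config_roots hc.
have D a b : (a < 6)%N -> (b < 6)%N -> a != b -> d a - d b != 0 := hd a b.
pose X a b v := form (w (xc a b)) v.
pose k1 := (d 0%N - d 2) * (d 1%N - d 2) * (d 0%N + d 1%N + d 2) * (d 3 + d 4 + d 5).
pose k2 := (d 1%N - d 3) * (d 0%N - d 3) * (d 0%N + d 1%N + d 3) * (d 2 + d 4 + d 5).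
have n1 : k1 != 0 by rewrite !mulf_neq0 // ?hd ?h3.
have n2 : k2 != 0 by rewrite !mulf_neq0 // ?hd ?h3.
suff E v : k1 * cubic (w \o tri_refl 2) v = k2 * cubic w v.
  clearbody k1 k2; exists (k2 / k1); first by rewrite mulf_neq0 ?invr_neq0.
  by move=> v; rewrite mulrAC -E mulrAC divff // mul1r.
rewrite /k1 /k2 => {k1 k2 n1 n2}.
rewrite /cubic /comp (_ : tri_refl 2 (xc 0 1) = xc 0 1); last by rewrite xcE; vm_compute.
rewrite (_ : tri_refl 2 (xc 1 2) = xc 1 3); last by rewrite xcE; vm_compute.
rewrite (_ : tri_refl 2 (xc 2 0) = xc 3 0); last by rewrite xcE; vm_compute.
rewrite (_ : tri_refl 2 (xc 0 2) = xc 0 3); last by rewrite xcE; vm_compute.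
rewrite (_ : tri_refl 2 (xc 2 1) = xc 3 1); last by rewrite xcE; vm_compute.
rewrite (_ : tri_refl 2 (xc 1 0) = xc 1 0); last by rewrite xcE; vm_compute.
have Ya : yc [:: 1; 2; 3; 0; 4; 5]%N = yc [:: 0; 3; 1; 2; 4; 5]%N by rewrite !ycE; vm_compute.
have Yb : yc [:: 1; 2; 4; 0; 3; 5]%N = yc [:: 0; 4; 1; 2; 3; 5]%N by rewrite !ycE; vm_compute.
have Yc : yc [:: 3; 1; 2; 0; 4; 5]%N = yc [:: 0; 2; 3; 1; 4; 5]%N by rewrite !ycE; vm_compute.
have Ye : yc [:: 3; 1; 4; 0; 2; 5]%N = yc [:: 0; 4; 3; 1; 2; 5]%N by rewrite !ycE; vm_compute.
have e1 := @pencilE 0 1 3 4 2 5 d w v isT hc.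
have e2 := @pencilE 0 2 3 4 1 5 d w v isT hc.
have g1 := @pencilG d w v hc 0 1 3 4 2 5 isT.
have g2 := @pencilG d w v hc 0 2 3 4 1 5 isT.
have f1 := @pencilF 0 3 1 2 4 5 d w v isT hc.
have f2 := @pencilF 0 4 1 2 3 5 d w v isT hc.
have f3 := @pencilF 0 2 3 1 4 5 d w v isT hc.
have f4 := @pencilF 0 4 3 1 2 5 d w v isT hc.
have y1 := @pencilFF 1 2 3 0 4 5 d w v isT hc.
have y2 := @pencilFF 3 1 2 0 4 5 d w v isT hc.
rewrite Ya Yb in y1; rewrite Yc Ye in y2.
have e3 := @pencilE 1 3 0 2 4 5 d w v isT hc.
have g3 := @pencilG d w v hc 0 3 1 2 4 5 isT.
have e4 := @pencilE 0 2 1 3 4 5 d w v isT hc.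
have g4 := @pencilG d w v hc 1 2 0 3 4 5 isT.
have ne (x y : K) : x = y -> x != 0 -> y != 0 by move=> ->.
move: Ya Yb Yc Ye => _ _ _ _; rewrite /= in e1 e2 f1 f2 f3 f4 e3 e4.
move: (form (w (xc 0 1)) v) (form (w (xc 0 2)) v) (form (w (xc 0 3)) v) (form (w (xc 0 4)) v)
  (form (w (xc 1 0)) v) (form (w (xc 2 0)) v) (form (w (xc 3 0)) v) (form (w (xc 4 0)) v)
  (form (w (xc 1 2)) v) (form (w (xc 3 1)) v) (form (w (xc 2 1)) v) (form (w (xc 1 3)) v)
  (form (w (yc _)) v) (form (w (yc _)) v) (form (w (yc _)) v) (form (w (yc _)) v)
  e1 e2 g1 g2 f1 f2 f3 f4 y1 y2 e3 g3 e4 g4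
  => x01 x02 x03 x04 x10 x20 x30 x40 x12 x31 x21 x13 ya yb ye yc' e1 e2 g1 g2 f1 f2 f3 f4 y1 y2 e3 g3 e4 g4.
have h6 := @six_term_relation K (d 0%N) (d 1%N) (d 2) (d 3) (d 4) (d 5)
  x01 x02 x03 x04 x10 x20 x30 x40 x12 x31 yc' ye yb ya.
apply: (@cubic_identity K (d 0%N) (d 1%N) (d 2) (d 3) (d 4) (d 5)
  x01 x02 x03 x10 x20 x30 x12 x21 x13 x31); last apply: h6.
all: try by [exact: hd | exact: h3 | exact: hS].
- by rewrite -[RHS]e3; ring.
- by rewrite -[RHS]g3; ring.
- by rewrite -[RHS]e4; ring.
- by rewrite -[RHS]g4; ring.
- by rewrite -[RHS]e1; ring.
- by rewrite -[RHS]e2; ring.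
- by rewrite -[RHS]g1; ring.
- by rewrite -[RHS]g2; ring.
- by rewrite -[RHS]f1; ring.
- by rewrite -[RHS]f2; ring.
- by rewrite -[RHS]f3; ring.
- by rewrite -[RHS]f4; ring.
- by rewrite -[RHS]y1; ring.
- by rewrite -[RHS]y2; ring.
Qed.

Lemma cubic_refl d w g : config d w -> exists2 k, k != 0 &
  forall v, cubic (w \o tri_refl g) v = k * cubic w v.
Proof.
move=> hc.
wlog g6 : g / (g < 6)%N.
  move=> h; have [|g6] := ltnP g 6; first exact: h.
  have -> : tri_refl g = tri_refl 5 by rewrite /tri_refl (minn_idPr (ltnW g6)).
  exact: h.
have sgn (k : K) : k \in [:: 1; -1] -> k != 0.
  by rewrite !inE => /orP [] /eqP ->; rewrite ?oppr_eq0 oner_eq0.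
have R (l l' : seq (nat * nat)) :
   map (tri_refl g) [seq xcode a.1 a.2 | a <- l] = [seq xcode a.1 a.2 | a <- l'] ->
   map (fun a => tri_refl g (xc a.1 a.2)) l = map (fun a => xc a.1 a.2) l'.
  by rewrite -map_comp xcE.
have {}R l' := R [:: (0, 1); (1, 2); (2, 0); (0, 2); (2, 1); (1, 0)]%N l'.
case: g g6 R => [|[|[|[|[|[|//]]]]]] _ R.
- exists (-1); first by apply: sgn; rewrite !inE eqxx orbT.
  move=> v; rewrite /cubic /comp.
  have [-> -> -> -> -> ->] := R [:: (1, 0); (0, 2); (2, 1); (1, 2); (2, 0); (0, 1)]%N
    ltac:(by vm_compute).
  by rewrite /=; ring.
- exists (-1); first by apply: sgn; rewrite !inE eqxx orbT.
  move=> v; rewrite /cubic /comp.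
  have [-> -> -> -> -> ->] := R [:: (0, 2); (2, 1); (1, 0); (0, 1); (1, 2); (2, 0)]%N
    ltac:(by vm_compute).
  by rewrite /=; ring.
- exact: cubic_swap23 hc.
- exists 1; first by apply: sgn; rewrite !inE eqxx.
  move=> v; rewrite /cubic /comp.
  have [-> -> -> -> -> ->] := R [:: (0, 1); (1, 2); (2, 0); (0, 2); (2, 1); (1, 0)]%N
    ltac:(by vm_compute).
  by rewrite /=; ring.
- exists 1; first by apply: sgn; rewrite !inE eqxx.
  move=> v; rewrite /cubic /comp.
  have [-> -> -> -> -> ->] := R [:: (0, 1); (1, 2); (2, 0); (0, 2); (2, 1); (1, 0)]%N
    ltac:(by vm_compute).
  by rewrite /=; ring.
- exists (-1); first by apply: sgn; rewrite !inE eqxx orbT.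
  move=> v; rewrite /cubic /comp.
  have [-> -> -> -> -> ->] := R [:: (2, 1); (0, 2); (1, 0); (1, 2); (0, 1); (2, 0)]%N
    ltac:(by vm_compute).
  by rewrite /=; ring.
Qed.

(** All conjugates of the base cubic cut out one surface in the span: the factors
    of proportionality of the single reflections multiply up. *)
Lemma cubic_word ws d w v : config d w ->
  cubic (w \o tri_word ws) v = 0 <-> cubic w v = 0.
Proof.
elim: ws d w => [|g ws IH] d w hc; first exact: iff_refl.
have hc' := config_refl g hc; have [k k0 ek] := cubic_refl g hc.
apply: (iff_trans (IH _ _ hc')); rewrite ek.
split=> [/eqP|->]; last by rewrite mulr0.
by rewrite mulf_eq0 (negbTE k0) => /eqP.
Qed.
End Configurations.

(** * Lines and tritangent planes of the surface *)

(** A form is determined by two others through a common line; five rounds of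
    this rule lead from each of the sets of four forms used below to all 45. *)
Definition span_step (S : seq nat) : seq nat :=
  [seq t <- iota 0 45 | if t \in S then true else
     has (fun c => (1 < count (fun u => c \in lines u) S)%N) (lines t)].

Definition spans (S : seq nat) : bool :=
  [&& uniq S, all (fun t => t < 45)%N S &
      all (fun t => t \in iter 5 span_step S) (iota 0 45)].

Lemma label_table_lt g c : (c < 27)%N -> (label_table g c < 27)%N.
Proof.
have /all_ltP h : all (fun g => all (fun c => label_table g c < 27)%N (iota 0 27))
  (iota 0 6) by vm_compute.
move=> c27; have [g6|g6] := ltnP g 6; first by have /h /all_ltP := g6; apply.
have -> : label_table g c = label_table 5 c by rewrite /label_table ltnNge (ltnW g6).
by have /all_ltP := h 5 isT; apply.
Qed.

Lemma mem_lines_refl g c t : (c < 27)%N -> (t < 45)%N ->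
  (label_table g c \in lines (tri_refl g t)) = (c \in lines t).
Proof.
have /all_ltP h : all (fun g => all (fun c => all (fun t =>
    (label_table g c \in lines (tri_refl g t)) == (c \in lines t)) (iota 0 45)) (iota 0 27))
  (iota 0 6) by vm_compute.
move=> c27 t45; have [g6|g6] := ltnP g 6.
  by have /h /all_ltP /(_ c c27) /all_ltP /(_ t t45) /eqP := g6.
have -> : label_table g c = label_table 5 c by rewrite /label_table ltnNge (ltnW g6).
have -> : tri_refl g = tri_refl 5 by rewrite /tri_refl (minn_idPr (ltnW g6)).
by have /h /all_ltP /(_ c c27) /all_ltP /(_ t t45) /eqP : (5 < 6)%N by [].
Qed.

(** W(E_6) permutes the 27 lines transitively; G_1, with code 6, is the line
    common to the three triples of the base linear form. *)
Lemma label_ind (P : nat -> Prop) : P 6 ->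
  (forall g c, (c < 27)%N -> P c -> P (label_table g c)) ->
  forall c, (c < 27)%N -> P c.
Proof.
move=> P6 hP c c27.
have : c \in closure [seq label_table g | g <- iota 0 6] 30 [:: 6%N] [:: 6%N].
  move: c c27; apply/all_ltP; by vm_compute.
move=> hc; suff : (c < 27)%N /\ P c by case.
move: c {c27} hc; apply: closure_ind => // x [x27 Px] z.
rewrite -map_comp => /mapP [g _ ->]; split; first exact: label_table_lt.
exact: hP.
Qed.

(** W(E_6) permutes the 45 tritangents transitively. *)
Lemma tri_ind (P : nat -> Prop) : P (xcode 0 1) ->
  (forall g t, (t < 45)%N -> P t -> P (tri_refl g t)) ->
  forall t, (t < 45)%N -> P t.
Proof.
move=> P0 hP t t45.
have : t \in closure [seq tri_refl g | g <- iota 0 6] 30 [:: xcode 0 1] [:: xcode 0 1].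
  move: t t45; apply/all_ltP; by vm_compute.
move=> ht; suff : (t < 45)%N /\ P t by case.
move: t {t45} ht; apply: closure_ind => [|x [x27 Px] z]; first by split=> //; vm_compute.
rewrite -map_comp => /mapP [g _ ->]; split; first exact: tri_refl_lt.
exact: hP.
Qed.

Lemma lin3_vanish (K : fieldType) (a b c x y z : K) :
  a != 0 -> b != 0 -> c != 0 -> a * x - b * y + c * z = 0 ->
  [/\ x = 0 -> y = 0 -> z = 0, x = 0 -> z = 0 -> y = 0 & y = 0 -> z = 0 -> x = 0].
Proof.
move=> a0 b0 c0 e; split=> h1 h2; move/eqP: e; rewrite h1 h2 !mulr0 ?subr0 ?sub0r ?add0r ?addr0.
- by rewrite mulf_eq0 (negbTE c0) => /eqP.
- by rewrite oppr_eq0 mulf_eq0 (negbTE b0) => /eqP.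
- by rewrite mulf_eq0 (negbTE a0) => /eqP.
Qed.

Section Geometry.
Variable K : fieldType.
Hypothesis K3 : 3%:R != 0 :> K.
Implicit Types (d : nat -> K) (w : nat -> 'cV[K]_4) (v : 'rV[K]_4).

Definition on_line w c v : bool := all (fun t => form (w t) v == 0) (through c).

Lemma on_lineP w c v :
  reflect (forall t, (t < 45)%N -> c \in lines t -> form (w t) v = 0) (on_line w c v).
Proof.
apply: (iffP allP) => h t; last by rewrite mem_through => /andP [t45 ct]; apply/eqP/h.
by move=> t45 ct; apply/eqP/h; rewrite mem_through t45.
Qed.

Lemma on_line_comb w c a b x y : on_line w c a -> on_line w c b ->
  on_line w c (x *: a + y *: b).
Proof.
move=> /on_lineP ha /on_lineP hb; apply/on_lineP => t t45 ct.
by rewrite formD !formZ ha // hb // !mulr0 addr0.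
Qed.

Lemma on_line_refl g w c v : (c < 27)%N ->
  on_line (w \o tri_refl g) c v = on_line w (label_table g c) v.
Proof.
move=> c27; apply/on_lineP/on_lineP => h t t45 ct.
  rewrite -(tri_reflK g t45); apply: h; first exact: tri_refl_lt.
  by rewrite -(mem_lines_refl g) ?tri_refl_lt // tri_reflK.
by apply: h; [exact: tri_refl_lt | rewrite mem_lines_refl].
Qed.

(** Three planes through a line satisfy one of the 270 relations, whose three
    coefficients are products of roots. *)
Lemma pencil_vanish d w v c t t' t'' : config d w -> (c < 27)%N ->
  t \in through c -> t' \in through c -> t'' \in through c -> t != t' ->
  form (w t) v = 0 -> form (w t') v = 0 -> form (w t'') v = 0.
Proof.
move=> hc c27 ht ht' ht'' tt' h h'.
have [->//|n] := eqVneq t'' t; have [->//|n'] := eqVneq t'' t'.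
have U : uniq [:: t; t'; t''] by rewrite /= !inE negb_or tt' eq_sym n eq_sym n'.
have := mem_pencil_triples c27 ht ht' ht'' U.
pose P (l : seq nat) := forall d w v, config d w -> {in l &, forall t t', t != t' ->
   form (w t) v = 0 -> form (w t') v = 0 -> {in l, forall t'', form (w t'') v = 0}}.
suff hP : {in pencil_triples, forall l : seq nat, P l}.
  move=> /hP /(_ d w v hc t t'); rewrite !mem_sort !inE !eqxx ?orbT => /(_ isT isT tt' h h').
  by apply; rewrite mem_sort !inE eqxx !orbT.
have -> : pencil_triples =
    closure [seq (fun l => sort leq (map (tri_refl g) l)) | g <- iota 0 6] 30
    [:: sort leq [:: xcode 1 0; xcode 2 0; xcode 3 0]]
    [:: sort leq [:: xcode 1 0; xcode 2 0; xcode 3 0]].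
  by vm_cast_no_check (erefl pencil_triples).
apply: closure_ind.
  rewrite -xcE => d1 w1 v1 hc1.
  have := config_lin hc1 [::] v1; rewrite /base_form -xcE /=.
  have [hd h3 _] := config_roots hc1.
  have n1 : (d1 2 - d1 3) * (d1 0%N + d1 2 + d1 3) != 0 by rewrite mulf_neq0 ?hd ?h3.
  have n2 : (d1 1%N - d1 3) * (d1 0%N + d1 1%N + d1 3) != 0 by rewrite mulf_neq0 ?hd ?h3.
  have n3 : (d1 1%N - d1 2) * (d1 0%N + d1 1%N + d1 2) != 0 by rewrite mulf_neq0 ?hd ?h3.
  move=> /(lin3_vanish n1 n2 n3) [z3 z2 z1] u u'; rewrite !mem_sort !inE => hu hu' uu' f f' u''.
  rewrite mem_sort !inE => hu''.
  case/or3P: hu f uu' => /eqP -> f; case/or3P: hu' f' => /eqP -> f' //=; rewrite ?eqxx // => _;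
    case/or3P: hu'' => /eqP -> //; by [exact: z1 | exact: z2 | exact: z3].
move=> l Pl z; rewrite -map_comp => /mapP [g _ ->] d1 w1 v1 hc1 u u'.
rewrite /= !mem_sort => /mapP [s sl ->] /mapP [s' s'l ->] ss' f f' u''.
rewrite mem_sort => /mapP [s'' s''l ->].
have := Pl _ _ v1 (config_refl K3 g hc1) s s' sl s'l.
move=> /(_ _ f f' s'' s''l); apply.
by apply: contraNneq ss' => ->.
Qed.

Lemma on_line2 d w v c t t' : config d w -> (c < 27)%N -> t \in through c ->
  t' \in through c -> t != t' -> form (w t) v = 0 -> form (w t') v = 0 -> on_line w c v.
Proof.
move=> hc c27 ht ht' tt' h h'; apply/on_lineP => t'' t45 ct.
by apply: (pencil_vanish hc c27 ht ht' _ tt' h h'); rewrite mem_through t45.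
Qed.

Lemma spans_vanish d w S v : config d w -> spans S ->
  {in S, forall t, form (w t) v = 0} -> v = 0.
Proof.
move=> hc /and3P [uS S45 hS] h0; apply: (config_span hc) => t t45.
have /allP/(_ t) := hS; rewrite mem_iota => /(_ t45); move: t {t45}.
have : [/\ uniq S, all (fun t => t < 45)%N S & {in S, forall t, form (w t) v = 0}] by [].
set n5 := (n in iter n _ _); move: n5 => n.
elim: n S {uS S45 hS h0} => [|n IH] S [uS S45 h0]; first exact: h0.
rewrite iterSr; apply: IH; split; first by rewrite filter_uniq ?iota_uniq.
  by apply/allP => t; rewrite mem_filter mem_iota => /andP [_ /andP [_]].
move=> t; rewrite mem_filter mem_iota add0n => /andP [h /andP [_ t45]].
have [/h0 //|tS] := boolP (t \in S); move: h; rewrite (negbTE tS) => /hasP [c ct hcount].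
move: hcount; rewrite -size_filter.
case e: [seq u <- S | c \in lines u] => [|u [|u' l]] // _.
have mS x : x \in [:: u, u' & l] -> [/\ x \in S, (x < 45)%N & c \in lines x].
  by rewrite -e mem_filter => /andP [cx xS]; split=> //; apply: (allP S45).
have [uS1 u45 cu] := mS u (mem_head _ _).
have [u'S u'45 cu'] : [/\ u' \in S, (u' < 45)%N & c \in lines u'].
  by apply: mS; rewrite !inE eqxx orbT.
have uu' : u != u'.
  by have := filter_uniq (fun u => c \in lines u) uS; rewrite e /= inE negb_or => /andP [/andP []].
apply: (pencil_vanish hc (lines_lt t45 ct) _ _ _ uu' (h0 _ uS1) (h0 _ u'S));
  by rewrite mem_through ?u45 ?cu ?u'45 ?cu' ?t45 ?ct.
Qed.

Section Coordinates.
Variables (d : nat -> K) (w : nat -> 'cV[K]_4) (a b c e : nat).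
Hypothesis hc : config d w.
Hypothesis hS : spans [:: a; b; c; e].

Let frame : 'M[K]_4 := \matrix_(i, j) w (nth 0%N [:: a; b; c; e] j) i 0.

Lemma frameE v j : (v *m frame) 0 j = form (w (nth 0%N [:: a; b; c; e] j)) v.
Proof. by rewrite /form !mxE; apply: eq_bigr => i _; rewrite mxE. Qed.

Lemma frame_unit : frame \in unitmx.
Proof.
rewrite -row_free_unit -kermx_eq0; apply/eqP/row_matrixP => i; rewrite row0.
apply: (spans_vanish hc hS) => t /(nthP 0%N) [j jlt <-].
rewrite -(frameE _ (Ordinal (jlt : (j < 4)%N))) -row_mul mulmx_ker row0 mxE //.
Qed.

Lemma point_with_coordinates x y z u : exists v,
  [/\ form (w a) v = x, form (w b) v = y, form (w c) v = z & form (w e) v = u].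
Proof.
pose r : 'rV[K]_4 := \row_j nth 0 [:: x; y; z; u] j.
exists (r *m invmx frame).
have E (j : 'I_4) : form (w (nth 0%N [:: a; b; c; e] j)) (r *m invmx frame) = r 0 j.
  by rewrite -frameE -mulmxA mulVmx ?frame_unit // mulmx1.
have := E (Ordinal (isT : (0 < 4)%N)); have := E (Ordinal (isT : (1 < 4)%N)).
have := E (Ordinal (isT : (2 < 4)%N)); have := E (Ordinal (isT : (3 < 4)%N)).
by rewrite /r !mxE.
Qed.

Lemma form_coordinates f : exists x y z u, forall v,
  form f v = x * form (w a) v + y * form (w b) v + z * form (w c) v + u * form (w e) v.
Proof.
pose r := invmx frame *m f.
have E v : form f v = \sum_(j < 4) form (w (nth 0%N [:: a; b; c; e] j)) v * r j 0.
  transitivity ((v *m frame *m r) 0 0).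
    by rewrite /r mulmxA -(mulmxA v) mulmxV ?frame_unit // mulmx1.
  by rewrite mxE; apply: eq_bigr => j _; rewrite frameE.
do 4!eexists; move=> v; rewrite E !big_ord_recl big_ord0 /= addr0.
rewrite mulrC [form _ _ * r (lift _ _) _]mulrC [form _ _ * r (lift _ (lift _ _)) _]mulrC.
rewrite [form _ _ * r _ _]mulrC !addrA; reflexivity.
Qed.
End Coordinates.
End Geometry.

(** * Linear algebra in four dimensions *)

Section FourSpace.
Variable K : fieldType.
Hypothesis K2 : 2%:R != 0 :> K.
Implicit Types (f g : 'cV[K]_4) (a b v : 'rV[K]_4).

Definition indep a b : Prop := forall x y, x *: a + y *: b = 0 -> x = 0 /\ y = 0.

Lemma form_delta f i : form f (delta_mx 0 i) = f i 0.
Proof. by rewrite /form -rowE mxE. Qed.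

Lemma form_eq f g : (forall v, form f v = form g v) -> f = g.
Proof. by move=> e; apply/colP => i; rewrite -!form_delta. Qed.

Lemma form_scale f k v : form (k *: f) v = k * form f v.
Proof. by rewrite /form -scalemxAr mxE. Qed.

Lemma comb_indep_neq0 a b : indep a b -> a != 0.
Proof.
move=> h; apply/eqP => a0; have := h 1 0; rewrite a0 scaler0 scale0r addr0.
by move=> /(_ erefl) [/eqP]; rewrite oner_eq0.
Qed.

Lemma indep_sym a b : indep a b -> indep b a.
Proof. by move=> h x y; rewrite addrC => /h []. Qed.

Lemma two_forms f g : exists a b, [/\ indep a b, form f a = 0, form f b = 0,
  form g a = 0 & form g b = 0].
Proof.
pose A := row_mx f g; pose B := row_base (kermx A).
have rB : (1 < \rank (kermx A))%N.
  by rewrite mxrank_ker; have : (\rank A <= 2)%N := rank_leq_col A; clear -A; lia.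
have BA (u : 'rV_(\rank (kermx A))) : u *m B *m A = 0.
  by rewrite -mulmxA; have /sub_kermxP -> : (B <= kermx A)%MS; rewrite ?mulmx0 // eq_row_base.
have hz u : form f (u *m B) = 0 /\ form g (u *m B) = 0.
  have := BA u; rewrite /A mul_mx_row => /eqP; rewrite row_mx_eq0 => /andP [/eqP h1 /eqP h2].
  by rewrite /form h1 h2 !mxE.
have Bf : row_free B by exact: row_base_free.
pose i := Ordinal (ltnW rB); pose j := Ordinal rB.
exists (delta_mx 0 i *m B), (delta_mx 0 j *m B).
have [h1 h2] := hz (delta_mx 0 i); have [h3 h4] := hz (delta_mx 0 j).
split=> // x y; rewrite !scalemxAl -mulmxDl => /eqP.
rewrite (mulmx_free_eq0 _ Bf) => /eqP /rowP e; have := e i; have := e j.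
by rewrite !mxE !eqxx /= !mulr1 !mulr0 ?addr0 ?add0r => -> ->.
Qed.

Lemma form_through a b c : exists2 f, f != 0 &
  [/\ form f a = 0, form f b = 0 & form f c = 0].
Proof.
pose A := row_mx (row_mx a^T b^T) c^T.
have : kermx A != 0.
  rewrite -mxrank_eq0 mxrank_ker subn_eq0 -ltnNge.
  exact: leq_ltn_trans (rank_leq_col A) _.
move=> /rowV0Pn [r rK r0]; exists r^T.
  by rewrite -(inj_eq (@trmx_inj _ _ _)) trmxK trmx0.
have := sub_kermxP rK; rewrite /A !mul_mx_row => /eqP.
rewrite !row_mx_eq0 => /andP [/andP [/eqP h1 /eqP h2] /eqP h3].
have E v : form r^T v = (r *m v^T) 0 0.
  by rewrite /form -[r in RHS]trmxK -trmx_mul [RHS]mxE.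
by rewrite !E h1 h2 h3 !mxE.
Qed.

(** Of the four points a, b, a + b and a - b of the line, two lie in the same
    subspace, and any two of them span the line. *)
Lemma line_in_union (Q : nat -> pred 'rV[K]_4) j1 j2 j3 a b :
  (forall j u v x y, Q j u -> Q j v -> Q j (x *: u + y *: v)) ->
  (forall x y, has (fun j => Q j (x *: a + y *: b)) [:: j1; j2; j3]) ->
  has (fun j => Q j a && Q j b) [:: j1; j2; j3].
Proof.
move=> hQ h.
have b1 j : Q j a -> Q j (a + b) -> Q j a && Q j b.
  move=> ha hs; rewrite ha; have := hQ j _ _ (-1) 1 ha hs.
  by rewrite scaleN1r scale1r addKr.
have b2 j : Q j a -> Q j (a - b) -> Q j a && Q j b.
  move=> ha hs; rewrite ha; have := hQ j _ _ 1 (-1) ha hs.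
  by rewrite scaleN1r scale1r opprB addrC subrK.
have a1 j : Q j b -> Q j (a + b) -> Q j a && Q j b.
  move=> hb hs; rewrite hb andbT; have := hQ j _ _ (-1) 1 hb hs.
  by rewrite scaleN1r scale1r addrC addrK.
have a2 j : Q j b -> Q j (a - b) -> Q j a && Q j b.
  move=> hb hs; rewrite hb andbT; have := hQ j _ _ 1 1 hb hs.
  by rewrite !scale1r addrC subrK.
have ab j : Q j (a + b) -> Q j (a - b) -> Q j a && Q j b.
  move=> hs hd.
  have e1 : 2%:R^-1 *: (a + b) + 2%:R^-1 *: (a - b) = a.
    rewrite -scalerDr addrACA subrr addr0 -mulr2n -scaler_nat scalerA mulVf ?scale1r //.
  have e2 : 2%:R^-1 *: (a + b) + (- 2%:R^-1) *: (a - b) = b.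
    rewrite scaleNr -scalerBr opprB [b - a]addrC addrACA subrr add0r.
    by rewrite -mulr2n -scaler_nat scalerA mulVf ?scale1r.
  by apply/andP; split; [rewrite -e1 | rewrite -e2]; apply: hQ.
have := h 1 0; have := h 0 1; have := h 1 1; have := h 1 (-1).
rewrite !scale1r !scale0r scaleN1r addr0 add0r.
move=> /hasP [j4 m4 q4] /hasP [j3' m3 q3] /hasP [j2' m2 q2] /hasP [j1' m1 q1].
have : ~~ uniq [:: j1'; j2'; j3'; j4].
  apply/negP => U; have := uniq_leq_size U (s2 := [:: j1; j2; j3]).
  have sub : {subset [:: j1'; j2'; j3'; j4] <= [:: j1; j2; j3]}.
    by move=> x; rewrite 4!inE => /or4P [] /eqP ->.
  by move=> /(_ sub).
move=> U; apply/hasP; move: U.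
rewrite /= !inE !negb_and !negbK orbF => /orP [/or3P [] /eqP e|/orP [/orP [] /eqP e|/eqP e]].
- by exists j1' => //; rewrite q1 e q2.
- by exists j1' => //; apply: b1 => //; rewrite e.
- by exists j1' => //; apply: b2 => //; rewrite e.
- by exists j2' => //; apply: a1 => //; rewrite e.
- by exists j2' => //; apply: a2 => //; rewrite e.
- by exists j3' => //; apply: ab => //; rewrite e.
Qed.

(** A cubic curve made up of the line s = 0 and a conic. The conclusion says that
    the determinant of the conic, here multiplied by 4, is zero: the conic
    contains a second line, so its quadratic form vanishes on a plane of the
    three-dimensional space and is degenerate. *)
Lemma conic_with_line (B C F G H s p q s' p' q' : K) : s != 0 ->
  (forall x y, (x * s + y * s') *
     (B * (x * p + y * p') ^+ 2 + C * (x * q + y * q') ^+ 2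
      + F * (x * p + y * p') * (x * q + y * q')
      + G * (x * s + y * s') * (x * q + y * q')
      + H * (x * s + y * s') * (x * p + y * p')) = 0) ->
  (s * p' - s' * p != 0) || (s * q' - s' * q != 0) ->
  F * G * H - B * G ^+ 2 - C * H ^+ 2 = 0.
Proof.
move=> s0 hR; set u := s * p' - s' * p; set t := s * q' - s' * q => hut.
(* A second point of the line, on which s vanishes. *)
pose R1 := B * p ^+ 2 + C * q ^+ 2 + F * p * q + G * s * q + H * s * p.
pose R2 := B * u ^+ 2 + C * t ^+ 2 + F * u * t.
pose R12 := 2%:R * B * p * u + 2%:R * C * q * t + F * (p * t + q * u) + G * s * t + H * s * u.
have E y : R1 + y * R12 + y ^+ 2 * R2 = 0.
  apply: (mulfI s0); rewrite mulr0 -[RHS](hR (1 - y * s') (y * s)).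
  by rewrite /R1 /R2 /R12 /u /t; ring.
have r1 : R1 = 0 by rewrite -[RHS](E 0); ring.
have e1 : R12 + R2 = 0 by rewrite -[RHS](E 1) r1; ring.
have e2 : R2 - R12 = 0 by rewrite -[RHS](E (-1)) r1; ring.
have r2 : R2 = 0.
  by apply: (mulfI K2); rewrite mulr0 -[RHS]addr0 -{2}e1 -e2; ring.
have r12 : R12 = 0 by rewrite -[RHS]e1 r2 addr0.
set D := _ - _; have D2 k : k != 0 -> 2%:R * D * (s * k) ^+ 2 = 0 -> D = 0.
  move=> k0 /eqP; rewrite mulf_eq0 expf_eq0 !mulf_eq0 (negbTE K2) (negbTE s0) (negbTE k0) !orbF.
  by move/eqP.
case/orP: hut => n0; apply: (D2 _ n0).
  transitivity (2%:R * R1 * (4%:R * R2 * C - (2%:R * C * t + F * u) ^+ 2)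
    - R12 * (R12 * 2%:R * C - (2%:R * C * t + F * u) * (2%:R * C * q + F * p + G * s))
    + (2%:R * C * q + F * p + G * s) * (R12 * (2%:R * C * t + F * u)
       - 2%:R * R2 * (2%:R * C * q + F * p + G * s))).
    by rewrite /D /R1 /R2 /R12; ring.
  by rewrite r1 r2 r12; ring.
transitivity (2%:R * R1 * (4%:R * R2 * B - (2%:R * B * u + F * t) ^+ 2)
  - R12 * (R12 * 2%:R * B - (2%:R * B * u + F * t) * (2%:R * B * p + F * q + H * s))
  + (2%:R * B * p + F * q + H * s) * (R12 * (2%:R * B * u + F * t)
     - 2%:R * R2 * (2%:R * B * p + F * q + H * s))).
  by rewrite /D /R1 /R2 /R12; ring.
by rewrite r1 r2 r12; ring.
Qed.

Lemma four_roots (k0 k1 k2 k3 : K) (rs : seq K) : size rs = 4%N -> uniq rs ->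
  {in rs, forall r, k3 * r ^+ 3 + k2 * r ^+ 2 + k1 * r + k0 = 0} -> k3 = 0.
Proof.
move=> s4 U h; pose p := Poly [:: k0; k1; k2; k3].
have : p = 0.
  apply/eqP/negPn/negP => p0; have := max_poly_roots p0 _ U; rewrite s4.
  have hs : (size p <= 4)%N by apply: leq_trans (size_Poly _) _.
  move=> /(_ _) H; have {H} : (4 < size p)%N; last by rewrite ltnNge hs.
  apply: H; apply/allP => r rr; rewrite rootE /p horner_Poly /=.
  by rewrite -[X in _ == X](h r rr); apply/eqP; ring.
by move=> /(congr1 (fun q : {poly K} => q`_3)); rewrite /p coef_Poly coef0.
Qed.
End FourSpace.

(** * The pencil of planes through a line of the surface *)

Section Pencils.
Variable K : fieldType.
Hypothesis K3 : 3%:R != 0 :> K.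
Implicit Types (d : nat -> K) (w : nat -> 'cV[K]_4) (v a b : 'rV[K]_4) (f : 'cV[K]_4).

(** Coordinates adapted to two skew lines: the first two forms vanish on G_1 and
    the last two on E_1. *)
Lemma spans_base : spans [:: xc 1 0; xc 2 0; xc 0 1; xc 0 2].
Proof. by rewrite xcE; vm_compute. Qed.

Lemma coordinates_inj d w S v v' : config d w -> spans S ->
  {in S, forall t, form (w t) v = form (w t) v'} -> v = v'.
Proof.
move=> hc hS h; apply/eqP; rewrite -subr_eq0; apply/eqP.
apply: (spans_vanish K3 hc hS) => t /h e.
by rewrite -[v']scale1r -scaleNr formD formZ e mulN1r subrr.
Qed.

Definition line_basis w c a b : Prop :=
  [/\ indep a b, on_line w c a, on_line w c b
    & forall v, on_line w c v -> exists x y, v = x *: a + y *: b].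

Lemma mem_line6 : (xc 1 0 \in through 6) && (xc 2 0 \in through 6).
Proof. by rewrite xcE; vm_compute. Qed.

Lemma on_line6 d w v : config d w ->
  form (w (xc 1 0)) v = 0 -> form (w (xc 2 0)) v = 0 -> on_line w 6 v.
Proof.
have /andP [m1 m2] := mem_line6.
by move=> hc; apply: (on_line2 K3 hc _ m1 m2) => //; rewrite xcE; vm_compute.
Qed.

Lemma line6_on w v : on_line w 6 v ->
  form (w (xc 1 0)) v = 0 /\ form (w (xc 2 0)) v = 0.
Proof.
have /andP [] := mem_line6; rewrite !mem_through => /andP [p1 m1] /andP [p2 m2].
by move=> /on_lineP h; split; apply: h.
Qed.

Lemma line_has_basis c : (c < 27)%N -> forall d w, config d w ->
  exists a b, line_basis w c a b.
Proof.
move: c; apply: label_ind => [d w hc|g c c27 IH d w hc].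
  have [a [a1 a2 a3 a4]] := point_with_coordinates K3 hc spans_base 0 0 1 0.
  have [b [b1 b2 b3 b4]] := point_with_coordinates K3 hc spans_base 0 0 0 1.
  exists a, b; split.
  - move=> x y e; split.
      by have := form0 (w (xc 0 1)); rewrite -e formD !formZ a3 b3 mulr1 mulr0 addr0.
    by have := form0 (w (xc 0 2)); rewrite -e formD !formZ a4 b4 mulr1 mulr0 add0r.
  - exact: (on_line6 hc a1 a2).
  - exact: (on_line6 hc b1 b2).
  - move=> v /line6_on [v1 v2]; exists (form (w (xc 0 1)) v), (form (w (xc 0 2)) v).
    apply: (coordinates_inj hc spans_base) => t; rewrite !inE => /or4P [] /eqP ->;
      rewrite formD !formZ ?a1 ?a2 ?a3 ?a4 ?b1 ?b2 ?b3 ?b4 ?v1 ?v2; ring.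
have [a [b [h1 h2 h3 h4]]] := IH _ _ (config_refl K3 g hc).
exists a, b; split=> //; first by rewrite -on_line_refl.
  by rewrite -on_line_refl.
by move=> v; rewrite -on_line_refl //; apply: h4.
Qed.

Lemma line_span c d w a b v : (c < 27)%N -> config d w -> indep a b ->
  on_line w c a -> on_line w c b -> on_line w c v -> exists x y, v = x *: a + y *: b.
Proof.
move=> c27 hc hab ha hb hv; have [e [f [_ _ _ hs]]] := line_has_basis c27 hc.
have [x1 [y1 ea]] := hs _ ha; have [x2 [y2 eb]] := hs _ hb; have [x [y ev]] := hs _ hv.
pose D := x1 * y2 - x2 * y1.
have comb p q : p *: a + q *: b = (p * x1 + q * x2) *: e + (p * y1 + q * y2) *: f.
  by rewrite ea eb !scalerDr !scalerA addrACA -!scalerDl.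
have D0 : D != 0.
  apply/eqP => D0; have := hab y2 (- y1); rewrite comb.
  have -> : y2 * x1 + - y1 * x2 = 0 by rewrite -[RHS]D0 /D; ring.
  have -> : y2 * y1 + - y1 * y2 = 0 by ring.
  rewrite !scale0r addr0 => /(_ erefl) [y20 /eqP]; rewrite oppr_eq0 => /eqP y10.
  have := hab (- x2) x1; rewrite comb.
  have -> : - x2 * x1 + x1 * x2 = 0 by ring.
  have -> : - x2 * y1 + x1 * y2 = 0 by rewrite y10 y20; ring.
  rewrite !scale0r addr0 => /(_ erefl) [_ x10].
  have := comb_indep_neq0 hab; rewrite ea x10 y10 !scale0r addr0 eqxx //.
exists ((x * y2 - y * x2) / D), ((x1 * y - y1 * x) / D); rewrite comb ev.
by congr (_ *: _ + _ *: _); rewrite /D; field.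
Qed.

Lemma line_extend c d w a : (c < 27)%N -> config d w -> on_line w c a -> a != 0 ->
  exists2 b, on_line w c b & indep a b.
Proof.
move=> c27 hc ha a0; have [e [f [hi he hf hs]]] := line_has_basis c27 hc.
have [x [y ea]] := hs _ ha.
have [x0|x0] := eqVneq x 0.
  have y0 : y != 0 by apply: contraNneq a0 => y0; rewrite ea x0 y0 !scale0r addr0.
  exists e => // p q; rewrite ea x0 scale0r add0r scalerA addrC => /hi [-> /eqP].
  by rewrite mulf_eq0 (negbTE y0) orbF => /eqP.
exists f => // p q; rewrite ea scalerDr !scalerA -addrA -scalerDl => /hi [/eqP].
rewrite mulf_eq0 (negbTE x0) orbF => /eqP ->; rewrite mul0r add0r; by [].
Qed.

(** For G_1 the planes in question form one orbit of the subgroup generated by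
    the reflections 1 to 5, all of which fix G_1. *)
Lemma line_off_plane c : (c < 27)%N -> forall u, (u < 45)%N -> c \notin lines u ->
  forall d w, config d w -> exists2 v, on_line w c v & form (w u) v != 0.
Proof.
move: c; apply: label_ind => [u u45 cu|g c c27 IH u u45 cu d w hc]; last first.
  have := IH (tri_refl g u) (tri_refl_lt g u45).
  rewrite -(mem_lines_refl g) ?tri_refl_lt // tri_reflK // => /(_ cu _ _ (config_refl K3 g hc)).
  by move=> [v]; rewrite on_line_refl //= tri_reflK // => hv nv; exists v.
have : u \in closure [seq tri_refl g | g <- [:: 1; 2; 3; 4; 5]%N] 30
    [:: xcode 0 1] [:: xcode 0 1].
  have /all_ltP h : all (fun u => (6%N \notin lines u) ==> (u \in
    closure [seq tri_refl g | g <- [:: 1; 2; 3; 4; 5]%N] 30 [:: xcode 0 1] [:: xcode 0 1]))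
    (iota 0 45) by vm_compute.
  exact: (implyP (h u u45)).
move: u {u45 cu}; apply: closure_ind.
  move=> d w hc.
  have [v [v1 v2 v3 v4]] := point_with_coordinates K3 hc spans_base 0 0 1 0.
  by exists v; [exact: (on_line6 hc) | rewrite -xcE v3 oner_eq0].
move=> u Pu z; rewrite -map_comp => /mapP [g hg ->] d w hc.
have [v] := Pu _ _ (config_refl K3 g hc).
rewrite (on_line_refl g w v (isT : (6 < 27)%N)).
have -> : label_table g 6 = 6%N.
  by move: hg; rewrite !inE => /or4P [/eqP ->|/eqP ->|/eqP ->|/orP [] /eqP ->].
by move=> hv nv; exists v.
Qed.

(** On the base plane one of the two products of the cubic is zero, and each
    factor of the other is a second plane through one of its three lines. *)
Lemma plane_section t : (t < 45)%N -> forall d w v, config d w ->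
  form (w t) v = 0 -> (cubic w v = 0) <-> has (fun c => on_line w c v) (lines t).
Proof.
move: t; apply: tri_ind => [d w v hc h|g t t45 IH d w v hc h].
  have l01 : lines (xcode 0 1) = [:: 0; 7; 12]%N by vm_compute.
  have ol c t t' : (c < 27)%N -> t \in through c -> t' \in through c -> t != t' ->
      form (w t) v = 0 -> form (w t') v = 0 -> on_line w c v.
    by move=> *; apply: (on_line2 K3 hc (t := t) (t' := t')).
  have lo c t : t \in through c -> on_line w c v -> form (w t) v = 0.
    by rewrite mem_through => /andP [t45 ct] /on_lineP; apply.
  rewrite -xcE in h l01 *; rewrite l01 /cubic h !mul0r sub0r.
  have thr : [&& xc 0 1 \in through 0, xc 0 2 \in through 0, xc 0 1 \in through 7,
      xc 2 1 \in through 7, xc 0 1 \in through 12 & xc 1 0 \in through 12].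
    by rewrite xcE; vm_compute.
  have ne : [&& xc 0 1 != xc 0 2, xc 0 1 != xc 2 1 & xc 0 1 != xc 1 0].
    by rewrite xcE; vm_compute.
  case/and5P: thr => m1 m2 m3 m4 /andP [m5 m6]; case/and3P: ne => n1 n2 n3.
  split.
    move/eqP; rewrite oppr_eq0 !mulf_eq0 => /orP [/orP [] /eqP z|/eqP z]; apply/hasP.
    - by exists 0%N => //; apply: (ol 0%N _ _ isT m1 m2 n1 h z).
    - by exists 7%N => //; apply: (ol 7%N _ _ isT m3 m4 n2 h z).
    - by exists 12%N => //; apply: (ol 12%N _ _ isT m5 m6 n3 h z).
  case/hasP => c; rewrite !inE => /or3P [] /eqP -> hl.
  - by rewrite (lo 0%N _ m2 hl) !mul0r oppr0.
  - by rewrite (lo 7%N _ m4 hl) mulr0 mul0r oppr0.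
  - by rewrite (lo 12%N _ m6 hl) mulr0 oppr0.
have [k k0 ek] := cubic_refl K3 g hc.
have e : (cubic w v = 0) <-> (cubic (w \o tri_refl g) v = 0).
  rewrite ek; split=> [->|/eqP]; first by rewrite mulr0.
  by rewrite mulf_eq0 (negbTE k0) => /eqP.
apply: (iff_trans e); apply: (iff_trans (IH _ _ v (config_refl K3 g hc) h)).
have /andP [_ pe] := tri_reflP g t45.
rewrite -(eq_has_r (perm_mem pe)) has_map.
have -> : has (fun c => on_line (w \o tri_refl g) c v) (lines t) =
    has (preim (label_table g) (fun c => on_line w c v)) (lines t).
  apply: eq_in_has => c ct; exact: (on_line_refl g w v (lines_lt t45 ct)).
exact: iff_refl.
Qed.

Lemma cubic_on_line c d w v : (c < 27)%N -> config d w -> on_line w c v -> cubic w v = 0.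
Proof.
move=> c27 hc hv.
have /all_ltP h : all (fun c => has (fun t => c \in lines t) (iota 0 45)) (iota 0 27)
  by vm_compute.
have /hasP [t] := h c c27; rewrite mem_iota add0n => /andP [_ t45] ct.
by rewrite (plane_section t45 hc) ?(on_lineP _ _ _ hv) //; apply/hasP; exists c.
Qed.
End Pencils.

(** * Planes through a line that contain a further line *)

Section KeyLemma.
Variable K : fieldType.
Hypothesis K2 : 2%:R != 0 :> K.
Hypothesis K3 : 3%:R != 0 :> K.
Implicit Types (d : nat -> K) (w : nat -> 'cV[K]_4) (v a b : 'rV[K]_4) (f : 'cV[K]_4).

Definition contains_line w f a b : Prop :=
  indep a b /\ forall x y, form f (x *: a + y *: b) = 0 /\ cubic w (x *: a + y *: b) = 0.

Section BasePencil.
Variables (d : nat -> K) (w : nat -> 'cV[K]_4).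
Hypothesis hc : config d w.

Let X := form (w (xc 1 0)).
Let Y := form (w (xc 2 0)).
Let P := form (w (xc 0 1)).
Let Q := form (w (xc 0 2)).

Variables (a1 b1 c1 e1 a2 b2 c2 e2 : K).
Hypothesis E12 : forall v, form (w (xc 1 2)) v = a1 * X v + b1 * Y v + c1 * P v + e1 * Q v.
Hypothesis E21 : forall v, form (w (xc 2 1)) v = a2 * X v + b2 * Y v + c2 * P v + e2 * Q v.

(* The discriminant of the conic residual to the line G_1 in the plane
   al * Y + be * X = 0 is al * be times the binary cubic [disc]; the factors
   al and be belong to the tritangent planes X = 0 and Y = 0. *)
Let mu al be := b1 * be - a1 * al.
Let nu al be := b2 * be - a2 * al.
Let disc al be := (be * e1 + al * c2) * mu al be * nu al be
  - al * c1 * nu al be ^+ 2 - be * e2 * mu al be ^+ 2.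

(** In the plane al * Y + be * X = 0 the point has coordinates P, Q and s, with
    X = - al * s and Y = be * s, and the line G_1 is s = 0. *)
Lemma plane_with_line al be a b : al != 0 -> be != 0 -> indep a b ->
  (forall x y, al * Y (x *: a + y *: b) + be * X (x *: a + y *: b) = 0
     /\ cubic w (x *: a + y *: b) = 0) ->
  ~~ on_line w 6 a -> disc al be = 0.
Proof.
move=> al0 be0 hab h na.
have XE x y : X (x *: a + y *: b) = x * X a + y * X b by rewrite /X formD !formZ.
have YE x y : Y (x *: a + y *: b) = x * Y a + y * Y b by rewrite /Y formD !formZ.
have PE x y : P (x *: a + y *: b) = x * P a + y * P b by rewrite /P formD !formZ.
have QE x y : Q (x *: a + y *: b) = x * Q a + y * Q b by rewrite /Q formD !formZ.
pose s := Y a / be; pose s' := Y b / be.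
have [ya yb] : Y a = be * s /\ Y b = be * s' by rewrite /s /s'; split; field.
have [pa _] := h 1 0; have [pb _] := h 0 1.
have [xa xb] : X a = - al * s /\ X b = - al * s'.
  move: pa pb; rewrite !XE !YE !mul1r !mul0r !addr0 !add0r ya yb => pa pb.
  by split; apply: (mulfI be0); [rewrite -[LHS]subr0 -pa | rewrite -[LHS]subr0 -pb]; ring.
have s0 : s != 0.
  apply: contraNneq na => s0; apply: (on_line6 K3 hc); rewrite -/(X a) -/(Y a).
    by rewrite xa s0 mulr0.
  by rewrite ya s0 mulr0.
have D0 : (be * e1 + al * c2) * (al * nu al be) * (be * mu al be)
   - (be * c1) * (al * nu al be) ^+ 2 - (al * e2) * (be * mu al be) ^+ 2 = 0.
  apply: (conic_with_line K2 (s := s) (s' := s') (p := P a) (p' := P b)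
            (q := Q a) (q' := Q b)) => //.
    move=> x y; have [_] := h x y; rewrite /cubic E12 E21 -/(X _) -/(Y _) -/(P _) -/(Q _).
    rewrite XE YE PE QE xa xb ya yb => hz; rewrite -[RHS]hz /mu /nu; ring.
  rewrite -negb_and; apply/negP => /andP [/eqP zp /eqP zq].
  have : (- s') *: a + s *: b = 0.
    apply: (coordinates_inj K3 hc spans_base) => t; rewrite form0 !inE => /or4P [] /eqP ->.
    - by rewrite -/(X _) XE xa xb; ring.
    - by rewrite -/(Y _) YE ya yb; ring.
    - by rewrite -/(P _) PE -[RHS]zp; ring.
    - by rewrite -/(Q _) QE -[RHS]zq; ring.
  by move=> /hab [_ /eqP]; rewrite (negbTE s0).
apply: (mulfI (mulf_neq0 al0 be0)); rewrite mulr0 -[RHS]D0 /disc; ring.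
Qed.

Lemma form_through_line6 f : (forall v, on_line w 6 v -> form f v = 0) ->
  exists al be, forall v, form f v = al * Y v + be * X v.
Proof.
move=> hf; have [x [y [z [u E]]]] := form_coordinates K3 hc spans_base f.
have [p [p1 p2 p3 p4]] := point_with_coordinates K3 hc spans_base 0 0 1 0.
have [q [q1 q2 q3 q4]] := point_with_coordinates K3 hc spans_base 0 0 0 1.
have z0 : z = 0.
  have := hf p (on_line6 K3 hc p1 p2); rewrite E p1 p2 p3 p4 => <-; ring.
have u0 : u = 0.
  have := hf q (on_line6 K3 hc q1 q2); rewrite E q1 q2 q3 q4 => <-; ring.
by exists y, x => v; rewrite E z0 u0 /X /Y; ring.
Qed.

(** Besides G_1 the plane contains the line with code j, so the discriminant
    vanishes there. *)
Lemma tritangent_root j : j \in [:: 3; 4; 5]%N -> exists al be,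
  [/\ al != 0, be != 0, disc al be = 0
    & forall v, form (w (xc j 0)) v = al * Y v + be * X v].
Proof.
move=> hj; have vm : [&& xc j 0 \in through 6, xc j 0 \in through j, (j < 27)%N,
    j \notin lines (xc 1 0), spans [:: xc 1 0; xc j 0; xc 0 1; xc 0 2] &
    spans [:: xc 2 0; xc j 0; xc 0 1; xc 0 2]].
  have /allP h : all (fun j => [&& xcode j 0 \in through 6, xcode j 0 \in through j, (j < 27)%N,
    j \notin lines (xcode 1 0), spans [:: xcode 1 0; xcode j 0; xcode 0 1; xcode 0 2] &
    spans [:: xcode 2 0; xcode j 0; xcode 0 1; xcode 0 2]]) [:: 3; 4; 5]%N by vm_compute.
  by rewrite xcE; apply: h.
case/and5P: vm => m6 mj j27 nj /andP [sX sY].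
have m1 : (xc 1 0 < 45)%N by rewrite xcE; vm_compute.
move: mj; rewrite mem_through => /andP [t45 jt].
have [al [be E]] : exists al be, forall v, form (w (xc j 0)) v = al * Y v + be * X v.
  apply: form_through_line6 => v /on_lineP h; apply: h => //.
  by move: m6; rewrite mem_through => /andP [].
have al0 : al != 0.
  apply/eqP => al0; have [v [v1 v2 v3 v4]] := point_with_coordinates K3 hc spans_base 0 1 0 0.
  have v0 : v = 0.
    apply: (spans_vanish K3 hc sX) => t; rewrite !inE => /or4P [] /eqP -> //.
    by rewrite E al0 /X v1 mul0r mulr0 addr0.
  by move: v2; rewrite v0 form0 => /eqP; rewrite eq_sym oner_eq0.
have be0 : be != 0.
  apply/eqP => be0; have [v [v1 v2 v3 v4]] := point_with_coordinates K3 hc spans_base 1 0 0 0.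
  have v0 : v = 0.
    apply: (spans_vanish K3 hc sY) => t; rewrite !inE => /or4P [] /eqP -> //.
    by rewrite E be0 /Y v2 mul0r mulr0 addr0.
  by move: v1; rewrite v0 form0 => /eqP; rewrite eq_sym oner_eq0.
exists al, be; split=> //.
have [a ha Xa] := line_off_plane K3 j27 m1 nj hc.
have a0 : a != 0 by apply: contraNneq Xa => ->; rewrite form0.
have [b hb hab] := line_extend K3 j27 hc ha a0.
apply: (plane_with_line al0 be0 hab).
  move=> x y; have hl := on_line_comb x y ha hb; rewrite -E; split.
    exact: (on_lineP _ _ _ hl).
  exact: (cubic_on_line K3 j27 hc hl).
by apply: contra Xa => /line6_on [-> _].
Qed.

(** The binary cubic does not vanish identically: its value at al = 0 is nonzero
    because X, P, Q, x_23 are independent, and so are X, P, x_23, x_32. *)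
Lemma disc_lead : e1 * b1 * b2 - e2 * b1 ^+ 2 != 0.
Proof.
have sp1 : spans [:: xc 1 0; xc 0 1; xc 0 2; xc 1 2] by rewrite xcE; vm_compute.
have sp2 : spans [:: xc 1 0; xc 0 1; xc 1 2; xc 2 1] by rewrite xcE; vm_compute.
have b10 : b1 != 0.
  apply/eqP => b10; have [v [v1 v2 v3 v4]] := point_with_coordinates K3 hc spans_base 0 1 0 0.
  have v0 : v = 0.
    apply: (spans_vanish K3 hc sp1) => t; rewrite !inE => /or4P [] /eqP -> //.
    by rewrite E12 b10 /X /Y /P /Q v1 v3 v4; ring.
  by move: v2; rewrite v0 form0 => /eqP; rewrite eq_sym oner_eq0.
have -> : e1 * b1 * b2 - e2 * b1 ^+ 2 = b1 * (e1 * b2 - e2 * b1) by ring.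
rewrite mulf_neq0 //; apply/eqP => z.
have [v [v1 v2 v3 v4]] := point_with_coordinates K3 hc spans_base 0 e1 0 (- b1).
have v0 : v = 0.
  apply: (spans_vanish K3 hc sp2) => t; rewrite !inE => /or4P [] /eqP -> //.
    by rewrite E12 /X /Y /P /Q v1 v2 v3 v4; ring.
  by rewrite E21 /X /Y /P /Q v1 v2 v3 v4 -[RHS]z; ring.
by move: v4; rewrite v0 form0 => /eqP; rewrite eq_sym oppr_eq0 (negbTE b10).
Qed.

(** A nonzero binary cubic has no more than the three roots already known. *)
Lemma disc_root al be : al != 0 -> be != 0 -> disc al be = 0 ->
  exists t k, [/\ t \in through 6, k != 0
    & forall v, al * Y v + be * X v = k * form (w t) v].
Proof.
move=> al0 be0 D0.
have [al3 [be3 [a30 b30 D3 E3]]] := tritangent_root (isT : 3%N \in [:: 3; 4; 5]%N).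
have [al4 [be4 [a40 b40 D4 E4]]] := tritangent_root (isT : 4%N \in [:: 3; 4; 5]%N).
have [al5 [be5 [a50 b50 D5 E5]]] := tritangent_root (isT : 5%N \in [:: 3; 4; 5]%N).
have vm : [&& xc 3 0 \in through 6, xc 4 0 \in through 6, xc 5 0 \in through 6,
    spans [:: xc 3 0; xc 4 0; xc 0 1; xc 0 2], spans [:: xc 3 0; xc 5 0; xc 0 1; xc 0 2]
  & spans [:: xc 4 0; xc 5 0; xc 0 1; xc 0 2]] by rewrite xcE; vm_compute.
case/and5P: vm => m3 m4 m5 s34 /andP [s35 s45].
have same t al' be' : t \in through 6 -> al' != 0 ->
    (forall v, form (w t) v = al' * Y v + be' * X v) -> be / al = be' / al' ->
  exists t k, [/\ t \in through 6, k != 0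
    & forall v, al * Y v + be * X v = k * form (w t) v].
  move=> mt al'0 Et e; exists t, (al / al'); split=> //.
    by rewrite mulf_neq0 ?invr_neq0.
  have eb : be = be' / al' * al by rewrite -e divfK.
  by move=> v; rewrite Et eb; field.
have [e|n3] := eqVneq (be / al) (be3 / al3); first exact: same m3 a30 E3 e.
have [e|n4] := eqVneq (be / al) (be4 / al4); first exact: same m4 a40 E4 e.
have [e|n5] := eqVneq (be / al) (be5 / al5); first exact: same m5 a50 E5 e.
have dist t t' p q p' q' : p != 0 -> p' != 0 -> spans [:: t; t'; xc 0 1; xc 0 2] ->
    (forall v, form (w t) v = p * Y v + q * X v) ->
    (forall v, form (w t') v = p' * Y v + q' * X v) -> q / p != q' / p'.
  move=> p0 p'0 sp Et Et'; apply/eqP => e.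
  have [v [v1 v2 v3 v4]] := point_with_coordinates K3 hc spans_base 1 (- (q / p)) 0 0.
  have v0 : v = 0.
    apply: (spans_vanish K3 hc sp) => u; rewrite !inE => /or4P [] /eqP -> //.
      by rewrite Et /X /Y v1 v2; field.
    by rewrite Et' /X /Y v1 v2 e; field.
  by move: v1; rewrite v0 form0 => /eqP; rewrite eq_sym oner_eq0.
have h34 := dist _ _ _ _ _ _ a30 a40 s34 E3 E4.
have h35 := dist _ _ _ _ _ _ a30 a50 s35 E3 E5.
have h45 := dist _ _ _ _ _ _ a40 a50 s45 E4 E5.
have := disc_lead; rewrite (_ : _ - _ = 0) ?eqxx //.
pose k2 := c2 * b1 * b2 - e1 * (a1 * b2 + a2 * b1) - c1 * b2 ^+ 2 + 2%:R * e2 * a1 * b1.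
pose k1 := e1 * a1 * a2 - c2 * (a1 * b2 + a2 * b1) + 2%:R * c1 * a2 * b2 - e2 * a1 ^+ 2.
pose k0 := c2 * a1 * a2 - c1 * a2 ^+ 2.
apply: (@four_roots K k0 k1 k2 _ [:: be / al; be3 / al3; be4 / al4; be5 / al5]) => //.
  by rewrite /= !inE !negb_or n3 n4 n5 h34 h35 h45.
have root x y : x != 0 -> disc x y = 0 ->
  (e1 * b1 * b2 - e2 * b1 ^+ 2) * (y / x) ^+ 3 + k2 * (y / x) ^+ 2 + k1 * (y / x) + k0 = 0.
  move=> x0 Dxy; transitivity (disc x y / x ^+ 3); last by rewrite Dxy mul0r.
  by rewrite /disc /mu /nu /k2 /k1 /k0; field.
by move=> r; rewrite !inE => /or4P [] /eqP ->; apply: root.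
Qed.
End BasePencil.

(** The residual conic degenerates for only five planes of the pencil, namely the
    five tritangent planes through the line. *)
Lemma residual_line c : (c < 27)%N -> forall d w f a b, config d w -> f != 0 ->
  (forall v, on_line w c v -> form f v = 0) -> contains_line w f a b ->
  ~~ on_line w c a -> exists t k, [/\ t \in through c, k != 0 & f = k *: w t].
Proof.
move: c; apply: label_ind => [d w f a b hc f0 hf|g c c27 IH d w f a b hc f0 hf];
  move=> [hab h] na; last first.
  have hc' := config_refl K3 g hc; have [k k0 ek] := cubic_refl K3 g hc.
  have ol v : on_line (w \o tri_refl g) c v = on_line w (label_table g c) v.
    exact: on_line_refl.
  have [v|||t [k' [ht k'0 ->]]] := IH _ _ f a b hc' f0.
  - by rewrite ol; apply: hf.
  - by split=> // x y; have [h1 h2] := h x y; rewrite ek h2 mulr0.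
  - by rewrite ol.
  exists (tri_refl g t), k'; split; [|exact: k'0|reflexivity].
  move: ht; rewrite !mem_through => /andP [t45 ct].
  by rewrite tri_refl_lt ?mem_lines_refl.
have [al [be E]] := form_through_line6 hc hf.
have [a1 [b1 [c1 [e1 E12]]]] := form_coordinates K3 hc spans_base (w (xc 1 2)).
have [a2 [b2 [c2 [e2 E21]]]] := form_coordinates K3 hc spans_base (w (xc 2 1)).
have /andP [m1 m2] := mem_line6.
have [al0|al0] := eqVneq al 0.
  exists (xc 1 0), be; split; first exact: m1.
    apply: contraNneq f0 => be0; apply/eqP/form_eq => v; rewrite E al0 be0.
    by rewrite [form 0 v]/form mulmx0 mxE; ring.
  by apply: form_eq => v; rewrite E al0 form_scale; ring.
have [be0|be0] := eqVneq be 0.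
  exists (xc 2 0), al; split; [exact: m2 | exact: al0 |].
  by apply: form_eq => v; rewrite E be0 form_scale; ring.
have D0 := plane_with_line hc E12 E21 al0 be0 hab _ na.
have [|t [k [mt k0 Ef]]] := disc_root hc E12 E21 al0 be0 (D0 _).
  by move=> x y; rewrite -E; apply: h.
by exists t, k; split; [exact: mt | exact: k0 |]; apply: form_eq => v; rewrite E Ef form_scale.
Qed.
End KeyLemma.

(** * The lines of the surface and its Cayley-Salmon equations *)

Section Classification.
Variable K : fieldType.
Hypothesis K2 : 2%:R != 0 :> K.
Hypothesis K3 : 3%:R != 0 :> K.
Implicit Types (v a b z : 'rV[K]_4) (f : 'cV[K]_4).
Variables (d : nat -> K) (w : nat -> 'cV[K]_4).
Hypothesis hc : config d w.

Lemma size_lines t : (t < 45)%N -> exists j1 j2 j3,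
  [/\ lines t = [:: j1; j2; j3], (j1 < 27)%N, (j2 < 27)%N, (j3 < 27)%N & j1 != j2].
Proof.
have /all_ltP h : all (fun t => (size (lines t) == 3%N) && uniq (lines t)) (iota 0 45).
  by vm_compute.
move=> t45; have := h t t45; have := @lines_lt t _ t45.
case: (lines t) => [|j1 [|j2 [|j3 [|]]]] // l27 /andP [_] /=.
rewrite inE negb_or => /andP [/andP [n _] _]; exists j1, j2, j3.
by split=> //; apply: l27; rewrite !inE eqxx ?orbT.
Qed.

Lemma line_in_plane t a b : (t < 45)%N ->
  (forall x y, form (w t) (x *: a + y *: b) = 0 /\ cubic w (x *: a + y *: b) = 0) ->
  exists c, [/\ c \in lines t, on_line w c a & on_line w c b].
Proof.
move=> t45 h; have [j1 [j2 [j3 [lt _ _ _ _]]]] := size_lines t45.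
have := @line_in_union K K2 (on_line w) j1 j2 j3 a b.
move=> /(_ (fun j u v x y => @on_line_comb K w j u v x y)) H.
have {H} /hasP [c ct /andP [ha hb]] : has (fun j => on_line w j a && on_line w j b) [:: j1; j2; j3].
  apply: H => x y; rewrite -lt; have [h1 h2] := h x y.
  by apply/(plane_section K3 t45 hc h1).
by exists c; rewrite lt.
Qed.

(** The point x a + y b is where the new line meets the known line l; the plane
    through both is tritangent, so the new line is one of its three lines. *)
Lemma known_line_core l a b x y : (l < 27)%N -> indep a b ->
  (forall x y, cubic w (x *: a + y *: b) = 0) ->
  x *: a + y *: b != 0 -> on_line w l (x *: a + y *: b) -> ~~ on_line w l a ->
  exists c, [/\ (c < 27)%N, on_line w c a & on_line w c b].
Proof.
set z := x *: a + y *: b => l27 hab hX z0 zl nal.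
have [e el hze] := line_extend K3 l27 hc zl z0.
have [f f0 [fz fe fa]] := form_through z e a.
have scale_on c k u : k != 0 -> on_line w c (k *: u) -> on_line w c u.
  move=> k0 h; have := on_line_comb k^-1 0 h h.
  by rewrite scale0r addr0 scalerA mulVf // scale1r.
have haz : indep a z.
  move=> p q e0; have p0 : p = 0.
    apply/eqP/negPn/negP => p0; case/negP: nal; apply: (scale_on l p) => //.
    have -> : p *: a = (- q) *: z + 0 *: z.
      by rewrite scale0r addr0 scaleNr; apply/eqP; rewrite -addr_eq0 e0.
    exact: on_line_comb.
  move/eqP: e0; rewrite p0 scale0r add0r scaler_eq0 (negbTE z0) orbF => /eqP -> //.
have comb p q : p *: a + q *: z = (p + q * x) *: a + (q * y) *: b.
  by rewrite /z scalerDr !scalerA addrA -scalerDl.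
have [|||t [k [tl k0 ef]]] := residual_line K2 K3 l27 (f := f) (a := a) (b := z) hc f0.
- move=> v hv; have [p [q ->]] := line_span K3 l27 hc hze zl el hv.
  by rewrite formD !formZ fz fe !mulr0 addr0.
- split=> // p q; rewrite formD !formZ fa fz !mulr0 addr0; split=> //.
  by rewrite comb.
- exact: nal.
move: tl; rewrite mem_through => /andP [t45 lt].
have [p q|c [ct ha hz]] := line_in_plane (a := a) (b := z) t45.
  split; last by rewrite comb.
  apply: (mulfI k0); rewrite mulr0 -form_scale -ef.
  by rewrite formD !formZ fa fz !mulr0 addr0.
exists c; split=> //; first exact: lines_lt ct.
have y0 : y != 0.
  apply: contraNneq nal => y0; have x0 : x != 0.
    by apply: contraNneq z0 => x0; rewrite /z x0 y0 !scale0r addr0.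
  by apply: (scale_on l x _ x0); move: zl; rewrite /z y0 scale0r addr0.
apply: (scale_on c y _ y0); have -> : y *: b = 1 *: z + (- x) *: a.
  by rewrite /z scale1r scaleNr addrC addKr.
exact: on_line_comb.
Qed.

(** A line of the surface meets a fixed tritangent plane in a point of one of its
    three lines, and the plane spanned by the two lines is again tritangent. *)
Lemma known_line a b : indep a b -> (forall x y, cubic w (x *: a + y *: b) = 0) ->
  exists c, [/\ (c < 27)%N, on_line w c a & on_line w c b].
Proof.
move=> hab hX; have t45 : (xc 0 1 < 45)%N by rewrite xcE; vm_compute.
have [fa|fa] := eqVneq (form (w (xc 0 1)) a) 0.
  have /(plane_section K3 t45 hc fa) /hasP [l lt la] : cubic w a = 0.
    by have := hX 1 0; rewrite scale1r scale0r addr0.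
  have l27 := lines_lt t45 lt; have [lb|lb] := boolP (on_line w l b).
    by exists l.
  have E : 0 *: b + 1 *: a = a by rewrite scale0r scale1r add0r.
  have [||||c [c27 cb ca]] := known_line_core (x := 0) (y := 1) l27 (indep_sym hab).
  - by move=> x y; rewrite addrC.
  - by rewrite E (comb_indep_neq0 hab).
  - by rewrite E.
  - exact: lb.
  by exists c.
pose x := form (w (xc 0 1)) b; pose y := - form (w (xc 0 1)) a.
have fz : form (w (xc 0 1)) (x *: a + y *: b) = 0.
  by rewrite formD !formZ /x /y; ring.
have z0 : x *: a + y *: b != 0.
  by apply/eqP => /hab [_ /eqP]; rewrite oppr_eq0 (negbTE fa).
have /(plane_section K3 t45 hc fz) /hasP [l lt lz] := hX x y.
have l27 := lines_lt t45 lt; have [la|la] := boolP (on_line w l a).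
  exists l; split=> //; have y0 : y != 0 by rewrite oppr_eq0.
  have -> : b = (- (y^-1 * x)) *: a + y^-1 *: (x *: a + y *: b).
    by rewrite scalerDr !scalerA mulVf // scale1r scaleNr addKr.
  exact: on_line_comb.
exact: (known_line_core l27 hab hX z0 lz la).
Qed.

Lemma plane_contains_line f t : (t < 45)%N ->
  (forall v, form f v = 0 -> cubic w v = 0) ->
  exists2 c, c \in lines t & forall v, on_line w c v -> form f v = 0.
Proof.
move=> t45 hX; have [a [b [hab fa fb ta tb]]] := two_forms f (w t).
have [x y|c [ct ca cb]] := line_in_plane (a := a) (b := b) t45.
  split; first by rewrite formD !formZ ta tb !mulr0 addr0.
  by apply: hX; rewrite formD !formZ fa fb !mulr0 addr0.
exists c => // v /(line_span K3 (lines_lt t45 ct) hc hab ca cb) [x [y ->]].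
by rewrite formD !formZ fa fb !mulr0 addr0.
Qed.

Lemma skew_line c : (c < 27)%N -> exists2 c', (c' < 27)%N &
  forall d w, config d w -> forall v, on_line w c v -> on_line w c' v -> v = 0.
Proof.
move: c; apply: label_ind => [|g c c27 [c' c'27 IH]].
  exists 0%N => // d' w' hc' v /line6_on [h1 h2] /on_lineP h.
  have e : [&& xc 0 1 < 45, 0 \in lines (xc 0 1), xc 0 2 < 45 & 0 \in lines (xc 0 2)]%N.
    by rewrite xcE; vm_compute.
  case/and4P: e => m1 m2 m3 m4.
  apply: (spans_vanish K3 hc' spans_base) => t; rewrite !inE => /or4P [] /eqP -> //;
    exact: h.
exists (label_table g c'); first exact: label_table_lt.
move=> d' w' hc' v h h'; apply: (IH _ _ (config_refl K3 g hc'));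
  by rewrite on_line_refl.
Qed.

Lemma cubic0 : cubic w 0 = 0.
Proof. by rewrite /cubic !form0 !mul0r subrr. Qed.

(** A plane in the surface meets each tritangent plane in one of its lines. Hence
    it contains one of the 27 lines and further lines of the surface, which
    makes it tritangent; but some tritangent triple has no line in common with
    a given one. *)
Lemma no_plane f : f != 0 -> ~ (forall v, form f v = 0 -> cubic w v = 0).
Proof.
move=> f0 hX; have t45 : (xc 0 1 < 45)%N by rewrite xcE; vm_compute.
have [c ct hcf] := plane_contains_line t45 hX; have c27 := lines_lt t45 ct.
have [u [u45 cu]] : exists u, (u < 45)%N /\ c \notin lines u.
  have /all_ltP h : all (fun c => has (fun u => c \notin lines u) (iota 0 45)) (iota 0 27).
    by vm_compute.
  have /hasP [u] := h c c27; rewrite mem_iota add0n => /andP [_ u45] cu; by exists u.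
have [a [b [hab fa fb ua ub]]] := two_forms f (w u).
have hfX x y : form f (x *: a + y *: b) = 0 /\ cubic w (x *: a + y *: b) = 0.
  have h : form f (x *: a + y *: b) = 0 by rewrite formD !formZ fa fb !mulr0 addr0.
  by split=> //; apply: hX.
have [t [k [tc k0 ef]]] : exists t k, [/\ t \in through c, k != 0 & f = k *: w t].
  have [ca|ca] := boolP (on_line w c a); last first.
    exact: (residual_line K2 K3 c27 hc f0 hcf (conj hab hfX) ca).
  have [cb|cb] := boolP (on_line w c b); last first.
    have hfX' x y : form f (x *: b + y *: a) = 0 /\ cubic w (x *: b + y *: a) = 0.
      by rewrite addrC.
    exact: (residual_line K2 K3 c27 hc f0 hcf (conj (indep_sym hab) hfX') cb).
  have [v hv] := line_off_plane K3 c27 u45 cu hc.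
  have [x [y ->]] := line_span K3 c27 hc hab ca cb hv.
  by rewrite formD !formZ ua ub !mulr0 addr0 eqxx.
have t45' : (t < 45)%N by move: tc; rewrite mem_through => /andP [].
have [u' [u'45 dis]] : exists u, (u < 45)%N /\ {in lines u, forall c, c \notin lines t}.
  have /all_ltP h : all (fun t => has (fun u => all (fun c => c \notin lines t) (lines u))
    (iota 0 45)) (iota 0 45) by vm_compute.
  have /hasP [u'] := h t t45'; rewrite mem_iota add0n => /andP [_ u'45] /allP hu'.
  by exists u'.
have [c' c'u' hc'] := plane_contains_line u'45 hX.
have c'27 := lines_lt u'45 c'u'.
have [v hv] := line_off_plane K3 c'27 t45' (dis _ c'u') hc.
move/negP; apply; apply/eqP; apply: (mulfI k0); rewrite mulr0 -form_scale -ef.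
exact: hc'.
Qed.

(** Proportional forms vanish on the same lines, and two tritangent triples share
    at most one line. *)
Lemma plane_inj t u k : (t < 45)%N -> (u < 45)%N -> k != 0 -> w t = k *: w u -> t = u.
Proof.
move=> t45 u45 k0 e; have [j1 [j2 [j3 [lt l1 l2 l3 n12]]]] := size_lines t45.
have sub c : c \in lines t -> c \in lines u.
  move=> ct; apply/negPn/negP => cu.
  have [v hv] := line_off_plane K3 (lines_lt t45 ct) u45 cu hc.
  move/negP; apply; apply/eqP; apply: (mulfI k0); rewrite mulr0 -form_scale -e.
  by move/on_lineP: hv; apply.
by apply: (two_common_lines t45 u45 n12); rewrite ?sub // lt !inE eqxx ?orbT.
Qed.

Section CayleySalmonForms.
Variables L M : 'I_3 -> 'cV[K]_4.
Hypothesis hLM : forall v, v != 0 ->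
  (cubic w v = 0) <-> (\prod_i form (L i) v = \prod_i form (M i) v).

Lemma LM_surface i j v : form (L i) v = 0 -> form (M j) v = 0 -> cubic w v = 0.
Proof.
move=> h1 h2; have [->|v0] := eqVneq v 0; first exact: cubic0.
apply/(hLM v0); rewrite (bigD1 i) //= h1 mul0r.
by rewrite (bigD1 j) //= h2 mul0r.
Qed.

Lemma L_neq0 i : L i != 0.
Proof.
apply/eqP => Li0; have hX v : form (M 0) v = 0 -> cubic w v = 0.
  by apply: (LM_surface (i := i)); rewrite Li0 /form mulmx0 mxE.
have [M0|M0] := eqVneq (M 0) 0; last exact: no_plane M0 hX.
apply: (@no_plane (const_mx 1)).
  by apply/eqP => /colP /(_ 0) /eqP; rewrite !mxE oner_eq0.
by move=> v _; apply: hX; rewrite M0 /form mulmx0 mxE.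
Qed.

(** The line l_i = m_0 = 0 is one of the 27, so [residual_line] applies as soon as
    the plane contains a second line of the surface. *)
Lemma L_tritangent i : exists t k, [/\ (t < 45)%N, k != 0 & L i = k *: w t].
Proof.
suff [c [c27 hcL [a [b [h na]]]]] : exists c, [/\ (c < 27)%N,
    forall v, on_line w c v -> form (L i) v = 0
  & exists a b, contains_line w (L i) a b /\ ~~ on_line w c a].
  have [t [k [tc k0 e]]] := residual_line K2 K3 c27 hc (L_neq0 i) hcL h na.
  by exists t, k; split=> //; move: tc; rewrite mem_through => /andP [].
have comb j a b x y : form (L i) a = 0 -> form (L i) b = 0 -> form (M j) a = 0 ->
    form (M j) b = 0 -> form (L i) (x *: a + y *: b) = 0 /\ cubic w (x *: a + y *: b) = 0.
  move=> la lb ma mb; have h : form (L i) (x *: a + y *: b) = 0.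
    by rewrite formD !formZ la lb !mulr0 addr0.
  by split=> //; apply: (LM_surface h (j := j)); rewrite formD !formZ ma mb !mulr0 addr0.
have [a [b [hab la lb ma mb]]] := two_forms (L i) (M 0).
have [x y|c [c27 ca cb]] := known_line hab.
  by have [] := comb 0 a b x y la lb ma mb.
exists c; split=> //.
  move=> v /(line_span K3 c27 hc hab ca cb) [x [y ->]].
  by rewrite formD !formZ la lb !mulr0 addr0.
(* A skew line meets the plane in a point of the surface off the first line. *)
have [c' c'27 sk] := skew_line c27.
have [e [f [hef c'e c'f _]]] := line_has_basis K3 c'27 hc.
have [z [z0 c'z lz]] : exists z, [/\ z != 0, on_line w c' z & form (L i) z = 0].
  have [le|le] := eqVneq (form (L i) e) 0.
    by exists e; split=> //; apply: comb_indep_neq0 hef.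
  exists (form (L i) f *: e + (- form (L i) e) *: f); split.
  - by apply/eqP => /hef [_ /eqP]; rewrite oppr_eq0 (negbTE le).
  - exact: on_line_comb.
  - by rewrite formD !formZ; ring.
have cz : ~~ on_line w c z by apply: contra z0 => cz; apply/eqP; apply: (sk _ _ hc).
have [j mz] : exists j, form (M j) z = 0.
  have /(hLM z0) := cubic_on_line K3 c'27 hc c'z.
  rewrite (bigD1 i) //= lz mul0r => /esym /eqP /prodf_eq0 [j _ /eqP mz]; by exists j.
have [a1 [b1 [hab1 la1 lb1 ma1 mb1]]] := two_forms (L i) (M j).
have [ca1|ca1] := boolP (on_line w c a1); last first.
  by exists a1, b1; split=> //; split=> // x y; apply: (comb j).
exists z, a1; split=> //; split=> [x y e0|x y]; last exact: (comb j).
have x0 : x = 0.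
  apply/eqP/negPn/negP => x0; case/negP: cz.
  have -> : z = (- (x^-1 * y)) *: a1 + 0 *: a1.
    rewrite scale0r addr0 scaleNr; apply: (scalerI x0).
    by rewrite scalerN scalerA mulrA mulfV // mul1r; apply/eqP; rewrite -addr_eq0 e0.
  exact: on_line_comb.
move/eqP: e0; rewrite x0 scale0r add0r scaler_eq0 (negbTE (comb_indep_neq0 hab1)) orbF.
by move=> /eqP.
Qed.
End CayleySalmonForms.

(** Each of the three lines of the plane l_i = 0 lies on the surface, so
    m_1 m_2 m_3 vanishes on it and it lies in one of the planes m_j = 0. *)
Lemma cayley_salmon_planes (L M : 'I_3 -> 'cV[K]_4) :
  (forall v, v != 0 ->
     (cubic w v = 0) <-> (\prod_i form (L i) v = \prod_i form (M i) v)) ->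
  exists (T U : 'I_3 -> nat) (k k' : 'I_3 -> K) (n : nat),
    [/\ forall i, [/\ (T i < 45)%N, k i != 0 & L i = k i *: w (T i)],
        forall i, [/\ (U i < 45)%N, k' i != 0 & M i = k' i *: w (U i)],
        (n < 120)%N
      & same_pair (map T (enum 'I_3), map U (enum 'I_3)) (pair_at n)].
Proof.
move=> hLM; have hML v : v != 0 ->
    (cubic w v = 0) <-> (\prod_i form (M i) v = \prod_i form (L i) v).
  by move=> /hLM h; split=> [/h ->|/esym /h].
have [T hT] := fin_all_exists (L_tritangent hLM).
have [k hk] := fin_all_exists hT.
have [U hU] := fin_all_exists (L_tritangent hML).
have [k' hk'] := fin_all_exists hU.
have TU i j : T i != U j.
  apply/eqP => e; have [t45 ki eL] := hk i; have [_ _ eM] := hk' j.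
  apply: (no_plane (L_neq0 hLM i)) => v h; apply: (LM_surface hLM h (j := j)).
  move/eqP: h; rewrite eL e form_scale mulf_eq0 (negbTE ki) => /eqP hz.
  by rewrite eM form_scale hz mulr0.
have cov (L' M' : 'I_3 -> 'cV[K]_4) (T' U' : 'I_3 -> nat) (q q' : 'I_3 -> K) :
    (forall v, v != 0 ->
     (cubic w v = 0) <-> (\prod_i form (L' i) v = \prod_i form (M' i) v)) ->
    (forall i, [/\ (T' i < 45)%N, q i != 0 & L' i = q i *: w (T' i)]) ->
    (forall i, [/\ (U' i < 45)%N, q' i != 0 & M' i = q' i *: w (U' i)]) ->
    forall i, covered (T' i) (map U' (enum 'I_3)).
  move=> h hq hq' i; apply/allP => c ct; have [t45 qi eL] := hq i.
  have c27 := lines_lt t45 ct; have [a [b [hab ca cb hs]]] := line_has_basis K3 c27 hc.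
  have onU x y : has (fun j => form (w j) (x *: a + y *: b) == 0)
      [:: U' 0; U' 1; U' (inord 2)].
    have cl := on_line_comb x y ca cb; set v := x *: a + y *: b in cl *.
    have [v0|v0] := eqVneq v 0; first by rewrite /= v0 form0 eqxx.
    have := cubic_on_line K3 c27 hc cl; move/(h v v0).
    rewrite (bigD1 i) //= eL form_scale (on_lineP _ _ _ cl _ t45 ct) mulr0 mul0r.
    move=> /esym /eqP /prodf_eq0 [j _]; have [_ qj ->] := hq' j.
    rewrite form_scale mulf_eq0 (negbTE qj) /= => hj.
    case: j hj {qj} => [[|[|[|//]]] j3] hj.
    - by rewrite (_ : 0 = Ordinal j3) ?hj //; apply: val_inj.
    - by rewrite (_ : 1 = Ordinal j3) ?hj ?orbT //; apply: val_inj.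
    - by rewrite (_ : inord 2 = Ordinal j3) ?hj ?orbT //; apply: val_inj; rewrite /= inordK.
  have hlin j u v x y : form (w j) u == 0 -> form (w j) v == 0 ->
      form (w j) (x *: u + y *: v) == 0.
    by move=> /eqP hu /eqP hv; rewrite formD !formZ hu hv !mulr0 addr0.
  have /hasP [u uU /andP [/eqP ua /eqP ub]] :=
    line_in_union K2 (Q := fun j v => form (w j) v == 0) hlin onU.
  have [j eu] : exists j, u = U' j.
    by move: uU; rewrite !inE => /or3P [] /eqP ->; eexists.
  apply/hasP; exists u; first by rewrite eu map_f // mem_enum.
  have [u45 _ _] := hq' j; rewrite -eu in u45.
  apply/negPn/negP => cu; have [v hv] := line_off_plane K3 c27 u45 cu hc.
  by have [x [y ->]] := hs _ hv; rewrite formD !formZ ua ub !mulr0 addr0 eqxx.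
have [|||||||n n120 hn] := @trihedral_of_cover (map T (enum 'I_3)) (map U (enum 'I_3)).
- by rewrite size_map size_enum_ord.
- by rewrite size_map size_enum_ord.
- by move=> t /mapP [i _ ->]; have [] := hk i.
- by move=> t /mapP [i _ ->]; have [] := hk' i.
- by move=> t u /mapP [i _ ->] /mapP [j _ ->]; apply: TU.
- by move=> t /mapP [i _ ->]; apply: (cov _ _ _ _ _ _ hLM hk hk').
- by move=> t /mapP [i _ ->]; apply: (cov _ _ _ _ _ _ hML hk' hk).
by exists T, U, k, k', n.
Qed.
End Classification.

(** * Genericity of the parameters *)

Section Genericity.
Variable K : fieldType.
Variable d : 'I_6 -> K.
Hypothesis gen : generic_parameters d.

Lemma eval_plane_point i (q : {mpoly K[3]}) :
  q.@[fun k => plane_point d i 0 k] = q.@[fun k => nth 0 [:: 1; d i; d i ^+ 3] k].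
Proof.
apply: meval_eq => -[[|[|[|//]]] k3]; rewrite mxE /= ?expr0 ?expr1 //.
Qed.

Let x0 : {mpoly K[3]} := 'X_(@Ordinal 3 0 isT).
Let x1 : {mpoly K[3]} := 'X_(@Ordinal 3 1 isT).
Let x2 : {mpoly K[3]} := 'X_(@Ordinal 3 2 isT).

Lemma homogX k : ('X_k : {mpoly K[3]}) \is 1.-homog.
Proof. by rewrite dhomogX /= mdeg1. Qed.

Lemma generic_distinct i j : i != j -> d i != d j.
Proof.
have [h _ _] := gen; move=> /h; apply: contraNneq => e.
suff -> : plane_point d i = plane_point d j by rewrite submx_refl.
by apply/rowP => k; rewrite !mxE e.
Qed.

(** Three points of the cuspidal curve with d_i + d_j + d_k = 0 are collinear:
    their parameters are the roots of a polynomial t^3 + a t + b. *)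
Lemma generic_triple i j k : uniq [:: i; j; k] -> d i + d j + d k != 0.
Proof.
have [_ h _] := gen; rewrite /= !inE negb_or => /andP [/andP [ij ik] /andP [jk _]].
apply/eqP => s0; apply: (h [set i; j; k]).
  by rewrite setUC cardsU1 cards2 ij !inE ![k == _]eq_sym negb_or ik jk.
pose a := d i * d j + d i * d k + d j * d k; pose b := - (d i * d j * d k).
exists (x2 + a *: x1 + b *: x0); split.
- have : (x2 + a *: x1 + b *: x0).@[fun l => ((l : nat) == 2)%:R] = 1.
    by rewrite !mevalD !mevalZ !mevalXU /= !mulr0 !addr0.
  by apply: contra_eqN => /eqP ->; rewrite meval0 eq_sym oner_eq0.
- by rewrite !rpredD ?rpredZ ?homogX.
- have dk : d k = - (d i + d j) by apply/eqP; rewrite -addr_eq0 addrC s0.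
  move=> l; rewrite eval_plane_point !mevalD !mevalZ !mevalXU /=.
  by rewrite !inE => /orP [/orP [] /eqP ->|/eqP ->]; rewrite /a /b dk; ring.
Qed.

(** Six points with d_1 + ... + d_6 = 0 lie on a conic: the coefficient of t^5 in
    the product of the t - d_i vanishes, and the other powers of t up to 6 are
    products of two coordinates. *)
Lemma generic_sum : \sum_i d i != 0.
Proof.
have [_ _ h] := gen; apply/eqP => s0; apply: h.
pose ps := [seq d i | i <- enum 'I_6].
pose p := \prod_(x <- ps) ('X - x%:P).
have sps : size ps = 6%N by rewrite size_map size_enum_ord.
have sp : size p = 7%N by rewrite /p size_prod_XsubC sps.
have p5 : p`_5 = 0.
  have := coefPn_prod_XsubC (ps := ps); rewrite sps /= -/p => -> //.
  by rewrite /ps big_map big_enum s0 oppr0.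
have p6 : p`_6 = 1.
  have : lead_coef p = 1 by apply/eqP; apply: monic_prod_XsubC.
  by rewrite lead_coefE sp.
have root i : \sum_(k < 7) p`_k * d i ^+ k = 0.
  rewrite -horner_coef_wide ?sp //; apply/eqP; rewrite -/(root p (d i)) root_prod_XsubC.
  by apply: map_f; rewrite mem_enum.
exists (x2 * x2 + p`_4 *: (x1 * x2) + p`_3 *: (x0 * x2) + p`_2 *: (x1 * x1)
        + p`_1 *: (x0 * x1) + p`_0 *: (x0 * x0)); split.
- set q := (X in X != 0); have : q.@[fun l => ((l : nat) == 2)%:R] = 1.
    by rewrite /q !mevalD !mevalZ !mevalM !mevalXU /= !(mul0r, mulr0) !addr0 mulr1.
  by apply: contra_eqN => /eqP ->; rewrite meval0 eq_sym oner_eq0.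
- by rewrite !rpredD ?rpredZ // (dhomogM (homogX _) (homogX _)).
- move=> i _; rewrite eval_plane_point !mevalD !mevalZ !mevalM !mevalXU /=.
  have := root i; rewrite !big_ord_recl big_ord0 /= /bump /= p5 p6 => e.
  by rewrite -[RHS]e; ring.
Qed.

Lemma generic_roots : roots_ok (params d).
Proof.
have inj a b : (a < 6)%N -> (b < 6)%N -> a != b -> @inord 5 a != inord b.
  by move=> a6 b6; rewrite inord_inj6.
split=> [a b a6 b6 ab|a b c a6 b6 c6 /= |].
- by rewrite subr_eq0 generic_distinct ?inj.
- rewrite !inE negb_or => /andP [/andP [ab ac] /andP [bc _]].
  by apply: generic_triple; rewrite /= !inE negb_or !inj.
- have := generic_sum; rewrite !big_ord_recl big_ord0 /=.
  congr (_ != 0); rewrite /params addr0 !addrA.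
  by congr (_ + _ + _ + _ + _ + _); congr d; apply: val_inj; rewrite /= inordK.
Qed.
End Genericity.

(** * Binomials *)

Section Binomials.
Variable K : fieldType.
Hypothesis char0 : [pchar K] =i pred0.

Lemma natr_neq0 n : (0 < n)%N -> n%:R != 0 :> K.
Proof. by move=> n0; rewrite (pcharf0P _).1 // -lt0n. Qed.

Definition indicator (S : seq nat) (k : 'I_ntri) : K := (k \in map tri_of S)%:R.

Lemma mem_map_tri_of S k : {in S, forall t, (t < 45)%N} -> (k < 45)%N ->
  (tri_of k \in map tri_of S) = (k \in S).
Proof.
move=> S45 k45; apply/mapP/idP => [[t tS /(tri_of_inj k45 (S45 t tS)) ->] //|kS].
by exists k.
Qed.

Lemma prod_indicator S l : {in S, forall t, (t < 45)%N} -> {in l, forall t, (t < 45)%N} ->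
  \prod_(k <- l) indicator S (tri_of k) = (all (mem S) l)%:R.
Proof.
move=> S45; elim: l => [|k l IH] l45; first by rewrite big_nil.
rewrite big_cons IH => [|t tl]; last by apply: l45; rewrite inE tl orbT.
by rewrite /indicator mem_map_tri_of ?l45 ?mem_head //= -natrM mulnb.
Qed.

Lemma natr_inj m n : m%:R = n%:R :> K -> m = n.
Proof.
wlog mn : m n / (m <= n)%N => [h e|e].
  by have [/h->|/ltnW/h->] := leqP m n.
apply/eqP; rewrite eqn_leq mn leqNgt -subn_gt0; apply/negP => /natr_neq0 /eqP; apply.
by rewrite natrB // e subrr.
Qed.

Lemma bool_diff (a b c e : bool) : a%:R - b%:R = c%:R - e%:R :> K ->
  (a + e = c + b)%N.
Proof.
move=> h; apply: natr_inj; rewrite !natrD; apply/eqP; rewrite -subr_eq0; apply/eqP.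
by rewrite -[RHS](subrr (a%:R - b%:R)) {2}h; ring.
Qed.

(** Evaluating at the points all of whose coordinates are 0 or 1 recovers the two
    sets of variables. As A and B are disjoint, at the points given by A and
    by B only one monomial survives, which prevents cancellation. *)
Lemma binomial_inj (A B t u : seq nat) :
  size A = 3%N -> size B = 3%N -> size t = 3%N -> size u = 3%N ->
  uniq A -> uniq B -> {in A, forall k, k \notin B} ->
  {in A ++ B ++ t ++ u, forall k, (k < 45)%N} ->
  binomial K A B = binomial K t u -> perm_eq A t && perm_eq B u.
Proof.
move=> sA sB st su uA uB AB h45 E.
have [A45 B45 t45 u45] : [/\ {in A, forall k, (k < 45)%N}, {in B, forall k, (k < 45)%N},
    {in t, forall k, (k < 45)%N} & {in u, forall k, (k < 45)%N}].
  by split=> k hk; apply: h45; rewrite !mem_cat hk ?orbT.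
have ev (S : seq nat) : {in S, forall k, (k < 45)%N} ->
    (all (mem S) A + all (mem S) u = all (mem S) t + all (mem S) B)%N.
  move=> S45; apply: bool_diff.
  rewrite -(prod_indicator S45 A45) -(prod_indicator S45 B45).
  rewrite -(prod_indicator S45 t45) -(prod_indicator S45 u45).
  by rewrite -!eval_binomial E.
have self (l : seq nat) : all (mem l) l by apply/allP.
have disj (s s' : seq nat) : size s = 3%N -> {in s, forall k, k \notin s'} -> all (mem s') s = false.
  case: s => [//|k s] _ h; apply/negbTE/allPn; exists k; rewrite ?mem_head //.
  by apply: h; rewrite mem_head.
have BA : {in B, forall k, k \notin A}.
  by move=> k kB; apply/negP => /AB; rewrite kB.
have := ev A A45; rewrite self (disj B A) //.
have := ev B B45; rewrite self (disj A B) //.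
case tA : (all (mem A) t); case uA' : (all (mem A) u) => //;
  case tB : (all (mem B) t); case uB' : (all (mem B) u) => // _ _.
have ut : all (mem t) u = false.
  apply: disj => // k /(allP uB') kB; apply/negP => /(allP tA) kA.
  by have := AB k kA; rewrite (kB : k \in B).
have tu : all (mem u) t = false.
  apply: disj => // k /(allP tA) kA; apply/negP => /(allP uB') kB.
  by have := AB k kA; rewrite (kB : k \in B).
have full (s s' : seq nat) : size s = 3%N -> size s' = 3%N -> uniq s -> all (mem s') s -> perm_eq s s'.
  move=> z z' us /allP sub; have le : (size s' <= size s)%N by rewrite z z'.
  apply: uniq_perm => //; first exact: leq_size_uniq us sub le.
  by have [_] := uniq_min_size us sub le.
have := ev t t45; rewrite self ut; have := ev u u45; rewrite self tu.
case Au : (all (mem u) A); case Bu : (all (mem u) B) => // _;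
  case At : (all (mem t) A); case Bt : (all (mem t) B) => // _.
by rewrite !full.
Qed.

Lemma binomial_opp A B : - binomial K A B = binomial K B A.
Proof. by rewrite /binomial opprB. Qed.

Lemma binomial_perm A B A' B' : perm_eq A A' -> perm_eq B B' ->
  binomial K A B = binomial K A' B'.
Proof. by move=> h h'; rewrite /binomial (perm_big _ h) (perm_big _ h'). Qed.

Definition cubic_at (i : 'I_120) : {mpoly K[ntri]} :=
  binomial K (pair_at i).1 (pair_at i).2.

Lemma cubic_at_word i : exists ws, cubic_at i =
  binomial K (map (tri_word ws) cubic_pos) (map (tri_word ws) cubic_neg).
Proof.
have [ws /andP [h1 h2]] := trihedral_word (ltn_ord i); exists ws.
by apply: esym; apply: binomial_perm.
Qed.

Lemma cubic_at_enumerates (d : 'I_6 -> K) :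
  enumerates_up_to_sign cubic_at (conjugate_at d base_cubic).
Proof.
split=> [i|q|i j e].
- have [ws ->] := cubic_at_word i; apply/conjugate_at_cubicP; by exists ws.
- move=> /conjugate_at_cubicP [ws ->].
  have [n n120] := word_pair_trihedral ws; rewrite /same_pair.
  by move=> /orP [] /andP [h1 h2]; exists (Ordinal n120);
    [left | right; rewrite binomial_opp]; apply: binomial_perm.
- have [i1 i2 i3 i4 i5] := pair_atP (ltn_ord i).
  have [j1 j2 j3 j4 j5] := pair_atP (ltn_ord j).
  have dis := fun k => @pair_at_disjoint i k (ltn_ord i).
  apply: val_inj; apply: (pair_at_inj (ltn_ord i) (ltn_ord j)).
  rewrite /same_pair; apply/orP.
  have lt45 k : k \in ((pair_at i).1 ++ (pair_at i).2) ++ ((pair_at j).1 ++ (pair_at j).2) ->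
      (k < 45)%N.
    by rewrite mem_cat => /orP [/i5|/j5].
  have lt45' k : k \in ((pair_at i).1 ++ (pair_at i).2) ++ ((pair_at j).2 ++ (pair_at j).1) ->
      (k < 45)%N.
    by move=> hk; apply: lt45; move: hk; rewrite !mem_cat [X in _ || X]orbC.
  rewrite -!catA in lt45 lt45'.
  case: e => [e|]; first by left; apply: (binomial_inj i1 i2 j1 j2 i3 i4 dis lt45 e).
  rewrite binomial_opp => e; right.
  exact: (binomial_inj i1 i2 j2 j1 i3 i4 dis lt45' e).
Qed.
End Binomials.

(** * The linear span of the surface *)

Section LinearPolynomials.
Variable K : fieldType.
Implicit Types f g : 'cV[K]_4.

Definition linpoly f : {mpoly K[4]} := \sum_i f i 0 *: 'X_i.

Lemma eval_linpoly f (v : 'rV[K]_4) : (linpoly f).@[fun k => v 0 k] = form f v.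
Proof.
rewrite /linpoly raddf_sum /form mxE; apply: eq_bigr => i _.
by rewrite /= mevalZ mevalXU mulrC.
Qed.

Lemma linpoly_homog f : linpoly f \is 1.-homog.
Proof. by apply: rpred_sum => i _; rewrite rpredZ // dhomogX /= mdeg1. Qed.

Lemma homog_linpoly (p : {mpoly K[4]}) : p \is 1.-homog -> exists f, p = linpoly f.
Proof.
move=> hp; exists (\col_i p@_U_(i)); apply/mpolyP => m.
have [/mdeg1P [i /eqP ->]|m1] := boolP (mdeg m == 1%N).
  rewrite /linpoly raddf_sum /= (bigD1 i) //= mcoeffZ mcoeffXU eqxx mulr1 mxE.
  rewrite big1 ?addr0 // => j ji; by rewrite mcoeffZ mcoeffXU (negbTE ji) mulr0.
by rewrite (dhomog_nemf_coeff hp m1) (dhomog_nemf_coeff (linpoly_homog _) m1).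
Qed.

Lemma linpolyZ k f : linpoly (k *: f) = k *: linpoly f.
Proof.
by rewrite /linpoly scaler_sumr; apply: eq_bigr => i _; rewrite mxE scalerA.
Qed.

Lemma linpoly_inj : injective linpoly.
Proof. by move=> f g e; apply: form_eq => v; rewrite -!eval_linpoly e. Qed.
End LinearPolynomials.

Lemma mul_delta3 (K : fieldType) n (s : 'rV[K]_n) (a b c : K) i j k :
  (s *m (a *: delta_mx i 0 - b *: delta_mx j 0 + c *: delta_mx k 0 : 'cV_n)) 0 0
  = a * s 0 i - b * s 0 j + c * s 0 k.
Proof.
have D l : (s *m (delta_mx l 0 : 'cV_n)) 0 0 = s 0 l by rewrite -colE mxE.
have Z x l : (s *m (x *: (delta_mx l 0 : 'cV_n))) 0 0 = x * s 0 l.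
  by rewrite -scalemxAr mxE D.
have E (A B C : 'M[K]_1) : (A - B + C) 0 0 = A 0 0 - B 0 0 + C 0 0 by rewrite !mxE.
by rewrite mulmxDr mulmxBr E !Z.
Qed.

Lemma eq_base_form (K : fieldType) (d d' w w' : nat -> K) :
  (forall a, (a < 6)%N -> d a = d' a) -> (forall t, (t < 45)%N -> w t = w' t) ->
  base_form d w = base_form d' w'.
Proof.
move=> hd hw; have /and3P [m1 m2 m3] : [&& xc 1 0 < 45, xc 2 0 < 45 & xc 3 0 < 45]%N.
  by rewrite xcE; vm_compute.
rewrite /base_form -xcE (hw _ m1) (hw _ m2) (hw _ m3).
by rewrite (hd 0%N isT) (hd 1%N isT) (hd 2 isT) (hd 3 isT).
Qed.

Section SpanOfSurface.
Variable K : fieldType.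
Hypothesis char0 : [pchar K] =i pred0.
Variables (d : 'I_6 -> K) (M : 'M[K]_(4, ntri)).
Hypothesis gen : generic_parameters d.
Hypothesis onto : linear_map_onto M (spaceLS d).

Definition forms (t : nat) : 'cV[K]_4 := col (tri_of t) M.

Lemma formsE t v : form (forms t) v = (v *m M) 0 (tri_of t).
Proof. by rewrite /form /forms !mxE; apply: eq_bigr => i _; rewrite mxE. Qed.

Lemma generator_ideal f : generatorI d f -> idealI d f.
Proof.
move=> hf; exists 1%N, (fun=> 1), (fun=> f); split=> //.
by rewrite big_ord1 mul1r.
Qed.

(** A linear form that vanishes on S vanishes on the span of S. *)
Lemma span_relations ws v :
  base_form (param_word ws (params d)) (fun t => form (forms (tri_word ws t)) v) = 0.
Proof.
have [Q hQ ev] := word_conjugate (@base_linear K) ws.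
pose dw := param_word ws (params d).
pose C : 'cV[K]_ntri :=
  ((dw 2 - dw 3) * (dw 0%N + dw 2 + dw 3)) *: delta_mx (tri_of (tri_word ws (xcode 1 0))) 0
  - ((dw 1%N - dw 3) * (dw 0%N + dw 1%N + dw 3)) *: delta_mx (tri_of (tri_word ws (xcode 2 0))) 0
  + ((dw 1%N - dw 2) * (dw 0%N + dw 1%N + dw 2)) *: delta_mx (tri_of (tri_word ws (xcode 3 0))) 0.
have CE (s : 'rV[K]_ntri) :
    (s *m C) 0 0 = base_form dw (fun t => s 0 (tri_of (tri_word ws t))).
  exact: mul_delta3.
have [_ hL] := onto.
have /(_ (kermx C)) : spaceLS d (v *m M) by apply/hL; exists v.
move=> /(_ _) hW; have {hW} /sub_kermxP h : (v *m M <= kermx C)%MS.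
  apply: hW => s [_ hs]; apply/sub_kermxP; apply/matrixP => i j.
  rewrite !ord1 [RHS]mxE CE.
  have hz : eval_at d (fun k => s 0 k) Q = 0.
    by apply: (hs (specialize d Q)); apply: generator_ideal; left; exists Q.
  have [d' [w' [e1 e2 e3]]] := ev d (fun k => s 0 k).
  rewrite -[RHS]hz e1 eval_base_linear; apply: eq_base_form => [a a6|t t45].
    by rewrite e2.
  by rewrite e3.
have := CE (v *m M); rewrite h [LHS]mxE => hz; rewrite [RHS]hz.
by apply: eq_base_form => [//|t t45]; apply: formsE.
Qed.

Lemma forms_config : config (params d) forms.
Proof.
have [rM _] := onto; split; first exact: generic_roots gen.
  exact: span_relations.
move=> v hv; apply/eqP; rewrite -(mulmx_free_eq0 v rM); apply/eqP/rowP => k.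
by have [t t45 <-] := tri_of_surj k; rewrite -formsE hv // mxE.
Qed.

Let K2 : 2%:R != 0 :> K := natr_neq0 char0 (isT : (0 < 2)%N).
Let K3 : 3%:R != 0 :> K := natr_neq0 char0 (isT : (0 < 3)%N).

Lemma eval_binomial3 (g : nat -> nat) a b c a' b' c' v :
  (binomial K (map g [:: a; b; c]) (map g [:: a'; b'; c'])).@[fun k => (v *m M) 0 k]
  = form (forms (g a)) v * form (forms (g b)) v * form (forms (g c)) v
    - form (forms (g a')) v * form (forms (g b')) v * form (forms (g c')) v.
Proof. by rewrite eval_binomial !big_map !big_prod3 !formsE. Qed.

Lemma eval_word_binomial ws v :
  (binomial K (map (tri_word ws) cubic_pos) (map (tri_word ws) cubic_neg)).@[fun k => (v *m M) 0 k]
  = cubic (forms \o tri_word ws) v.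
Proof. by rewrite /cubic xcE; exact: eval_binomial3. Qed.

Lemma eval_cubic_at i v :
  (cubic_at K i).@[fun k => (v *m M) 0 k] = 0 <-> cubic forms v = 0.
Proof.
have [ws ->] := cubic_at_word K i; rewrite eval_word_binomial.
exact: (cubic_word K3 ws v forms_config).
Qed.

(** The generators of the ideal restrict on the span either to zero or to nonzero
    multiples of one cubic. *)
Lemma preimage_cubic v : v != 0 ->
  preimage M (surfaceS d) v <-> cubic forms v = 0.
Proof.
move=> v0; have [rM _] := onto; split=> [[_ hI]|h].
  have gI : generatorI d (binomial K (map (tri_word [::]) cubic_pos) (map (tri_word [::]) cubic_neg)).
    by right; apply/conjugate_at_cubicP; exists [::].
  by have := hI _ (generator_ideal gI); rewrite eval_word_binomial.
split; first by rewrite mulmx_free_eq0.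
move=> f [n [a [g [hg ->]]]]; rewrite raddf_sum big1 //= => i _.
rewrite mevalM; suff -> : (g i).@[fun k => (v *m M) 0 k] = 0 by rewrite mulr0.
case: (hg i) => [[Q /conjugate_word [ws ev] ->]|/conjugate_at_cubicP [ws ->]].
  have [d' [w' [e1 e2 e3]]] := ev d (fun k => (v *m M) 0 k).
  rewrite -[LHS]/(eval_at d (fun k => (v *m M) 0 k) Q) e1 eval_base_linear.
  rewrite -[RHS](config_lin forms_config ws v); apply: eq_base_form => [a' a6|t t45].
    by rewrite e2.
  by rewrite e3 // formsE.
by rewrite eval_word_binomial; apply/(cubic_word K3 ws v forms_config).
Qed.

Lemma pullbackX k : pullback M 'X_k = linpoly (col k M).
Proof.
rewrite /pullback comp_mpolyXU -tnth_nth tnth_mktuple.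
by apply: eq_bigr => i _; rewrite mxE.
Qed.

Lemma pullback_binomial (t u : 'I_3 -> 'I_ntri) :
  pullback M (\prod_(i < 3) 'X_(t i) - \prod_(i < 3) 'X_(u i)) =
  \prod_(i < 3) pullback M 'X_(t i) - \prod_(i < 3) pullback M 'X_(u i).
Proof. by rewrite /pullback rmorphB !rmorph_prod. Qed.

Lemma eval_pullback f (v : 'rV[K]_4) :
  (pullback M f).@[fun k => v 0 k] = f.@[fun k => (v *m M) 0 k].
Proof.
rewrite /pullback comp_mpoly_meval; apply: meval_eq => k; rewrite tnth_mktuple.
by rewrite raddf_sum mxE /=; apply: eq_bigr => i _; rewrite mevalZ mevalXU mulrC.
Qed.

Lemma image_cayley_salmon i (l m : 'I_3 -> {mpoly K[4]}) :
  image_equation M (cubic_at K i) l m ->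
  pullback M (cubic_at K i) = \prod_(k < 3) l k - \prod_(k < 3) m k
  /\ CayleySalmon (preimage M (surfaceS d)) l m.
Proof.
move=> [t [u [e el em]]].
have E : pullback M (cubic_at K i) = \prod_(k < 3) l k - \prod_(k < 3) m k.
  by rewrite e pullback_binomial; congr (_ - _); apply: eq_bigr => k _; rewrite ?el ?em.
split=> //; split=> [k|k|v v0].
- by rewrite el pullbackX linpoly_homog.
- by rewrite em pullbackX linpoly_homog.
rewrite -E eval_pullback; apply: (iff_trans (preimage_cubic v0)).
by apply: iff_sym; apply: eval_cubic_at.
Qed.

Lemma prod_nth3 (R : comRingType) (F : nat -> R) (s : seq nat) : size s = 3%N ->
  \prod_(k <- s) F k = \prod_(i < 3) F (nth 0%N s i).
Proof. by move=> s3; rewrite (big_nth 0%N) s3 big_mkord. Qed.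

Lemma cubic_at_nth i : cubic_at K i =
  \prod_(k < 3) 'X_(tri_of (nth 0%N (pair_at i).1 k))
  - \prod_(k < 3) 'X_(tri_of (nth 0%N (pair_at i).2 k)).
Proof.
have [s1 s2 _ _ _] := pair_atP (ltn_ord i).
by rewrite /cubic_at /binomial !prod_nth3.
Qed.

Lemma image_exists i : exists l m, image_equation M (cubic_at K i) l m.
Proof.
exists (fun k => pullback M 'X_(tri_of (nth 0%N (pair_at i).1 k))).
exists (fun k => pullback M 'X_(tri_of (nth 0%N (pair_at i).2 k))).
exists (fun k => tri_of (nth 0%N (pair_at i).1 k)).
exists (fun k => tri_of (nth 0%N (pair_at i).2 k)).
by split=> //; apply: cubic_at_nth.
Qed.

Section EssentiallySame.
Variables (l m : 'I_3 -> {mpoly K[4]}) (T U : 'I_3 -> nat) (k k' : 'I_3 -> K).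
Hypothesis hT : forall i, [/\ (T i < 45)%N, k i != 0 & l i = linpoly (k i *: forms (T i))].
Hypothesis hU : forall i, [/\ (U i < 45)%N, k' i != 0 & m i = linpoly (k' i *: forms (U i))].

Lemma same_triple_perm (l1 : 'I_3 -> {mpoly K[4]}) (T1 t : 'I_3 -> nat) (k1 : 'I_3 -> K) :
  (forall i, [/\ (T1 i < 45)%N, k1 i != 0 & l1 i = linpoly (k1 i *: forms (T1 i))]) ->
  (forall i, (t i < 45)%N) ->
  same_triple l1 (fun i => pullback M 'X_(tri_of (t i))) <->
  perm_eq (map T1 (enum 'I_3)) (map t (enum 'I_3)).
Proof.
move=> h1 ht; split.
  move=> [s [c hs]].
  have e i : t i = T1 (s i).
    have [c0] := hs i; have [t45 k0 ->] := h1 (s i).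
    rewrite pullbackX -linpolyZ scalerA => /linpoly_inj e.
    exact: (plane_inj K3 forms_config (ht i) t45 (mulf_neq0 c0 k0) e).
  rewrite perm_sym; apply/(tuple_permP (t := [tuple T1 i | i < 3])); exists s.
  by apply: eq_map => i; rewrite e tnth_mktuple.
rewrite perm_sym => /(tuple_permP (t := [tuple T1 i | i < 3])) [s es].
exists s, (fun i => (k1 (s i))^-1) => i; have [_ k0 e] := h1 (s i).
split; first by rewrite invr_eq0.
have -> : t i = T1 (s i).
  have := congr1 (fun q => nth 0%N q i) es.
  rewrite (nth_map ord0) ?size_enum_ord // nth_ord_enum => ->.
  by rewrite (nth_map ord0) ?size_enum_ord // nth_ord_enum tnth_mktuple.
by rewrite e -linpolyZ scalerA mulVf // scale1r pullbackX.
Qed.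

Lemma same_triple_ext (l1 l2 l2' : 'I_3 -> {mpoly K[4]}) : l2 =1 l2' ->
  same_triple l1 l2 <-> same_triple l1 l2'.
Proof.
by move=> e; split=> [] [s [c h]]; exists s, c => i; have := h i; rewrite e.
Qed.

(** Turns the comparison of equations up to scaling and order into the comparison
    of pairs of tritangent triples, which are determined by their planes. *)
Lemma essentially_same_pair (i : 'I_120) :
  (exists l' m', image_equation M (cubic_at K i) l' m' /\ essentially_same l m l' m')
  <-> same_pair (map T (enum 'I_3), map U (enum 'I_3)) (pair_at i).
Proof.
have [s1 s2 u1 u2 p45] := pair_atP (ltn_ord i).
have enum_nth (s : seq nat) : size s = 3%N -> map (fun j : 'I_3 => nth 0%N s j) (enum 'I_3) = s.
  move=> s3; apply: (@eq_from_nth _ 0%N); rewrite size_map size_enum_ord // => j j3.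
  by rewrite (nth_map ord0) ?size_enum_ord // nth_enum_ord.
have sT := same_triple_perm hT; have sU := same_triple_perm hU.
split=> [[l' [m' [[t [u [e el em]]] hs]]]|].
  have [t' ht'] := fin_all_exists (fun j => let: ex_intro2 x p q := tri_of_surj (t j) in
     ex_intro (fun x => (x < 45)%N /\ tri_of x = t j) x (conj p q)).
  have [u' hu'] := fin_all_exists (fun j => let: ex_intro2 x p q := tri_of_surj (u j) in
     ex_intro (fun x => (x < 45)%N /\ tri_of x = u j) x (conj p q)).
  have t45 j : (t' j < 45)%N by have [] := ht' j.
  have u45 j : (u' j < 45)%N by have [] := hu' j.
  have lE : l' =1 (fun j => pullback M 'X_(tri_of (t' j))).
    by move=> j; rewrite el; have [_ ->] := ht' j.
  have mE : m' =1 (fun j => pullback M 'X_(tri_of (u' j))).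
    by move=> j; rewrite em; have [_ ->] := hu' j.
  have eb : binomial K (pair_at i).1 (pair_at i).2 =
      binomial K (map t' (enum 'I_3)) (map u' (enum 'I_3)).
    rewrite -/(cubic_at K i) e /binomial !big_map -!enumT !big_enum /=.
    by congr (_ - _); apply: eq_bigr => j _; [have [_ ->] := ht' j | have [_ ->] := hu' j].
  have /andP [p1 p2] : perm_eq (pair_at i).1 (map t' (enum 'I_3)) &&
      perm_eq (pair_at i).2 (map u' (enum 'I_3)).
    apply: binomial_inj eb => //; rewrite ?size_map -?enumT ?size_enum_ord //.
      by move=> x; apply: pair_at_disjoint.
    move=> x; rewrite catA mem_cat => /orP [/p45 //|].
    by rewrite mem_cat => /orP [] /mapP [j _ ->].
  have tE : perm_eq (map t' (enum 'I_3)) (pair_at i).1 by rewrite perm_sym.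
  have uE : perm_eq (map u' (enum 'I_3)) (pair_at i).2 by rewrite perm_sym.
  apply/orP; rewrite /=.
  case: hs => [] [h1 h2]; [left | right]; apply/andP; split.
  - by apply: perm_trans tE; apply/(sT _ t45)/(same_triple_ext _ lE).
  - by apply: perm_trans uE; apply/(sU _ u45)/(same_triple_ext _ mE).
  - by apply: perm_trans uE; apply/(sT _ u45)/(same_triple_ext _ mE).
  - by apply: perm_trans tE; apply/(sU _ t45)/(same_triple_ext _ lE).
have n1 (j : 'I_3) : (nth 0%N (pair_at i).1 j < 45)%N.
  by apply: p45; rewrite mem_cat mem_nth ?s1.
have n2 (j : 'I_3) : (nth 0%N (pair_at i).2 j < 45)%N.
  by apply: p45; rewrite mem_cat orbC mem_nth ?s2.
move=> h; exists (fun j => pullback M 'X_(tri_of (nth 0%N (pair_at i).1 j))).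
exists (fun j => pullback M 'X_(tri_of (nth 0%N (pair_at i).2 j))).
split.
  exists (fun j => tri_of (nth 0%N (pair_at i).1 j)).
  exists (fun j => tri_of (nth 0%N (pair_at i).2 j)).
  by split=> //; apply: cubic_at_nth.
case/orP: h => /= /andP [h1 h2]; [left | right]; split.
- by apply/(sT _ n1); rewrite enum_nth.
- by apply/(sU _ n2); rewrite enum_nth.
- by apply/(sT _ n2); rewrite enum_nth.
- by apply/(sU _ n1); rewrite enum_nth.
Qed.
End EssentiallySame.
End SpanOfSurface.

Theorem proposition4p1 (K : closedFieldType) (d : 'I_6 -> K)
    (M : 'M[K]_(4, ntri)) :
  [pchar K] =i pred0 ->
  generic_parameters d ->
  linear_map_onto M (spaceLS d) ->
  exists c : 'I_120 -> {mpoly K[ntri]},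
    [/\ enumerates_up_to_sign c (conjugate_at d base_cubic),
        forall i : 'I_120,
          (exists l m : 'I_3 -> {mpoly K[4]}, image_equation M (c i) l m)
          /\ (forall l m : 'I_3 -> {mpoly K[4]}, image_equation M (c i) l m ->
                pullback M (c i) = \prod_(k < 3) l k - \prod_(k < 3) m k
                /\ CayleySalmon (preimage M (surfaceS d)) l m)
      & forall l m : 'I_3 -> {mpoly K[4]},
          CayleySalmon (preimage M (surfaceS d)) l m ->
          exists! i : 'I_120,
            exists l' m' : 'I_3 -> {mpoly K[4]},
              image_equation M (c i) l' m' /\ essentially_same l m l' m'].
Proof.
move=> char0 gen onto; exists (@cubic_at K).
split=> [|i|l m [hl hm hX]].
- exact: cubic_at_enumerates.
- by split; [exact: image_exists | move=> l m; exact: image_cayley_salmon].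
have hc := forms_config gen onto.
have [L eL] := fin_all_exists (fun i => homog_linpoly (hl i)).
have [N eN] := fin_all_exists (fun i => homog_linpoly (hm i)).
have hLN v : v != 0 -> (cubic (forms M) v = 0) <->
    (\prod_i form (L i) v = \prod_i form (N i) v).
  move=> v0; apply: (iff_trans (iff_sym (preimage_cubic char0 gen onto v0))).
  apply: (iff_trans (hX v v0)); rewrite mevalB !rmorph_prod /=.
  have -> : \prod_i (l i).@[fun k => v 0 k] = \prod_i form (L i) v.
    by apply: eq_bigr => i _; rewrite eL eval_linpoly.
  have -> : \prod_i (m i).@[fun k => v 0 k] = \prod_i form (N i) v.
    by apply: eq_bigr => i _; rewrite eN eval_linpoly.
  by split=> [/eqP|->]; rewrite ?subrr // subr_eq0 => /eqP.
have K2 : 2%:R != 0 :> K := natr_neq0 char0 (isT : (0 < 2)%N).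
have K3 : 3%:R != 0 :> K := natr_neq0 char0 (isT : (0 < 3)%N).
have [T [U [k [k' [n [hT hU n120 hn]]]]]] := cayley_salmon_planes K2 K3 hc hLN.
have same := @essentially_same_pair K char0 d M gen onto l m T U k k'.
have {}same := same (fun i => let: And3 a b c := hT i in
  And3 a b (eq_trans (eL i) (congr1 (@linpoly K) c))).
have {}same := same (fun i => let: And3 a b c := hU i in
  And3 a b (eq_trans (eN i) (congr1 (@linpoly K) c))).
exists (Ordinal n120); split; first exact/same.
move=> j /same hj; apply: val_inj; apply: (pair_at_inj n120 (ltn_ord j)).
by apply: same_pair_trans hj; rewrite same_pair_sym.
Qed.
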